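(* For every integer $p\geq 1$ there is a combinatorial constant $\kappa_p\in(0,\infty)$, depending only on $p$, such that the following holds. Let $n\geq p$ be an integer, let $X_1,\dotsc,X_n$ be independent random variables on a probability space $(\Omega,\mathcal{F},\mathbb{P})$ with values in measurable spaces $(E_1,\mathcal{E}_1),\dotsc,(E_n,\mathcal{E}_n)$, respectively, and let $W\in L^4(\mathbb{P})$ be a completely degenerate, not necessarily symmetric $U$-statistic of order $p$, based on $X_1,\dotsc,X_n$, with $\mathrm{Var}(W)=\mathbb{E}[W^2]=1$. Then \[ \sup_{t\in\mathbb{R}}\bigl|\mathbb{P}(W\leq t)-\Phi(t)\bigr|\leq 11.9\sqrt{\bigl|\mathbb{E}[W^4]-3\bigr|}+\bigl(3.5+10.8\sqrt{\kappa_p}\bigr)\varrho_n . \]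
   Context: Write $[n]=\{1,\dotsc,n\}$ and $\mathcal{D}_p(n)=\{J\subseteq[n]:|J|=p\}$. Let $f:\prod_{j=1}^nE_j\to\mathbb{R}$ be measurable with respect to $\bigotimes_{j=1}^n\mathcal{E}_j$ and the Borel $\sigma$-field, with $W=f(X_1,\dotsc,X_n)\in L^1(\mathbb{P})$. Then $W$ has a $\mathbb{P}$-a.s. unique decomposition (Hoeffding decomposition) $W=\sum_{J\subseteq[n]}W_J$ such that (a) for each $J\subseteq[n]$, $W_J$ is $\sigma(X_i,i\in J)$-measurable, and (b) for all $J,K\subseteq[n]$, $\mathbb{E}[W_J\mid X_i,i\in K]=0$ unless $J\subseteq K$. Explicitly, $W_J=\sum_{L\subseteq J}(-1)^{|J|-|L|}\mathbb{E}[W\mid X_i,i\in L]$. $W$ is called a completely degenerate, not necessarily symmetric $U$-statistic of order $p$, based on $X_1,\dotsc,X_n$, if $W_K=0$ $\mathbb{P}$-a.s. unless $|K|=p$, i.e. if $W=\sum_{J\in\mathcal{D}_p(n)}W_J$ is its Hoeffding decomposition. For such $W$ put $\sigma_J^2:=\mathbb{E}[W_J^2]$ for $J\in\mathcal{D}_p(n)$ and let $\varrho_n\geq 0$ be defined by $\varrho_n^2:=\max_{1\leq i\leq n}\sum_{J\in\mathcal{D}_p(n):\,i\in J}\sigma_J^2$. $\Phi(t)=\frac{1}{\sqrt{2\pi}}\int_{-\infty}^te^{-x^2/2}\,dx$ is the standard normal distribution function. *)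

(* Defs.v *)
From HB Require Import structures.
From mathcomp Require Import all_boot all_order all_algebra.
From mathcomp Require Import all_classical all_reals all_analysis.
Set Implicit Arguments.
Unset Strict Implicit.
Unset Printing Implicit Defensive.
Import Order.TTheory GRing.Theory Num.Theory.
Import numFieldNormedType.Exports.
Local Open Scope classical_set_scope.
Local Open Scope ring_scope.

(** [sigma_gen X J] is sigma(X_i, i \in J).  Applied to the coordinate maps of
    [forall i, E i] and to [J = finset.setT] it is the product sigma-field. *)
Definition sigma_gen (T : Type) (n : nat) (dE : 'I_n -> measure_display)
    (E : forall i, measurableType (dE i)) (X : forall i, T -> E i)
    (J : {set 'I_n}) : set (set T) :=
  <<s \bigcup_(i in [set` J])
        preimage_set_system [set: T] (X i) (@measurable _ (E i)) >>.

(** Measurability with respect to a given sigma-field [G] on [T], not the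
    canonical one, and the Borel sigma-field of [R]. *)
Definition sigma_measurable (R : realType) (T : Type) (G : set (set T))
    (Y : T -> R) : Prop :=
  forall B : set R, measurable B -> G (Y @^-1` B).

Definition prod_measurable (R : realType) (n : nat)
    (dE : 'I_n -> measure_display) (E : forall i, measurableType (dE i))
    (f : (forall i, E i) -> R) : Prop :=
  sigma_measurable
    (sigma_gen (fun i (x : forall j, E j) => x i) [set: 'I_n]%SET) f.

Definition independent_rvs (R : realType) (d : measure_display)
    (T : measurableType d) (P : probability T R) (n : nat)
    (dE : 'I_n -> measure_display) (E : forall i, measurableType (dE i))
    (X : forall i, {RV P >-> E i}) : Prop :=
  forall (J : {set 'I_n}) (B : forall i, set (E i)),
    (forall i, i \in J -> measurable (B i)) ->
    P (\bigcap_(i in [set` J]) (X i @^-1` B i)) =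
    (\prod_(i in J) P (X i @^-1` B i))%E.

(** [Z] is a version of E[Y | G], where [G] is a sub-sigma-field. *)
Definition is_cond_exp (R : realType) (d : measure_display)
    (T : measurableType d) (P : probability T R) (G : set (set T))
    (Y Z : T -> R) : Prop :=
  [/\ P.-integrable [set: T] (EFin \o Y),
      sigma_measurable G Z,
      P.-integrable [set: T] (EFin \o Z) &
      forall A, G A ->
        (\int[P]_(w in A) (Z w)%:E = \int[P]_(w in A) (Y w)%:E)%E].

(** [WJ] is a version of the Hoeffding decomposition of [W] (it is unique only
    up to P-null sets). *)
Definition hoeffding_decomposition (R : realType) (d : measure_display)
    (T : measurableType d) (P : probability T R) (n : nat)
    (dE : 'I_n -> measure_display) (E : forall i, measurableType (dE i))
    (X : forall i, {RV P >-> E i}) (W : T -> R) (WJ : {set 'I_n} -> T -> R)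
    : Prop :=
  [/\ {ae P, forall w, W w = \sum_(J : {set 'I_n}) WJ J w},
      forall J, sigma_measurable (sigma_gen X J) (WJ J) &
      forall J K : {set 'I_n}, ~~ (J \subset K) ->
        is_cond_exp P (sigma_gen X K) (WJ J) (cst 0)].

(** [W] is a completely degenerate, not necessarily symmetric U-statistic of
    order [p] based on [X], with Hoeffding components [WJ]. *)
Definition completely_degenerate (R : realType) (d : measure_display)
    (T : measurableType d) (P : probability T R) (n : nat)
    (dE : 'I_n -> measure_display) (E : forall i, measurableType (dE i))
    (X : forall i, {RV P >-> E i}) (p : nat)
    (W : T -> R) (WJ : {set 'I_n} -> T -> R) : Prop :=
  hoeffding_decomposition X W WJ /\
  forall K : {set 'I_n}, #|K| <> p -> {ae P, forall w, WJ K w = 0}.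

(** sigma_J^2 = E[W_J^2].  [fine] loses nothing when [W] is square integrable:
    then so is every [WJ J]. *)
Definition sigma2 (R : realType) (d : measure_display)
    (T : measurableType d) (P : probability T R) (n : nat)
    (WJ : {set 'I_n} -> T -> R) (J : {set 'I_n}) : R :=
  fine 'E_P[(fun w => WJ J w ^+ 2)%R].

(** The summands are nonnegative, so the unit 0 of the maximum is harmless. *)
Definition varrho (R : realType) (d : measure_display)
    (T : measurableType d) (P : probability T R) (n p : nat)
    (WJ : {set 'I_n} -> T -> R) : R :=
  Num.sqrt (\big[Num.max/0]_(i < n)
    \sum_(J : {set 'I_n} | (#|J| == p) && (i \in J)) sigma2 P WJ J).

Definition Phi (R : realType) (t : R) : R :=
  (Num.sqrt (2 * pi))^-1 *
  \int[lebesgue_measure]_(x in `]-oo, t]) expR (- (x ^+ 2 / 2)).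

Definition kolmogorov_dist (R : realType) (d : measure_display)
    (T : measurableType d) (P : probability T R) (W : T -> R) : \bar R :=
  ereal_sup
    [set `|P [set w | (W w <= t)%R] - (Phi t)%:E|%E | t in [set: R]].

(* Main.v *)
(* Let [W^i] be [W] with [X_i] replaced by an independent copy and write
   [D_i = W - W^i].  Degeneracy gives [sum_i E[h D_i] = p E[h W]] for every
   function [h] of the original variables, so Stein's method applies to the
   exchangeable pairs [(W, W^i)].  The trapezoidal rule for the Stein solution
   of a half-line has an error controlled by a bounded nondecreasing function
   [m]; by exchangeability this leaves [sum_i E[D_i |D_i| m(W)]], bounded through
   [sum_i E[D_i^4]], and the distance of [sum_i E[D_i^2 | X] / 2p] to [1].
   Writing [W^2 = U + R] with [U] the sum of the products [W_J W_K] over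
   disjoint [J] and [K], both are bounded in terms of [E[W^4]] and [E[U^2]], by
   the spectral gap of the operator that counts resampled coordinates.
   Finally [E[U^2] >= 2 - 4^p p rho^2]: exchange two copies of [X] on a random
   set of coordinates and use that a four-cycle expectation is nonnegative. *)
Require Import Defs.
From HB Require Import structures.
From mathcomp Require Import all_boot all_order all_algebra.
From mathcomp Require Import all_classical all_reals all_analysis.
From mathcomp Require Import measurable_realfun.
From mathcomp Require Import ring lra.
Set Implicit Arguments.
Unset Strict Implicit.
Unset Printing Implicit Defensive.
Import Order.TTheory GRing.Theory Num.Theory.
Import numFieldNormedType.Exports.
Local Open Scope classical_set_scope.
Local Open Scope ring_scope.


(** Why 3, and where [kappa] comes from. [U] and [R] are orthogonal and E[R] = 1, so R has variance
    E[W^4] - E[U^2] - 1, while the sum of the E[D_i^4] is at most p (8 E[W^4] - 12 E[U^2]).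
    Inserting E[U^2] >= 2 - r with r = 4^p p rho^2 turns both into multiples of E[W^4] - 3 and r.
    The factor 4^p arises because a uniformly random set of coordinates contains a given set of 2p
    coordinates with probability 1/4^p; the factor p bounds the weight of the pairs J, K that meet.
    The number operator replaces a Hoeffding decomposition of W^2: on [U] it is multiplication by
    2p, on [R] only its spectral bounds are used. Everything takes place on the product space. There
    the kernels are chosen to ignore, at every point, the coordinates outside J, conditional
    expectations are integrals over a second copy, and independence enters as the invariance of two
    copies under exchange of any set of coordinates. *)

(** * Integrability and expectations *)

Section expectation.
Context {d : measure_display} {T : measurableType d} {R : realType}.
Variable P : probability T R.
Implicit Types F G : T -> R.

Definition L1 F := P.-integrable setT (EFin \o F).
Definition Ex F : R := \int[P]_x F x.
Definition L2 F := measurable_fun setT F /\ L1 (fun x => F x ^+ 2).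
Definition L4 F := measurable_fun setT F /\ L1 (fun x => F x ^+ 4).

Lemma L1_meas F : L1 F -> measurable_fun setT F.
Proof. by move=> /measurable_int /measurable_EFinP. Qed.

Lemma L2_meas F : L2 F -> measurable_fun setT F. Proof. by case. Qed.
Lemma L4_meas F : L4 F -> measurable_fun setT F. Proof. by case. Qed.

Lemma L1_dom F G : measurable_fun setT F -> L1 G ->
  (forall x, `|F x| <= G x) -> L1 F.
Proof.
move=> mF iG FG; apply: (le_integrable _ _ _ iG) => //.
  exact/measurable_EFinP.
by move=> x _ /=; rewrite lee_fin (le_trans (FG x))// ler_norm.
Qed.

Lemma L1D F G : L1 F -> L1 G -> L1 (fun x => F x + G x).
Proof. by move=> iF iG; exact: (integrableD measurableT iF iG). Qed.

Lemma L1B F G : L1 F -> L1 G -> L1 (fun x => F x - G x).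
Proof. by move=> iF iG; exact: (integrableB measurableT iF iG). Qed.

Lemma L1Z c F : L1 F -> L1 (fun x => c * F x).
Proof. by move=> iF; apply: (integrableZl measurableT c iF). Qed.

Lemma L1_cst c : L1 (fun=> c).
Proof. exact: finite_measure_integrable_cst. Qed.

Lemma L1_abs F : L1 F -> L1 (fun x => `|F x|).
Proof. by move=> iF; apply: integrable_abse iF. Qed.

Lemma L1_sum (I : Type) (r : seq I) (Q : pred I) (F : I -> T -> R) :
  (forall i, Q i -> L1 (F i)) -> L1 (fun x => \sum_(i <- r | Q i) F i x).
Proof.
move=> iF; elim: r => [|i r IH].
  by under [X in L1 X]eq_fun do rewrite big_nil; exact: L1_cst.
under [X in L1 X]eq_fun do rewrite big_cons.
by case: (boolP (Q i)) => // Qi; apply: L1D => //; exact: iF.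
Qed.

Lemma ExD F G : L1 F -> L1 G -> Ex (fun x => F x + G x) = Ex F + Ex G.
Proof. exact: RintegralD. Qed.

Lemma ExB F G : L1 F -> L1 G -> Ex (fun x => F x - G x) = Ex F - Ex G.
Proof. exact: RintegralB. Qed.

Lemma ExZ c F : L1 F -> Ex (fun x => c * F x) = c * Ex F.
Proof. exact: RintegralZl. Qed.

Lemma Ex_cst c : Ex (fun=> c) = c.
Proof. by rewrite /Ex Rintegral_cst //= probability_setT mulr1. Qed.

Lemma eq_Ex F G : F =1 G -> Ex F = Ex G.
Proof. by move=> /funext ->. Qed.

Lemma Ex_sum (I : Type) (r : seq I) (Q : pred I) (F : I -> T -> R) :
  (forall i, Q i -> L1 (F i)) ->
  Ex (fun x => \sum_(i <- r | Q i) F i x) = \sum_(i <- r | Q i) Ex (F i).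
Proof.
move=> iF; elim: r => [|i r IH].
  by under [X in Ex X]eq_fun do rewrite big_nil; rewrite Ex_cst big_nil.
under [X in Ex X]eq_fun do rewrite big_cons.
rewrite big_cons; case: (boolP (Q i)) => // Qi; rewrite ExD ?IH//; first exact: iF.
exact: L1_sum.
Qed.

Lemma Ex_ge0 F : (forall x, 0 <= F x) -> 0 <= Ex F.
Proof. by move=> F0; apply: Rintegral_ge0. Qed.

Lemma le_Ex F G : L1 F -> L1 G -> (forall x, F x <= G x) -> Ex F <= Ex G.
Proof. by move=> iF iG FG; apply: le_Rintegral. Qed.

Lemma norm_Ex_le F G : L1 F -> L1 G -> (forall x, `|F x| <= G x) ->
  `|Ex F| <= Ex G.
Proof.
move=> iF iG FG; apply: (le_trans (le_normr_Rintegral _ _)) => //.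
by apply: le_Ex => //; exact: L1_abs.
Qed.

Lemma ae_eq_Ex F G : measurable_fun setT F -> measurable_fun setT G ->
  {ae P, forall x, F x = G x} -> Ex F = Ex G.
Proof.
move=> mF mG FG; congr fine; apply: ae_eq_integral => //.
- exact/measurable_EFinP.
- exact/measurable_EFinP.
- by apply: filterS FG => x /= -> .
Qed.

Lemma ae_eq_L1 F G : measurable_fun setT G ->
  {ae P, forall x, F x = G x} -> L1 F -> L1 G.
Proof.
move=> mG FG iF; apply/integrableP; split; first exact/measurable_EFinP.
have /integrableP[_] := iF; rewrite (_ : integral _ _ _ =
  (\int[P]_x `|(G x)%:E|)%E)//.
apply: ae_eq_integral => //.
- by apply: measurableT_comp => //; exact/measurable_EFinP/L1_meas.
- by apply: measurableT_comp => //; exact/measurable_EFinP.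
- by apply: filterS FG => x /= -> .
Qed.

Lemma Ex_EFin F : L1 F -> (\int[P]_x (F x)%:E)%E = (Ex F)%:E.
Proof. by move=> iF; rewrite fineK//; exact: integrable_fin_num. Qed.

Lemma Ex_eq0_ae F : L1 F -> (forall x, 0 <= F x) -> Ex F = 0 ->
  {ae P, forall x, F x = 0}.
Proof.
move=> iF F0 E0; have : (\int[P]_x `|(F x)%:E|)%E = 0%E.
  under eq_integral do rewrite gee0_abs ?lee_fin//.
  by rewrite Ex_EFin// E0.
move/(ae_eq_integral_abs P measurableT (measurable_int _ iF)).1.
by apply: filterS => x /= /(_ I) [].
Qed.

(** * Square and fourth power integrability *)

Lemma L1M F G : L2 F -> L2 G -> L1 (fun x => F x * G x).
Proof.
move=> [mF iF] [mG iG]; apply: (L1_dom _ (L1D iF iG)).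
  exact: measurable_funM.
move=> x; rewrite normrM -(real_normK (num_real (F x))).
rewrite -(real_normK (num_real (G x))).
have := sqr_ge0 (`|F x| - `|G x|); have := normr_ge0 (F x).
have := normr_ge0 (G x); nra.
Qed.

Lemma L2_cst c : L2 (fun=> c).
Proof. by split => //; exact: L1_cst. Qed.

Lemma L2_L1 F : L2 F -> L1 F.
Proof.
by move=> /L1M/(_ (L2_cst 1)); under [X in L1 X]eq_fun do rewrite mulr1.
Qed.

Lemma L2Z c F : L2 F -> L2 (fun x => c * F x).
Proof.
move=> [mF iF]; split; first exact: measurable_funM.
by under [X in L1 X]eq_fun do rewrite exprMn; exact: L1Z.
Qed.

Lemma L2D F G : L2 F -> L2 G -> L2 (fun x => F x + G x).
Proof.
move=> iF iG; split; first by apply: measurable_funD; [case: iF|case: iG].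
have iFG := L1M iF iG; case: iF iG => [mF iF] [mG iG].
rewrite (_ : (fun _ => _) = fun x => F x ^+ 2 + G x ^+ 2 + 2 * (F x * G x)).
  by apply: L1D; [exact: L1D|exact: L1Z].
by apply/funext => x; ring.
Qed.

Lemma L2B F G : L2 F -> L2 G -> L2 (fun x => F x - G x).
Proof.
move=> iF /(L2Z (-1)) iG; under [X in L2 X]eq_fun do rewrite -mulN1r.
exact: L2D.
Qed.

Lemma L2_sum (I : Type) (r : seq I) (Q : pred I) (F : I -> T -> R) :
  (forall i, Q i -> L2 (F i)) -> L2 (fun x => \sum_(i <- r | Q i) F i x).
Proof.
move=> iF; elim: r => [|i r IH].
  by under [X in L2 X]eq_fun do rewrite big_nil; exact: L2_cst.
under [X in L2 X]eq_fun do rewrite big_cons.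
by case: (boolP (Q i)) => // Qi; apply: L2D => //; exact: iF.
Qed.

Lemma L2_dom F G : measurable_fun setT F -> L2 G ->
  (forall x, `|F x| <= `|G x|) -> L2 F.
Proof.
move=> mF [mG iG] FG; split => //; apply: (L1_dom _ iG).
  exact: measurable_funX.
move=> x; rewrite normrX -(real_normK (num_real (G x))).
by rewrite ler_pXn2r ?nnegrE.
Qed.

Lemma L2_bdd c F : measurable_fun setT F -> (forall x, `|F x| <= c) -> L2 F.
Proof.
move=> mF Fc; apply: (L2_dom mF (L2_cst c)) => x.
by rewrite (le_trans (Fc x))// ler_norm.
Qed.

Lemma L2_bddM c F G : measurable_fun setT F -> (forall x, `|F x| <= c) ->
  L2 G -> L2 (fun x => F x * G x).
Proof.
move=> mF Fc iG; apply: (L2_dom _ (L2Z c iG)).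
  by apply: measurable_funM => //; case: iG.
move=> x; rewrite !normrM ler_wpM2r// (le_trans (Fc x))//; exact: ler_norm.
Qed.

Lemma L1_bddM c F G : measurable_fun setT F -> (forall x, `|F x| <= c) ->
  L1 G -> L1 (fun x => F x * G x).
Proof.
move=> mF Fc iG; apply: (L1_dom _ (L1Z c (L1_abs iG))).
  by apply: measurable_funM => //; exact: L1_meas.
by move=> x; rewrite normrM ler_wpM2r.
Qed.

Lemma L4M F G : L4 F -> L4 G -> L2 (fun x => F x * G x).
Proof.
move=> [mF iF] [mG iG]; split; first exact: measurable_funM.
apply: (L1_dom _ (L1D iF iG)); first exact/measurable_funX/measurable_funM.
move=> x; rewrite ger0_norm ?sqr_ge0//.
have := sqr_ge0 (F x ^+ 2 - G x ^+ 2); have := sqr_ge0 (F x ^+ 2).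
have := sqr_ge0 (G x ^+ 2); nra.
Qed.

Lemma L4_cst c : L4 (fun=> c).
Proof. by split => //; exact: L1_cst. Qed.

Lemma L4_L2 F : L4 F -> L2 F.
Proof.
by move=> /L4M/(_ (L4_cst 1)); under [X in L2 X]eq_fun do rewrite mulr1.
Qed.

Lemma L4_L1 F : L4 F -> L1 F.
Proof. by move=> /L4_L2/L2_L1. Qed.

Lemma L2_sqr_L4 F : measurable_fun setT F -> L2 (fun x => F x ^+ 2) -> L4 F.
Proof.
by move=> mF [_]; under [X in L1 X]eq_fun do rewrite -exprM; split.
Qed.

Lemma L4X2 F : L4 F -> L2 (fun x => F x ^+ 2).
Proof. by move=> iF; under [X in L2 X]eq_fun do rewrite expr2; exact: L4M. Qed.

Lemma L4Z c F : L4 F -> L4 (fun x => c * F x).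
Proof.
move=> [mF iF]; split; first exact: measurable_funM.
by under [X in L1 X]eq_fun do rewrite exprMn; exact: L1Z.
Qed.

Lemma L4D F G : L4 F -> L4 G -> L4 (fun x => F x + G x).
Proof.
move=> iF iG; apply: L2_sqr_L4.
  by apply: measurable_funD; [case: iF|case: iG].
rewrite (_ : (fun _ => _) = fun x => F x ^+ 2 + G x ^+ 2 + 2 * (F x * G x)).
  by apply: L2D; [apply: L2D; exact: L4X2|apply: L2Z; exact: L4M].
by apply/funext => x; ring.
Qed.

Lemma L4B F G : L4 F -> L4 G -> L4 (fun x => F x - G x).
Proof.
move=> iF /(L4Z (-1)) iG; under [X in L4 X]eq_fun do rewrite -mulN1r.
exact: L4D.
Qed.

Lemma L4_sum (I : Type) (r : seq I) (Q : pred I) (F : I -> T -> R) :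
  (forall i, Q i -> L4 (F i)) -> L4 (fun x => \sum_(i <- r | Q i) F i x).
Proof.
move=> iF; elim: r => [|i r IH].
  by under [X in L4 X]eq_fun do rewrite big_nil; exact: L4_cst.
under [X in L4 X]eq_fun do rewrite big_cons.
by case: (boolP (Q i)) => // Qi; apply: L4D => //; exact: iF.
Qed.

Lemma Ex_CS F G : L2 F -> L2 G ->
  Ex (fun x => F x * G x) ^+ 2 <=
  Ex (fun x => F x ^+ 2) * Ex (fun x => G x ^+ 2).
Proof.
move=> iF iG; set a := Ex (fun x => F x ^+ 2); set b := Ex (fun x => _ * _).
set c := Ex (fun x => G x ^+ 2).
have pos t : 0 <= a - 2 * t * b + t ^+ 2 * c.
  have -> : a - 2 * t * b + t ^+ 2 * c = Ex (fun x => (F x - t * G x) ^+ 2).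
    rewrite (_ : (fun x => (F x - t * G x) ^+ 2) = (fun x =>
      F x ^+ 2 - (2 * t) * (F x * G x) + t ^+ 2 * G x ^+ 2)); last first.
      by apply/funext => x; ring.
    have i1 := iF.2; have i2 := iG.2; have i3 := L1M iF iG.
    rewrite ExD ?ExB ?ExZ//; [exact: L1Z|apply: L1B => //; exact: L1Z|exact: L1Z].
  by apply: Ex_ge0 => x; exact: sqr_ge0.
have a0 : 0 <= a by apply: Ex_ge0 => x; exact: sqr_ge0.
have c0 : 0 <= c by apply: Ex_ge0 => x; exact: sqr_ge0.
have [c_eq0|c_neq0] := eqVneq c 0.
  have [->|b0] := eqVneq b 0; first by rewrite expr0n/= mulr_ge0.
  (* Here the quadratic is affine in [t]; this [t] gives it the value [- a - 2 < 0]. *)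
  have := pos ((a + 1) / b); rewrite c_eq0 mulr0 addr0 -mulrA divfK//; lra.
have c1 : 0 < c by rewrite lt_neqAle eq_sym c_neq0.
have := pos (b / c); rewrite -(ler_pM2r c1) mul0r.
have -> : (a - 2 * (b / c) * b + (b / c) ^+ 2 * c) * c = a * c - b ^+ 2 by field.
by rewrite subr_ge0.
Qed.

Lemma Ex_le_sqrt F : L2 F -> `|Ex F| <= Num.sqrt (Ex (fun x => F x ^+ 2)).
Proof.
move=> iF; have := Ex_CS iF (L2_cst 1).
under [X in Ex X ^+ 2]eq_fun do rewrite mulr1.
by rewrite expr1n Ex_cst mulr1 => h; rewrite -sqrtr_sqr ler_wsqrtr.
Qed.

Lemma normEx_bdd c F G : 0 <= c -> measurable_fun setT F ->
  (forall x, `|F x| <= c) -> L2 G ->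
  `|Ex (fun x => F x * G x)| <= c * Num.sqrt (Ex (fun x => G x ^+ 2)).
Proof.
move=> c0 mF Fc iG; have iG1 := L2_L1 iG.
apply: (@le_trans _ _ (Ex (fun x => c * `|G x|))).
  apply: norm_Ex_le; first exact: (L1_bddM mF Fc iG1).
    exact/L1Z/L1_abs.
  by move=> x; rewrite normrM ler_wpM2r.
rewrite ExZ; last exact: L1_abs.
rewrite ler_wpM2l//; have iaG : L2 (fun x => `|G x|).
  apply: (L2_dom _ iG) => [|x]; last by rewrite normr_id.
  by apply: measurableT_comp => //; case: iG.
apply: le_trans (ler_norm _) _; apply: le_trans (Ex_le_sqrt iaG) _.
by rewrite ler_wsqrtr// le_eqVlt (eq_Ex (fun x => real_normK (num_real (G x)))) eqxx.
Qed.

End expectation.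

(** * Sums of commuting projections *)

Section commuting_projections.
Variables (R : realFieldType) (V : zmodType) (H : V -> Prop).
Variables (ip : V -> V -> R) (I : eqType) (B : I -> V -> V).
Hypothesis HB : forall a b, H a -> H b -> H (a - b).
Hypothesis HBop : forall i a, H a -> H (B i a).
Hypothesis ipBl : forall a b c, H a -> H b -> H c ->
  ip (a - b) c = ip a c - ip b c.
Hypothesis ipC : forall a b, H a -> H b -> ip a b = ip b a.
Hypothesis ip_ge0 : forall a, H a -> 0 <= ip a a.
Hypothesis Bsa : forall i a b, H a -> H b -> ip (B i a) b = ip a (B i b).
Hypothesis Bid : forall i a b, H a -> H b -> ip (B i a) (B i b) = ip (B i a) b.
(** Commutation is required only under the inner product: for averages over coordinates it comes
    from Fubini, as an identity of expectations and not of functions. *)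
Hypothesis Bcomm : forall i j a b, H a -> H b ->
  ip (B i a) (B j b) = ip (B j a) (B i b).

(* The number operator [\sum_i B i] has spectrum in [0, m] on sums of vectors
   that are fixed by all but [m] of the complementary projections.  Induction
   on the projections, splitting [h] as [B i h + (h - B i h)]. *)
Lemma number_operator_bound (K : finType) (s : seq I) (m : nat) (h : V)
    (F : K -> V) (M : K -> pred I) :
  H h -> (forall k, H (F k)) ->
  (forall k j, j \in s -> ~~ M k j -> forall l, H l -> ip (F k) (B j l) = 0) ->
  (forall k, (count (M k) s <= m)%N) ->
  (forall l, H l -> ip h l = \sum_k ip (F k) l) ->
  \sum_(i <- s) ip (B i h) h <= m%:R * ip h h /\
  \sum_(i <- s) \sum_(j <- s) ip (B i h) (B j h) <=
    m%:R * \sum_(i <- s) ip (B i h) h.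
Proof.
elim: s m h F M => [|i s IH] m h F M Hh HF Fz cM hE.
  by rewrite !big_nil mulr0 mulr_ge0// ip_ge0.
case: m cM => [|m] cM.
  (* With no index left, [h] is orthogonal to the range of every [B j] and all sums vanish. *)
  have z j l : j \in i :: s -> H l -> ip h (B j l) = 0.
    move=> js Hl; rewrite hE; last exact: HBop.
    apply: big1 => k _; apply: Fz => //.
    have := cM k; rewrite leqn0 -leqn0 leqNgt -has_count => /hasPn; exact.
  rewrite !mul0r [X in X <= _]big_seq [X in X <= 0]big1; last first.
    by move=> j js; rewrite Bsa// z.
  split => //; rewrite big_seq big1// => j js; rewrite big_seq big1// => k ks.
  by rewrite Bsa ?z//; do ?apply: HBop.
set b := B i h; set c := h - b.
have Hb : H b by exact: HBop.
have Hc : H c by exact: HB.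
(* The part of [h] in the range of [B i] has spent the index [i]: only the [F k] with [M k i]
   survive, each with at most [m] indices left in [s]. *)
have [] := IH m b (fun k => B i (F k)) (fun k => if M k i then M k else pred0) Hb.
- by move=> k; exact: HBop.
- move=> k j js; have jis : j \in i :: s by rewrite inE js orbT.
  case: ifPn => Mki Mkj l Hl.
    by rewrite Bcomm ?Bsa// ?Fz//; do ?apply: HBop.
  by rewrite Bsa// ?Fz ?mem_head//; do ?apply: HBop.
- move=> k; have := cM k => /=; case: (M k i) => //=.
  by rewrite count_pred0.
- move=> l Hl; rewrite /b Bsa// hE; last exact: HBop.
  by apply: eq_bigr => k _; rewrite Bsa.
(* The complementary part keeps the bound [m.+1], but [B i] annihilates it, so [i] contributes
   nothing there. *)
have [] := IH m.+1 c (fun k => F k - B i (F k)) M Hc.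
- by move=> k; apply: HB => //; exact: HBop.
- move=> k j js Mkj l Hl; have jis : j \in i :: s by rewrite inE js orbT.
  have HFi : H (B i (F k)) by exact: HBop.
  have HBl : H (B j l) by exact: HBop.
  have HBl' : H (B i l) by exact: HBop.
  by rewrite ipBl// Fz// Bcomm// Bsa// Fz// subr0.
- by move=> k; apply: leq_trans (cM k); rewrite /= leq_addl.
- move=> l Hl; rewrite /c ipBl// hE// /b Bsa// hE; last exact: HBop.
  by rewrite -sumrB; apply: eq_bigr => k _; rewrite ipBl ?Bsa//; exact: HBop.
set A2 := \sum_(j <- s) ip (B j c) c; set D2 := \sum_(j <- s) \sum_(k <- s) _.
move=> a2 d2.
set A1 := \sum_(j <- s) ip (B j b) b; set D1 := \sum_(j <- s) \sum_(k <- s) _.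
move=> a1 d1.
have ci l : H l -> ip c (B i l) = 0.
  move=> Hl; have HBl : H (B i l) by exact: HBop.
  by rewrite /c ipBl// /b Bid// Bsa// subrr.
have hbc l : H l -> ip h l = ip b l + ip c l.
  by move=> Hl; rewrite /c ipBl// addrC subrK.
have hbcr l : H l -> ip l h = ip l b + ip l c.
  by move=> Hl; rewrite ipC// hbc// (ipC Hb)// (ipC Hc).
(* By commutation every [B j] preserves the range of [B i] and its orthogonal complement, so there
   are no cross terms between [b] and [c]. *)
have bjc j : ip b (B j c) = 0.
  have HBj : H (B j h) by exact: HBop.
  have HBic : H (B i c) by exact: HBop.
  by rewrite /b Bcomm// ipC// Bsa// ci.
have bjck j k : ip (B j b) (B k c) = 0.
  have HBk : H (B k c) by exact: HBop.
  have HBj : H (B j h) by exact: HBop.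
  have HBjk : H (B k (B j h)) by exact: HBop.
  have HBic : H (B i c) by exact: HBop.
  have HBjk' : H (B j (B k c)) by exact: HBop.
  have HBik : H (B i (B k c)) by exact: HBop.
  have HBij : H (B i (B j h)) by exact: HBop.
  by rewrite Bsa// /b Bcomm// -Bsa// Bcomm// ipC// Bsa// ci.
have Bjl j l : H l -> ip (B j h) l = ip (B j b) l + ip (B j c) l.
  by move=> Hl; rewrite (Bsa _ Hh)// (Bsa _ Hb)// (Bsa _ Hc)// hbc//; exact: HBop.
have Bjlr j l : H l -> ip l (B j h) = ip l (B j b) + ip l (B j c).
  move=> Hl; have HBb : H (B j b) by exact: HBop.
  have HBc : H (B j c) by exact: HBop.
  have HBh : H (B j h) by exact: HBop.
  by rewrite (ipC Hl HBh) Bjl// (ipC Hl HBb) (ipC Hl HBc).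
have E0 : ip b h = ip b b.
  by rewrite /b Bid.
have E1 : \sum_(j <- s) ip (B j h) h = A1 + A2.
  rewrite -big_split/=; apply: eq_bigr => j _.
  rewrite Bjl// !hbcr; [|exact: HBop|exact: HBop].
  rewrite (Bsa _ Hb Hc) bjc addr0; congr (_ + _).
  by rewrite ipC// ?bjc ?add0r//; exact: HBop.
have E2 : \sum_(j <- s) ip b (B j h) = A1.
  by apply: eq_bigr => j _; rewrite Bjlr// bjc addr0 ipC//; exact: HBop.
have E2' : \sum_(j <- s) ip (B j h) b = A1.
  by rewrite -E2; apply: eq_bigr => j _; rewrite ipC//; exact: HBop.
have E3 : \sum_(j <- s) \sum_(k <- s) ip (B j h) (B k h) = D1 + D2.
  rewrite -big_split/=; apply: eq_bigr => j _.
  rewrite -big_split/=; apply: eq_bigr => k _.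
  rewrite Bjl ?Bjlr ?bjck ?addr0; try by do ?apply: HBop.
  by congr (_ + _); rewrite ipC ?bjck ?add0r; do ?apply: HBop.
have E4 : ip h h = ip b b + ip c c.
  rewrite hbc// E0; congr (_ + _); rewrite hbcr// -[RHS]add0r; congr (_ + _).
  by rewrite /b ci.
have b0 := ip_ge0 Hb; have c0 := ip_ge0 Hc.
rewrite !big_cons -/b E1 E4 E2.
under [X in _ /\ _ + X <= _]eq_bigr do rewrite big_cons.
rewrite big_split/= -/b E2' E3 E0 -/b -natr1.
move: a2 d2; rewrite -natr1 => a2 d2.
split; nra.
Qed.

End commuting_projections.

(** * The Stein equation *)

Section gaussian_primitive.
Variable R : realType.
Implicit Types (F f df : R -> R) (x w z : R).

Lemma mvt_le f df a b : a <= b -> (forall x, is_derive x 1 f (df x)) ->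
  exists2 c, a <= c <= b & f b - f a = (b - a) * df c.
Proof.
move=> ab fdf; have [|c] := MVT_segment ab (fun x _ => fdf x).
  by apply: derivable_within_continuous => x _; exact: ex_derive.
by rewrite in_itv/= mulrC; exists c.
Qed.

Definition gpeak : R := Num.sqrt (2 * pi).
Definition gpdf x : R := gpeak^-1 * expR (- (x ^+ 2 / 2)).
Definition gpdfV x : R := gpeak * expR (x ^+ 2 / 2).

Lemma gpeak_gt0 : 0 < gpeak.
Proof. by rewrite sqrtr_gt0 mulr_gt0 ?pi_gt0. Qed.

Lemma gpdf_gt0 x : 0 < gpdf x.
Proof. by rewrite mulr_gt0 ?invr_gt0 ?gpeak_gt0 ?expR_gt0. Qed.

Lemma gpdfV_gt0 x : 0 < gpdfV x.
Proof. by rewrite mulr_gt0 ?gpeak_gt0 ?expR_gt0. Qed.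

Lemma gpdfVK x : gpdf x * gpdfV x = 1.
Proof.
rewrite /gpdf /gpdfV mulrACA mulVf ?gt_eqF ?gpeak_gt0// -expRD addrC subrr.
by rewrite expR0 mulr1.
Qed.

Lemma is_derive_halfsq x : is_derive x 1 (fun x : R => x ^+ 2 / 2) x.
Proof.
have := is_deriveZ 2^-1
  (is_deriveX 2 (is_derive_id x 1)).
rewrite (_ : 2^-1 \*: _ = (fun x : R => x ^+ 2 / 2)); last first.
  by apply/funext => y /=; rewrite /GRing.scale/= mulrC.
by move=> h; apply: is_derive_eq; rewrite /GRing.scale/=; field.
Qed.

Lemma is_derive_gpdf x : is_derive x 1 gpdf (- x * gpdf x).
Proof.
have h := is_deriveN (is_derive_halfsq x).
have := is_derive1_comp (f := expR) (is_derive_expR _) h.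
move/(is_deriveZ (gpeak^-1)) => {}h.
by apply: (is_derive_eq h); rewrite /gpdf /GRing.scale/=; ring.
Qed.

Lemma is_derive_gpdfV x : is_derive x 1 gpdfV (x * gpdfV x).
Proof.
have := is_derive1_comp (f := expR) (is_derive_expR _) (is_derive_halfsq x).
move/(is_deriveZ (gpeak)) => h.
by apply: (is_derive_eq h); rewrite /gpdfV /GRing.scale/=; ring.
Qed.

Section mills.
Variable F : R -> R.
Hypothesis dF : forall x, is_derive x 1 F (gpdf x).
Hypothesis F_ge0 : forall x, 0 <= F x.
Hypothesis F_Ny : forall (e : R) w, 0 < e -> exists2 t, t <= w & F t < e.

(** The Mills ratio of the lower tail. [F] stays abstract because the bounds are applied both to
    [Phi] and to the reflected upper tail. *)
Let A w := F w * gpdfV w.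

Lemma is_derive_mills w : is_derive w 1 A (1 + w * A w).
Proof.
have h := is_deriveM (dF w) (is_derive_gpdfV w).
apply: (is_derive_eq h); rewrite /A /GRing.scale/= -[gpdfV w * _]mulrC gpdfVK.
by ring.
Qed.

Lemma mills_ge0 w : 0 <= A w.
Proof. by rewrite mulr_ge0// ltW// gpdfV_gt0. Qed.

(** For fixed [w] the function [gpdf x + w * F x] has derivative [(w - x) * gpdf x], hence increases
    up to [w]. It is positive up to an arbitrarily small error far to the left, so it cannot be
    negative at [w]. *)
Lemma mills_upper w : w < 0 -> - w * A w <= 1.
Proof.
move=> w0; suff h : - w * F w <= gpdf w.
  rewrite /A mulrA (le_trans (ler_wpM2r (ltW (gpdfV_gt0 w)) h))//.
  by rewrite gpdfVK.
rewrite leNgt; apply/negP => h.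
have [|t tw Ft] := @F_Ny ((- w * F w - gpdf w) / (- w)) w.
  by rewrite divr_gt0 ?oppr_gt0// subr_gt0.
pose k x := gpdf x - (- w) * F x.
have dk x : is_derive x 1 k (- x * gpdf x - (- w) * gpdf x).
  exact: is_deriveB (is_derive_gpdf x) (is_deriveZ (- w) (dF x)).
have [c /andP[tc cw]] := mvt_le tw dk.
have : 0 <= (w - t) * (- c * gpdf c - - w * gpdf c).
  apply: mulr_ge0; first by rewrite subr_ge0.
  by rewrite -mulrBl mulr_ge0 ?(ltW (gpdf_gt0 c))// opprK addrC subr_ge0.
move=> + E; rewrite -E /k; have := gpdf_gt0 t.
move: Ft; rewrite ltr_pdivlMr ?oppr_gt0//; lra.
Qed.

Lemma is_derive_mul_mills w :
  is_derive w 1 (fun x => x * A x) (A w * (1 + w ^+ 2) + w).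
Proof.
have h := is_deriveM (is_derive_id w 1) (is_derive_mills w).
by apply: (is_derive_eq h); rewrite /GRing.scale/=; ring.
Qed.

(* [F + x gpdf / (1 + x ^ 2)] has derivative [2 gpdf / (1 + x ^ 2) ^ 2] and
   vanishes at minus infinity. *)
Lemma mills_lower w : 0 <= A w * (1 + w ^+ 2) + w.
Proof.
have q0 x : 0 < 1 + x ^+ 2 by rewrite ltr_pwDl// sqr_ge0.
have q1 x : 1 + x ^+ 2 != 0 by rewrite gt_eqF.
suff h : 0 <= F w + w * gpdf w * (1 + w ^+ 2)^-1.
  have := mulr_ge0 h (mulr_ge0 (ltW (gpdfV_gt0 w)) (ltW (q0 w))).
  rewrite /A; have K := gpdfVK w; rewrite (_ : (_ + _) * _ = F w * gpdfV w *
    (1 + w ^+ 2) + w * (gpdf w * gpdfV w)); last by field.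
  by rewrite K mulr1.
pose k x := F x + x * gpdf x * (1 + x ^+ 2)^-1.
have dk x : is_derive x 1 k (2 * gpdf x / (1 + x ^+ 2) ^+ 2).
  have h1 := is_deriveM (is_derive_id x 1) (is_derive_gpdf x).
  have h2 := is_deriveD (is_derive_cst (1 : R) x 1)
    (is_deriveX 2 (is_derive_id x 1)).
  have h3 := is_deriveV (q1 x : (cst 1 + id ^+ 2) x != 0) h2.
  have h4 := is_deriveD (dF x) (is_deriveM h1 h3).
  apply: (is_derive_eq h4); rewrite /GRing.scale/=.
  rewrite -[(cst 1 + id ^+ 2) x]/(1 + x ^+ 2) -[(id * gpdf) x]/(x * gpdf x).
  rewrite /= expr1.
  by field.
rewrite leNgt; apply/negP => kw.
(* A point so far left that [t * gpdf t / (1 + t ^ 2)] exceeds the supposed negative value, using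
   only that [gpdf] is at most [gpeak^-1]. *)
pose t := Num.min w (- 1 + ((F w + w * gpdf w * (1 + w ^+ 2)^-1) * gpeak)^-1).
have tw : t <= w by rewrite ge_min lexx.
have [c _ E] := mvt_le tw dk.
have : 0 <= (w - t) * (2 * gpdf c / (1 + c ^+ 2) ^+ 2).
  by rewrite mulr_ge0 ?subr_ge0// divr_ge0 ?sqr_ge0// mulr_ge0// ltW// gpdf_gt0.
rewrite -E subr_ge0; apply/negP; rewrite -ltNge; rewrite /k.
set a := F w + _ in kw t tw E *.
have t1 : t <= - 1 + (a * gpeak)^-1 by rewrite ge_min lexx orbT.
have ag : a * gpeak < 0 by rewrite nmulr_rlt0// gpeak_gt0.
have ag' : (a * gpeak)^-1 < 0 by rewrite invr_lt0.
have t0 : t < 0 by lra.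
have gt : gpdf t <= gpeak^-1.
  rewrite /gpdf ler_piMr ?invr_ge0 ?(ltW gpeak_gt0)//.
  by rewrite -[leRHS]expR0 ler_expR oppr_le0 divr_ge0 ?sqr_ge0.
have : a < t * gpdf t * (1 + t ^+ 2)^-1.
  rewrite ltr_pdivlMr//.
  apply: (@lt_le_trans _ _ (t * gpeak^-1)); last by rewrite ler_wnM2l// ltW.
  rewrite ltr_pdivlMr ?gpeak_gt0// mulrAC -subr_lt0.
  have -> : a * gpeak * (1 + t ^+ 2) - t =
      a * gpeak * (1 + t ^+ 2 - t * (a * gpeak)^-1).
    rewrite [in RHS]mulrBr; congr (_ - _).
    by rewrite mulrCA divff ?mulr1 ?lt_eqF.
  rewrite nmulr_rlt0//; move: t1 t0 ag'; move: (t) ((a * gpeak)^-1) => r q; nra.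
have := F_ge0 t; lra.
Qed.

Lemma mul_mills_ndecr a b : a <= b -> a * A a <= b * A b.
Proof.
move=> ab; have [c _ E] := mvt_le ab is_derive_mul_mills.
by rewrite -subr_ge0 E mulr_ge0 ?mills_lower// subr_ge0.
Qed.

Lemma mul_mills_le1 w : w <= 0 -> `|w * A w| <= 1.
Proof.
rewrite le_eqVlt => /predU1P[->|w0]; first by rewrite mul0r normr0.
rewrite ler0_norm; last by rewrite mulr_le0_ge0 ?mills_ge0// ltW.
by rewrite -mulNr; exact: mills_upper.
Qed.

Hypothesis F_le1 : forall x, F x <= 1.

(** Left of -1 the ratio is below [- w * A w <= 1]; between -1 and 0 it is below [gpdfV 1], as
    [F <= 1]. *)
Lemma mills_bdd w : w <= 0 -> A w <= 1 + gpdfV 1.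
Proof.
move=> w0; have g1 := gpdfV_gt0 1; have A0 := mills_ge0 w.
have [w1|w1] := leP w (- 1).
  have := mul_mills_le1 w0; rewrite ler0_norm; last by rewrite mulr_le0_ge0.
  nra.
apply: (@le_trans _ _ (gpdfV 1)); last by lra.
rewrite /A (@le_trans _ _ (gpdfV w))//.
  by rewrite ler_piMl// ltW// gpdfV_gt0.
rewrite ler_wpM2l ?(ltW gpeak_gt0)// ler_expR ler_pM2r// ; nra.
Qed.

End mills.
End gaussian_primitive.

(** * The normal distribution function: derivative and limits *)

Section gaussian_cdf.
Variable R : realType.
Local Notation mu := (@lebesgue_measure R).
Local Notation Phi := (@Phi R).

Lemma gpdfE (x : R) : gpdf x = normal_pdf 0 1 x.
Proof.
rewrite normal_pdfE ?oner_eq0// /gpdf /gpeak /normal_peak /normal_fun.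
by rewrite expr1n mul1r mulr_natl subr0 mulNr.
Qed.

Lemma integrable_gpdf : mu.-integrable setT (EFin \o @gpdf R).
Proof.
have := @integrable_normal_pdf R 0 1.
by congr (_.-integrable _ _); apply/funext => x; rewrite /= gpdfE.
Qed.

Lemma PhiE (t : R) : Phi t = \int[mu]_(x in `]-oo, t]) gpdf x.
Proof.
have g0 : gpeak R != 0 by rewrite gt_eqF// gpeak_gt0.
rewrite /gpdf RintegralZl//.
have := integrableZl measurableT (gpeak R) integrable_gpdf.
rewrite (_ : (fun x => _)%E = EFin \o (fun x => expR (- (x ^+ 2 / 2)))); last first.
  by apply/funext => x; rewrite /= -EFinM /gpdf mulVKf.
by move=> h; apply: integrableS h.
Qed.

Lemma PhiE_prob (t : R) : (Phi t)%:E = normal_prob 0 1 `]-oo, t].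
Proof.
rewrite PhiE /normal_prob; under [RHS]eq_integral do rewrite -gpdfE.
by rewrite fineK//; apply: integrable_fin_num => //; apply: integrableS integrable_gpdf.
Qed.

Lemma Phi_ge0 (t : R) : 0 <= Phi t.
Proof. by rewrite -lee_fin PhiE_prob. Qed.

Lemma Phi_le1 (t : R) : Phi t <= 1.
Proof. by rewrite -lee_fin PhiE_prob; apply: probability_le1. Qed.

Lemma is_derive_Phi (t : R) : is_derive t 1 Phi (gpdf t).
Proof.
have tt : t < t + 1 by rewrite ltrDl.
have cg : {for t, continuous (@gpdf R)}.
  apply: differentiable_continuous; apply/derivable1_diffP.
  by apply: ex_derive; exact: is_derive_gpdf.
have ig : mu.-integrable `]-oo, t + 1] (EFin \o @gpdf R).
  by apply: integrableS integrable_gpdf.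
have [dP PE] := @continuous_FTC1 R (@gpdf R) -oo%O t (t + 1) tt ig (ltNyr _) cg.
have -> : Phi = fun x => \int[mu]_(t in `]-oo, x]) gpdf t.
  by apply/funext => x; rewrite PhiE.
by apply: DeriveDef => //; rewrite -derive1E.
Qed.

(** The identity as a random variable under the normal law; its [cdf] is [Phi], which gives the
    limits of [Phi] at both ends. *)
Let idR : measurableTypeR R -> R := idfun.
HB.instance Definition _ :=
  @isMeasurableFun.Build _ _ _ _ idR (@measurable_id _ _ setT).

Let cdfE t : cdf (idR : {RV (normal_prob 0 1) >-> R}) t = (Phi t)%:E.
Proof. by rewrite PhiE_prob. Qed.

Lemma Phi_Ny (e w : R) : 0 < e -> exists2 t, t <= w & Phi t < e.
Proof.
move=> e0; have /fine_cvgP[_ /cvgrPdist_lt/(_ _ e0)] :=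
  cvg_cdfNy0 (idR : {RV (normal_prob 0 1) >-> R}).
move=> [M [_ hM]]; exists (Num.min w (M - 1)); first by rewrite ge_min lexx.
have /hM : Num.min w (M - 1) < M by rewrite gt_min ltrBlDr ltrDl ltr01 orbT.
by rewrite compE cdfE /= sub0r normrN ger0_norm ?Phi_ge0.
Qed.

Lemma Phi_y (e w : R) : 0 < e -> exists2 t, w <= t & 1 - Phi t < e.
Proof.
move=> e0; have /fine_cvgP[_ /cvgrPdist_lt/(_ _ e0)] :=
  cvg_cdfy1 (idR : {RV (normal_prob 0 1) >-> R}).
move=> [M [_ hM]]; exists (Num.max w (M + 1)); first by rewrite le_max lexx.
have /hM : M < Num.max w (M + 1) by rewrite lt_max ltrDl ltr01 orbT.
by rewrite compE cdfE /= ger0_norm ?subr_ge0 ?Phi_le1.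
Qed.

End gaussian_cdf.

(** * The Stein solution of a half-line and the trapezoidal estimate *)

Section stein_solution.
Variable R : realType.
Implicit Types w x a b c : R.
Local Notation Phi := (@Phi R).

Lemma gpdfVN w : gpdfV (- w) = gpdfV w.
Proof. by rewrite /gpdfV sqrrN. Qed.

(** The reflected upper tail satisfies the assumptions made on [F] for the Mills ratio, so each
    bound on [A] yields one on [B]. *)
Let Phi1 x := 1 - Phi (- x).

Let dPhi1 x : is_derive x 1 Phi1 (gpdf x).
Proof.
have h := is_deriveB (is_derive_cst (1 : R) x 1)
  (is_derive1_comp (is_derive_Phi (- x)) (is_deriveNid x 1)).
apply: (is_derive_eq h); rewrite mulrN1 sub0r opprK.
by rewrite /gpdf sqrrN.
Qed.

Let Phi1_ge0 x : 0 <= Phi1 x. Proof. by rewrite subr_ge0 Phi_le1. Qed.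
Let Phi1_le1 x : Phi1 x <= 1. Proof. by rewrite lerBlDr lerDl Phi_ge0. Qed.

Let Phi1_Ny (e : R) w : 0 < e -> exists2 t, t <= w & Phi1 t < e.
Proof.
move=> /(Phi_y (- w))[t wt te]; exists (- t); first by rewrite lerNl.
by rewrite /Phi1 opprK.
Qed.

Let Phi1E w : (1 - Phi w) * gpdfV w = Phi1 (- w) * gpdfV (- w).
Proof. by rewrite /Phi1 opprK gpdfVN. Qed.

Let A w := Phi w * gpdfV w.
Let B w := (1 - Phi w) * gpdfV w.

Let A_ge0 w : 0 <= A w. Proof. exact/mills_ge0/Phi_ge0. Qed.
Let B_ge0 w : 0 <= B w. Proof. by rewrite /B Phi1E; exact: mills_ge0. Qed.

Let dA w : is_derive w 1 A (1 + w * A w).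
Proof. exact/is_derive_mills/is_derive_Phi. Qed.

Let dB w : is_derive w 1 B (- 1 + w * B w).
Proof.
have h := is_deriveM (is_deriveB (is_derive_cst (1 : R) w 1) (is_derive_Phi w))
  (is_derive_gpdfV w).
apply: (is_derive_eq h); rewrite /B /GRing.scale/= -[(cst 1 - Phi) w]/(1 - Phi w).
by rewrite sub0r mulrN [gpdfV w * _]mulrC gpdfVK; ring.
Qed.

Let A_bdd w : w <= 0 -> A w <= 1 + gpdfV 1.
Proof.
by move=> w0; apply: mills_bdd => //;
  [exact: is_derive_Phi|exact: Phi_ge0|exact: Phi_Ny|exact: Phi_le1].
Qed.

Let B_bdd w : 0 <= w -> B w <= 1 + gpdfV 1.
Proof.
by move=> w0; rewrite /B Phi1E; apply: mills_bdd => //; rewrite oppr_le0.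
Qed.

Let wA_le1 w : w <= 0 -> `|w * A w| <= 1.
Proof.
by move=> w0; apply: mul_mills_le1 => //;
  [exact: is_derive_Phi|exact: Phi_ge0|exact: Phi_Ny].
Qed.

Let wB_le1 w : 0 <= w -> `|w * B w| <= 1.
Proof.
move=> w0; rewrite /B Phi1E -normrN -mulNr; apply: mul_mills_le1 => //.
by rewrite oppr_le0.
Qed.

Let wA_ndecr a b : a <= b -> a * A a <= b * A b.
Proof.
by move=> ab; exact: (mul_mills_ndecr (@is_derive_Phi R) (@Phi_ge0 R)).
Qed.

Let wB_ndecr a b : a <= b -> a * B a <= b * B b.
Proof.
move=> ab; rewrite -lerN2 -!mulNr /B !Phi1E.
by apply: (mul_mills_ndecr dPhi1 Phi1_ge0); rewrite lerN2.
Qed.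

Variable z : R.

(** The bounded solution [f] of the equation [f' w - w * f w = (w <= z) - Phi z]. *)
Definition stein w := if w <= z then (1 - Phi z) * A w else Phi z * B w.
Local Notation f := stein.
Local Notation g w := (w * stein w).
(* Off [z], [dstein] is the derivative of [stein]; [mstein] is nondecreasing. *)
Definition dstein w := w * stein w + (w <= z)%R%:R - Phi z.
Definition mstein w := w * stein w - (w <= z)%R%:R.

Let steinE w : z <= w -> f w = Phi z * B w.
Proof.
rewrite /stein le_eqVlt => /predU1P[<-|zw]; last by rewrite leNgt zw.
by rewrite lexx /A /B; ring.
Qed.

Let Pz0 : 0 <= Phi z := Phi_ge0 z.
Let Pz1 : 0 <= 1 - Phi z. Proof. by rewrite subr_ge0 Phi_le1. Qed.

Let Phi_ndecr a b : a <= b -> Phi a <= Phi b.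
Proof.
move=> ab; have [c _ E] := mvt_le ab (@is_derive_Phi R).
by rewrite -subr_ge0 E mulr_ge0 ?subr_ge0// ltW// gpdf_gt0.
Qed.

Let stein_le_A w : w <= z -> 0 <= w -> f w <= B w.
Proof.
move=> wz w0; rewrite /stein wz /A /B mulrA ler_wpM2r ?(ltW (gpdfV_gt0 _))//.
apply: (@le_trans _ _ (1 - Phi z)); first by rewrite ler_piMr// Phi_le1.
by rewrite lerD2l lerN2 Phi_ndecr.
Qed.

Let stein_le_B w : z <= w -> w <= 0 -> f w <= A w.
Proof.
move=> zw w0; rewrite steinE// /A /B mulrA ler_wpM2r ?(ltW (gpdfV_gt0 _))//.
apply: (@le_trans _ _ (Phi z)); last exact: Phi_ndecr.
by rewrite ler_piMr// gerBl Phi_ge0.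
Qed.

Let stein_le_A' w : w <= z -> f w <= A w.
Proof. by move=> wz; rewrite /stein wz ler_piMl// gerBl Phi_ge0. Qed.

Let stein_le_B' w : z <= w -> f w <= B w.
Proof. by move=> zw; rewrite steinE// ler_piMl// Phi_le1. Qed.

Lemma stein_ge0 w : 0 <= f w.
Proof. by rewrite /stein; case: ifPn => _; rewrite mulr_ge0. Qed.

(** [A] and [B] are each bounded on one half-line only, and the half-lines split at 0, not at [z];
    between 0 and [z] monotonicity of [Phi] allows the change of branch. *)
Let stein_le w : f w <= if w <= 0 then A w else B w.
Proof.
have [wz|/ltW zw] := leP w z; case: ifPn => [w0|].
- exact: stein_le_A'.
- by rewrite -ltNge => /ltW; exact: stein_le_A.
- exact: stein_le_B.
- by move=> _; exact: stein_le_B'.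
Qed.

Lemma stein_bdd w : `|f w| <= 1 + gpdfV 1.
Proof.
rewrite ger0_norm ?stein_ge0// (le_trans (stein_le w))//.
by case: ifPn => [|]; [exact: A_bdd|rewrite -ltNge => /ltW; exact: B_bdd].
Qed.

Lemma mul_stein_bdd w : `|g w| <= 1.
Proof.
rewrite normrM (ger0_norm (stein_ge0 w)).
apply: (le_trans (ler_wpM2l (normr_ge0 w) (stein_le w))).
case: ifPn => [w0|]; first by rewrite -(ger0_norm (A_ge0 w)) -normrM wA_le1.
by rewrite -ltNge => /ltW w0; rewrite -(ger0_norm (B_ge0 w)) -normrM wB_le1.
Qed.

Lemma dstein_bdd w : `|dstein w| <= 2.
Proof.
rewrite /dstein -addrA (le_trans (ler_normD _ _))//.
rewrite (_ : 2 = 1 + 1)// lerD ?mul_stein_bdd// ler_norml.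
by have := Phi_le1 z; have := Pz0; case: (w <= z) => /=; lra.
Qed.

Lemma mstein_bdd w : `|mstein w| <= 2.
Proof.
rewrite /mstein (le_trans (ler_normB _ _))// (_ : 2 = 1 + 1)//.
by rewrite lerD ?mul_stein_bdd//; case: (w <= z); rewrite /= ?normr1 ?normr0.
Qed.

Let leA a b : a <= b -> b <= z -> exists2 c, a <= c <= b &
  f b - f a = (b - a) * (g c + 1 - Phi z).
Proof.
move=> ab bz; have [c /andP[ac cb] E] := mvt_le ab dA.
have az := le_trans ab bz; have cz := le_trans cb bz.
exists c; first by rewrite ac.
by rewrite /stein az bz cz -mulrBr E; ring.
Qed.

Let leB a b : a <= b -> z <= a -> exists2 c, a <= c <= b &
  f b - f a = (b - a) * (g c - Phi z).
Proof.
move=> ab az; have [c /andP[ac cb] E] := mvt_le ab dB.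
have bz := le_trans az ab; have cz := le_trans az ac.
exists c; first by rewrite ac.
by rewrite !steinE// -mulrBr E; ring.
Qed.

Let gA a b : a <= b -> b <= z -> g a <= g b.
Proof.
move=> ab bz; rewrite /stein bz (le_trans ab bz) !(mulrCA _ (1 - _)).
by rewrite ler_wpM2l// wA_ndecr.
Qed.

Let gB a b : a <= b -> z <= a -> g a <= g b.
Proof.
move=> ab az; rewrite !steinE//; last exact: le_trans ab.
by rewrite !(mulrCA _ (Phi z)) ler_wpM2l// wB_ndecr.
Qed.

(* Trapezoidal rule for [dstein], which is the difference of the nondecreasing
   functions [w * stein w] and [- (w <= z)] up to a constant. *)
Let trapezoid a b : a < b ->
  `|2 * (f b - f a) - (b - a) * (dstein b + dstein a)| <=
  (b - a) * (mstein b - mstein a).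
Proof.
move=> ab; have d0 : 0 < b - a by rewrite subr_gt0.
rewrite /dstein /mstein.
have [bz|zb] := leP b z.
  have az : a <= z by exact: le_trans (ltW ab) bz.
  have [c /andP[ac cb] ->] := leA (ltW ab) bz; rewrite az /=.
  have := gA ac (le_trans cb bz); have := gA cb bz.
  rewrite (_ : _ - _ = (b - a) * (2 * (g c) - g b - g a)); last by ring.
  rewrite normrM gtr0_norm// ler_pM2l// ler_norml; lra.
have [az|za] := leP a z; last first.
  have [c /andP[ac cb] ->] := leB (ltW ab) (ltW za).
  have zc := le_trans (ltW za) ac.
  have := gB ac (ltW za); have := gB cb zc.
  rewrite (_ : _ - _ = (b - a) * (2 * (g c) - g b - g a)); last by rewrite /=; ring.
  rewrite normrM gtr0_norm// ler_pM2l// ler_norml /=; lra.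
(* The jump point [z] lies between [a] and [b]: the mean value theorem is applied on each side of
   it, and the jump is absorbed by the indicator in [mstein]. *)
have [c1 /andP[ac1 c1z] E1] := leA az (lexx z).
have [c2 /andP[zc2 c2b] E2] := leB (ltW zb) (lexx z).
have -> : f b - f a = (f b - f z) + (f z - f a) by ring.
rewrite E1 E2 /= ler_norml.
have := gA ac1 c1z; have := gA c1z (lexx z).
have := gB zc2 (lexx z); have := gB c2b zc2.
move: (g c1) (g c2) (g z) (g a) (g b) (Phi z) => x1 x2 x3 x4 x5 P h1 h2 h3 h4.
have hz : 0 <= z - a by rewrite subr_ge0.
have hb : 0 <= b - z by rewrite subr_ge0 ltW.
have -> : b - a = (b - z) + (z - a) by ring.
by move: (z - a) (b - z) hz hb => u v u0 v0; apply/andP; split; nra.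
Qed.

(** The factor [w - x] makes both sides symmetric in [w] and [x], so the estimate applies to an
    exchangeable pair whatever the order of its members. *)
Lemma stein_trapezoid w x :
  `|(w - x) * (2 * (f w - f x) - (w - x) * (dstein w + dstein x))| <=
  (w - x) * `|w - x| * (mstein w - mstein x).
Proof.
rewrite normrM; have [wx|xw|->] := ltgtP w x.
- rewrite -(opprB x w) normrN !(gtr0_norm (_ : 0 < x - w)) ?subr_gt0//.
  rewrite [leRHS](_ : _ = (x - w) * ((x - w) * (mstein x - mstein w))); last by ring.
  rewrite ler_pM2l ?subr_gt0// -normrN.
  rewrite (le_trans _ (trapezoid wx))// le_eqVlt; apply/orP; left; apply/eqP.
  by congr `| _ |; ring.
- rewrite !(gtr0_norm (_ : 0 < w - x)) ?subr_gt0// -mulrA ler_pM2l ?subr_gt0//.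
  exact: trapezoid.
- by rewrite subrr normr0 !mul0r.
Qed.

Let measurable_le_z : measurable_fun setT (fun w : R => w <= z).
Proof. exact: (@measurable_fun_ler _ _ _ _ id (cst z)). Qed.

Let measurable_indic_le : measurable_fun setT (fun w : R => (w <= z)%R%:R : R).
Proof.
rewrite (_ : (fun _ => _) = fun w => if w <= z then 1 else 0).
  by apply: measurable_fun_ifT.
by apply/funext => w; case: (w <= z).
Qed.

Lemma measurable_stein : measurable_fun setT stein.
Proof.
have cM (k k' : R -> R) : (forall x, is_derive x 1 k (k' x)) ->
    measurable_fun setT k.
  move=> dk; apply: continuous_measurable_fun => x.
  by apply/differentiable_continuous/derivable1_diffP/ex_derive.
apply: measurable_fun_ifT => //.
- by apply: measurable_funM => //; apply: cM dA.
- by apply: measurable_funM => //; apply: cM dB.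
Qed.

Lemma measurable_dstein : measurable_fun setT dstein.
Proof.
rewrite /dstein; apply: measurable_funB => //; apply: measurable_funD => //.
by apply: measurable_funM => //; exact: measurable_stein.
Qed.

Lemma measurable_mstein : measurable_fun setT mstein.
Proof.
rewrite /mstein; apply: measurable_funB => //.
by apply: measurable_funM => //; exact: measurable_stein.
Qed.

End stein_solution.

(** * Measure preserving maps and product spaces *)

Section measure_preserving.
Context {d1 d2 : measure_display} {T1 : measurableType d1}
  {T2 : measurableType d2} {R : realType}.
Variables (P1 : probability T1 R) (P2 : probability T2 R) (phi : T1 -> T2).

Definition mpres := measurable_fun setT phi /\
  forall A, measurable A -> P1 (phi @^-1` A) = P2 A.

Hypothesis hphi : mpres.
Let mphi : measurable_fun setT phi := hphi.1.

Lemma mpres_ge0_integral (f : T2 -> \bar R) : measurable_fun setT f ->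
  (forall x, 0 <= f x)%E ->
  (\int[P1]_x f (phi x) = \int[P2]_x f x)%E.
Proof.
move=> mf f0; rewrite -[LHS](@ge0_integral_pushforward _ _ _ _ _ phi mphi P1 setT f)//.
by apply: eq_measure_integral => A mA _; exact: (hphi.2 _ mA).
Qed.

Lemma mpres_L1 (f : T2 -> R) : L1 P2 f -> L1 P1 (fun x => f (phi x)).
Proof.
move=> /integrableP[mf fi]; apply/integrableP; split.
  exact: (measurableT_comp mf mphi).
rewrite (mpres_ge0_integral (f := fun x => `|(f x)%:E|%E))//.
exact: measurableT_comp.
Qed.

(** Measurability suffices because positive and negative parts are transported separately, infinite
    integrals included. *)
Lemma mpres_Ex (f : T2 -> R) : measurable_fun setT f ->
  Ex P1 (fun x => f (phi x)) = Ex P2 f.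
Proof.
move=> mf; have mf' : measurable_fun setT (EFin \o f) by exact/measurable_EFinP.
rewrite /Ex /Rintegral; congr fine.
rewrite [LHS]integralE [RHS]integralE.
rewrite -(mpres_ge0_integral (measurable_funepos mf'))// -[in RHS](mpres_ge0_integral (measurable_funeneg mf'))//.
congr (_ - _)%E; apply: eq_integral => x _.
  by rewrite -[LHS]/((((EFin \o f) \o phi)^\+)%E x) funepos_comp.
by rewrite -[LHS]/((((EFin \o f) \o phi)^\-)%E x) funeneg_comp.
Qed.

Lemma mpres_L2 (f : T2 -> R) : L2 P2 f -> L2 P1 (fun x => f (phi x)).
Proof.
by move=> [mf fi]; split; [exact: measurableT_comp|exact: mpres_L1 fi].
Qed.

Lemma mpres_L4 (f : T2 -> R) : L4 P2 f -> L4 P1 (fun x => f (phi x)).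
Proof.
by move=> [mf fi]; split; [exact: measurableT_comp|exact: mpres_L1 fi].
Qed.

End measure_preserving.

Lemma mpres_L1_inv (d1 d2 : measure_display) (T1 : measurableType d1)
    (T2 : measurableType d2) (R : realType) (P1 : probability T1 R)
    (P2 : probability T2 R) (phi : T1 -> T2) (f : T2 -> R) :
  mpres P1 P2 phi -> measurable_fun setT f -> L1 P1 (fun x => f (phi x)) -> L1 P2 f.
Proof.
move=> hphi mf /integrableP[_ fi]; apply/integrableP; split.
  exact/measurable_EFinP.
rewrite -(mpres_ge0_integral hphi (f := fun x => `|(f x)%:E|%E))//.
by apply: measurableT_comp => //; exact/measurable_EFinP.
Qed.

Lemma integrable_ae_eq d (T : measurableType d) (R : realType)
    (P : probability T R) (f g : T -> \bar R) :
  measurable_fun setT g -> {ae P, forall x, f x = g x} ->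
  P.-integrable setT f -> P.-integrable setT g.
Proof.
move=> mg fg /integrableP[mf fi]; apply/integrableP; split => //.
rewrite (_ : (\int[P]_x `|g x|)%E = \int[P]_x `|f x|)%E//.
by apply: ae_eq_integral => //;
  [exact: measurableT_comp|exact: measurableT_comp|apply: filterS fg => x ->].
Qed.

(** * Iterated expectations *)

Section fubini.
Context {d1 d2 : measure_display} {T1 : measurableType d1}
  {T2 : measurableType d2} {R : realType}.
Variables (P1 : probability T1 R) (P2 : probability T2 R).
Local Notation P := (P1 \x P2)%E.

Lemma mpres_fst : mpres P P1 fst.
Proof.
split=> // A mA; rewrite (_ : fst @^-1` A = A `*` setT); last first.
  by apply/seteqP; split => [[x y]|[x y] []].
by rewrite -[RHS]mule1 -(probability_setT P2); exact: product_measure1E.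
Qed.

Lemma mpres_snd : mpres P P2 snd.
Proof.
split=> // A mA; rewrite (_ : snd @^-1` A = setT `*` A); last first.
  by apply/seteqP; split => [[x y]|[x y] []].
by rewrite -[RHS]mul1e -(probability_setT P1); exact: product_measure1E.
Qed.

Variable F : T1 * T2 -> R.
Hypothesis iF : L1 P F.

Lemma ae_L1_slice1 : {ae P1, forall x, L1 P2 (fun y => F (x, y))}.
Proof. exact: (ae_integrable1 iF). Qed.

Lemma ae_L1_slice2 : {ae P2, forall y, L1 P1 (fun x => F (x, y))}.
Proof. exact: (ae_integrable2 iF). Qed.

Lemma measurable_Ex1 : measurable_fun setT (fun x => Ex P2 (fun y => F (x, y))).
Proof. exact: (measurableT_comp _ (measurable_fubini_F iF)). Qed.

Lemma measurable_Ex2 : measurable_fun setT (fun y => Ex P1 (fun x => F (x, y))).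
Proof. exact: (measurableT_comp _ (measurable_fubini_G iF)). Qed.

Lemma L1_Ex1 : L1 P1 (fun x => Ex P2 (fun y => F (x, y))).
Proof.
apply: integrable_ae_eq (integrable_fubini_F iF).
  exact/measurable_EFinP/measurable_Ex1.
by apply: filterS ae_L1_slice1 => x ix /=; rewrite -Ex_EFin.
Qed.

Lemma Ex_fubini1 : Ex P F = Ex P1 (fun x => Ex P2 (fun y => F (x, y))).
Proof.
rewrite /Ex /Rintegral -(integral12_prod_meas1 iF); congr fine.
apply: ae_eq_integral => //.
- exact: (measurable_fubini_F iF).
- exact/measurable_EFinP/measurable_Ex1.
- by apply: filterS ae_L1_slice1 => x ix _ /=; rewrite -Ex_EFin.
Qed.

Lemma Ex_fubini2 : Ex P F = Ex P2 (fun y => Ex P1 (fun x => F (x, y))).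
Proof.
rewrite /Ex /Rintegral -(integral21_prod_meas1 iF); congr fine.
apply: ae_eq_integral => //.
- exact: (measurable_fubini_G iF).
- exact/measurable_EFinP/measurable_Ex2.
- by apply: filterS ae_L1_slice2 => x ix _ /=; rewrite -Ex_EFin.
Qed.

End fubini.

(** * Conditional means over the second factor *)

Section conditional_mean.
Context {d1 d2 : measure_display} {T1 : measurableType d1}
  {T2 : measurableType d2} {R : realType}.
Variables (P1 : probability T1 R) (P2 : probability T2 R).
Local Notation P := (P1 \x P2)%E.
Implicit Types u v : T1 * T2 -> R.

Definition cmean u (x : T1) : R := Ex P2 (fun y => u (x, y)).

Lemma L2_slice1 u : L2 P u -> {ae P1, forall x, L2 P2 (fun y => u (x, y))}.
Proof.
move=> [mu iu]; apply: filterS (ae_L1_slice1 iu) => x ix; split => //.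
exact: (measurableT_comp mu).
Qed.

Lemma L2_cmean u : L2 P u -> L2 P1 (cmean u).
Proof.
move=> iu; have iu1 := L2_L1 iu.
split; first exact: (measurable_Ex1 iu1).
have mu2 : measurable_fun setT (cmean u) by exact: (measurable_Ex1 iu1).
have mq : measurable_fun setT (fun x => Ex P2 (fun y => u (x, y) ^+ 2)).
  exact: (measurable_Ex1 iu.2).
apply/integrableP; split; first exact/measurable_EFinP/measurable_funX.
have /integrableP[_] := L1_Ex1 iu.2; apply: le_lt_trans.
apply: ae_ge0_le_integral => //.
- by apply: measurableT_comp => //; exact/measurable_EFinP/measurable_funX.
- by apply: measurableT_comp => //; exact/measurable_EFinP.
apply: filterS (L2_slice1 iu) => x ix _ /=.
rewrite lee_fin ger0_norm ?sqr_ge0// ger0_norm; last first.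
  by apply: Ex_ge0 => y; exact: sqr_ge0.
have := Ex_CS ix (L2_cst P2 1).
rewrite (eq_Ex P2 (fun y => mulr1 _)) expr1n Ex_cst mulr1; exact.
Qed.

Lemma le_Ex_cmean u : L2 P u ->
  Ex P1 (fun x => cmean u x ^+ 2) <= Ex P (fun z => u z ^+ 2).
Proof.
move=> iu; rewrite (Ex_fubini1 iu.2) -lee_fin.
rewrite -Ex_EFin; last exact: (L2_cmean iu).2.
rewrite -Ex_EFin; last exact: (L1_Ex1 iu.2).
apply: ae_ge0_le_integral => //.
- by move=> x _; rewrite lee_fin sqr_ge0.
- exact/measurable_EFinP/measurable_funX/(measurable_Ex1 (L2_L1 iu)).
- by move=> x _; rewrite lee_fin; apply: Ex_ge0 => y; exact: sqr_ge0.
- exact/measurable_EFinP/(measurable_Ex1 iu.2).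
apply: filterS (L2_slice1 iu) => x ix _ /=; rewrite lee_fin.
have := Ex_CS ix (L2_cst P2 1).
rewrite (eq_Ex P2 (fun y => mulr1 _)) expr1n Ex_cst mulr1; exact.
Qed.

Lemma Ex_cmean_mul u (h : T1 -> R) : measurable_fun setT h -> L1 P u ->
  L1 P (fun z => h z.1 * u z) ->
  Ex P1 (fun x => h x * cmean u x) = Ex P (fun z => h z.1 * u z).
Proof.
move=> mh iu ihu; rewrite (Ex_fubini1 ihu); apply: ae_eq_Ex.
- by apply: measurable_funM => //; exact: (measurable_Ex1 iu).
- exact: (measurable_Ex1 ihu).
by apply: filterS (ae_L1_slice1 iu) => x ix /=; rewrite ExZ.
Qed.

End conditional_mean.

(** * Exchanging coordinates of independent copies *)

(** A cylinder over one factor is a product with [setT], whence the two assumptions. This provides a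
    pi-system of products of rectangles on which laws of two copies can be compared. *)
Lemma measurable_prod_generated (T1 T2 : pointedType) (C1 : set (set T1))
    (C2 : set (set T2)) : C1 setT -> C2 setT ->
  @measurable _ (g_sigma_algebraType C1 * g_sigma_algebraType C2)%type =
  <<s [set A `*` B | A in C1 & B in C2] >>.
Proof.
move=> C1T C2T; rewrite eqEsubset; split.
  apply: smallest_sub; first exact: smallest_sigma_algebra.
  rewrite subUset; split.
    rewrite [X in X `<=` _](_ : _ = preimage_set_system setT fst <<s C1 >>)//.
    rewrite -g_sigma_preimageE; apply: sub_sigma_algebra2.
    move=> _ [A CA <-]; rewrite setTI; exists A => //; exists setT => //.
    by apply/seteqP; split => [[x y] []|[x y]].
  rewrite [X in X `<=` _](_ : _ = preimage_set_system setT snd <<s C2 >>)//.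
  rewrite -g_sigma_preimageE; apply: sub_sigma_algebra2.
  move=> _ [B CB <-]; rewrite setTI; exists setT => //; exists B => //.
  by apply/seteqP; split => [[x y] []|[x y]].
apply: smallest_sub; first exact: smallest_sigma_algebra.
move=> _ [A CA] [B CB] <-; apply: measurableX.
  exact: sub_sigma_algebra.
exact: sub_sigma_algebra.
Qed.

(** * The coordinate space and the exchange of coordinates *)

Section coordinates.
Context {R : realType} {n : nat} {dE : 'I_n -> measure_display}
  {E : forall i, measurableType (dE i)}.

Definition rect (B : forall i, set (E i)) : set (forall i, E i) :=
  [set x | forall i, B i (x i)].

Definition rects : set (set (forall i, E i)) :=
  [set rect B | B in [set B | forall i, measurable (B i)]].

(** The product sigma-field on a dependent product, presented through the pi-system of
    rectangles. *)
Definition cspace := g_sigma_algebraType rects.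
HB.instance Definition _ := Measurable.on cspace.

Lemma rectI (A B : forall i, set (E i)) :
  rect A `&` rect B = rect (fun i => A i `&` B i).
Proof.
by apply/seteqP; split => [x [xA xB] i|x xAB]; [split|split => i; case: (xAB i)].
Qed.

Lemma rects_setI : setI_closed rects.
Proof.
move=> _ _ [A mA <-] [B mB <-]; rewrite rectI; exists (fun i => A i `&` B i) => //.
by move=> i; exact: measurableI.
Qed.

Lemma rectT : rect (fun=> setT) = setT.
Proof. by apply/seteqP; split. Qed.

Lemma rects_setT : rects setT.
Proof. by exists (fun=> setT); [move=> i|rewrite rectT]. Qed.

Lemma measurable_rect (B : forall i, set (E i)) :
  (forall i, measurable (B i)) -> measurable (rect B : set cspace).
Proof. by move=> mB; apply: sub_sigma_algebra; exists B. Qed.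

Lemma measurable_to_cspace d (T : measurableType d) (f : T -> cspace) :
  (forall i, measurable_fun setT (fun x => f x i)) -> measurable_fun setT f.
Proof.
move=> mf; apply: (measurability (rects : set (set cspace))) => // _ [_ [B mB <-] <-].
rewrite setTI (_ : _ @^-1` _ = \bigcap_i (fun x => f x i) @^-1` B i).
  apply: fin_bigcap_measurable => // i _.
  by rewrite -[_ @^-1` _]setTI; exact: (mf i measurableT _ (mB i)).
by apply/seteqP; split => [x xB i _|x xB i]; [exact: xB|exact: xB].
Qed.

Lemma measurable_coord i : measurable_fun setT (fun x : cspace => x i).
Proof.
move=> _ B mB; rewrite setTI.
(* The cylinder as a rectangle: [B] must be transported along [j = i], since the type of the factor
   depends on the index. *)
pose C j : set (E j) := if j =P i is ReflectT e then
  ecast k (set (E k)) (esym e) B else setT.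
rewrite (_ : _ @^-1` _ = rect C).
  apply: measurable_rect => j; rewrite /C; case: eqP => // e.
  by destruct e.
apply/seteqP; split => x; rewrite /C /rect/=.
  by move=> Bx j; case: eqP => // e; destruct e.
by move=> /(_ i); case: eqP => // e; rewrite (eq_irrelevance e erefl).
Qed.

Definition mix (S : {set 'I_n}) (x y : cspace) : cspace :=
  fun i => if i \in S then y i else x i.

Lemma mixE S x y i : mix S x y i = if i \in S then y i else x i.
Proof. by []. Qed.

Lemma measurable_mix S : measurable_fun setT (fun z : cspace * cspace =>
  mix S z.1 z.2).
Proof.
apply: measurable_to_cspace => i; rewrite /mix; case: (i \in S).
  exact: (measurableT_comp (@measurable_coord i) measurable_snd).
exact: (measurableT_comp (@measurable_coord i) measurable_fst).
Qed.

Definition mswap S (z : cspace * cspace) := (mix S z.1 z.2, mix S z.2 z.1).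

Variable mu : probability cspace R.
(** The form in which independence enters: [mu] factorises over rectangles, with some set functions
    [m i] as factors. *)
Hypothesis mu_rect : exists m : forall i, set (E i) -> \bar R,
  forall B : forall i, set (E i), (forall i, measurable (B i)) ->
  mu (rect B) = (\prod_i m i (B i))%E.

(** On a product of two rectangles the exchange only permutes factors [m i] between the copies;
    products of rectangles form a generating pi-system. *)
Lemma mpres_mswap S : mpres (mu \x mu)%E (mu \x mu)%E (mswap S).
Proof.
have ms : measurable_fun setT (mswap S).
  apply: (measurable_fun_pair (f := fun z => mix S z.1 z.2)
    (g := fun z => mix S z.2 z.1)); first exact: measurable_mix.
  apply: (measurableT_comp (f := fun z : cspace * cspace => mix S z.1 z.2)
    (g := fun z => (z.2, z.1))); first exact: measurable_mix.
  exact: measurable_swap.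
split => // A mA.
pose m' := pushforward (mu \x mu)%E (mswap S).
rewrite -[LHS]/(m' A).
pose C : set (set cspace) := rects.
apply: (measure_unique [set A `*` B | A in C & B in C] (fun=> setT)) => //.
- by rewrite -measurable_prod_generated//; exact: rects_setT.
- move=> _ _ [A1 h1 [A2 h2 <-]] [B1 h3 [B2 h4 <-]]; rewrite -setXI.
  exists (A1 `&` B1); first exact: rects_setI.
  by exists (A2 `&` B2) => //; exact: rects_setI.
- move=> i; exists setT; first exact: rects_setT.
  by exists setT; [exact: rects_setT|rewrite setXTT].
- by rewrite bigcup_const.
- case: mu_rect => m mE _ [_ [A1 m1 <-]] [_ [B1 m2 <-]] <-.
  rewrite -[LHS]/((mu \x mu)%E (mswap S @^-1` (rect A1 `*` rect B1))).
  pose A2 i := if i \in S then B1 i else A1 i.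
  pose B2 i := if i \in S then A1 i else B1 i.
  have mA2 i : measurable (A2 i) by rewrite /A2; case: ifP.
  have mB2 i : measurable (B2 i) by rewrite /B2; case: ifP.
  rewrite (_ : _ @^-1` _ = (rect A2 : set cspace) `*` (rect B2 : set cspace)).
    transitivity (mu (rect A2) * mu (rect B2))%E.
      by apply: product_measure1E; exact: measurable_rect.
    transitivity (mu (rect A1) * mu (rect B1))%E; last first.
      by apply/esym; apply: product_measure1E; exact: measurable_rect.
    rewrite !mE// -!big_split/=; apply: eq_bigr => i _.
    by rewrite /A2 /B2; case: ifP => // _; rewrite muleC.
  apply/seteqP; split => -[x y] [/= xA yB]; split => /= i;
    move: (xA i) (yB i); rewrite /A2 /B2 /= ?mixE; case: ifP => //.
- move=> _; rewrite -[X in (X < _)%E]/((mu \x mu)%E setT).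
  by rewrite probability_setT ltry.
Qed.

End coordinates.

(** * Two copies, and expectations annihilated by degeneracy *)

Section two_copies.
Context {R : realType} {n : nat} {dE : 'I_n -> measure_display}
  {E : forall i, measurableType (dE i)}.
Local Notation T := (@cspace n dE E).
Implicit Types (S : {set 'I_n}) (i j : 'I_n) (x y : T) (z : T * T).

Definition xm S z : T := mix S z.1 z.2.

Lemma xmE S z i : xm S z i = if i \in S then z.2 i else z.1 i.
Proof. by []. Qed.

Lemma cspaceP x y : (forall i, x i = y i) -> x = y.
Proof. exact: functional_extensionality_dep. Qed.

Definition symd S S' : {set 'I_n} := [set i | (i \in S) (+) (i \in S')]%SET.

Lemma xm0 z : xm finset.set0 z = z.1.
Proof. by apply: cspaceP => i; rewrite xmE inE. Qed.

Lemma xmT z : xm [set: 'I_n] z = z.2.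
Proof. by apply: cspaceP => i; rewrite xmE inE. Qed.

Lemma xm_mswap S S' z : xm S (mswap S' z) = xm (symd S S') z.
Proof.
apply: cspaceP => i; rewrite /symd !xmE /= !mixE inE.
by case: (i \in S); case: (i \in S').
Qed.

Lemma xmC S z : xm S (z.2, z.1) = xm (~: S) z.
Proof. by apply: cspaceP => i; rewrite !xmE inE /=; case: (i \in S). Qed.

(** Not depending on a coordinate is encoded as invariance under overwriting it, at every point;
    this is stable under exchanges and involves no sub-sigma-field. *)
Definition free1 i (F : T * T -> R) :=
  forall x y w, F (mix [set i] x w, y) = F (x, y).
Definition free2 i (F : T * T -> R) :=
  forall x y w, F (x, mix [set i] y w) = F (x, y).

Lemma free2_mswap S i F : i \in S -> free2 i F -> free1 i (F \o mswap S).
Proof.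
move=> iS fF x y w; rewrite /= /mswap/= -[RHS](fF _ _ (mix S y w)); congr (F (_, _)).
  apply: cspaceP => k; rewrite !mixE !inE.
  by case: eqVneq => // ->; rewrite iS.
by apply: cspaceP => k; rewrite !mixE !inE; case: eqVneq => // ->; rewrite iS.
Qed.

Variable mu : probability T R.
Hypothesis mu_rect : exists m : forall i, set (E i) -> \bar R,
  forall B : forall i, set (E i), (forall i, measurable (B i)) ->
  mu (rect B) = (\prod_i m i (B i))%E.
Local Notation M := (mu \x mu)%E.
Local Notation E1 := (Ex mu).
Local Notation E2 := (Ex M).

Let sw S : mpres M M (mswap S) := mpres_mswap mu_rect S.

Lemma E2_mswap S F : measurable_fun setT F -> E2 (fun z => F (mswap S z)) = E2 F.
Proof. exact: (mpres_Ex (sw S)). Qed.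

Lemma mpres_xm S : mpres M mu (xm S).
Proof.
split; first exact: measurable_mix.
move=> A mA; have mA' : measurable (fst @^-1` A : set (T * T)).
  by rewrite -[_ @^-1` _]setTI; apply: measurable_fst.
by rewrite -((mpres_fst mu mu).2 _ mA) -((sw S).2 _ mA').
Qed.

Lemma L4_xm S k : L4 mu k -> L4 M (fun z => k (xm S z)).
Proof. exact: (mpres_L4 (mpres_xm S)). Qed.
Lemma L2_xm S k : L2 mu k -> L2 M (fun z => k (xm S z)).
Proof. exact: (mpres_L2 (mpres_xm S)). Qed.
Lemma L1_xm S k : L1 mu k -> L1 M (fun z => k (xm S z)).
Proof. exact: (mpres_L1 (mpres_xm S)). Qed.
Lemma meas_xm S (k : T -> R) : measurable_fun setT k ->
  measurable_fun setT (fun z => k (xm S z)).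
Proof. by move=> mk; exact: (measurableT_comp mk (@measurable_mix _ _ _ S)). Qed.
Lemma E2_xm S k : measurable_fun setT k -> E2 (fun z => k (xm S z)) = E1 k.
Proof. exact: (mpres_Ex (mpres_xm S)). Qed.
Lemma E2_fst (k : T -> R) : measurable_fun setT k -> E2 (fun z => k z.1) = E1 k.
Proof. exact: (mpres_Ex (mpres_fst mu mu)). Qed.

Definition degen i (k : T -> R) :=
  {ae mu, forall x, E1 (fun y => k (mix [set i] x y)) = 0}.

Section degenerate.
Variables (i : 'I_n) (k : T -> R).
Hypotheses (ik : L1 mu k) (dk : degen i k).

(** Resampling coordinate [i] keeps the law and is not seen by [h]; integrating the new coordinate
    first gives 0. *)
Lemma degen_E1 (h : T -> R) : measurable_fun setT h ->
  (forall x y, h (mix [set i] x y) = h x) -> L1 mu (fun x => h x * k x) ->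
  E1 (fun x => h x * k x) = 0.
Proof.
move=> mh fh ihk; rewrite -(E2_xm [set i]); last exact: L1_meas ihk.
have ihk' := L1_xm [set i] ihk.
rewrite (eq_Ex M (fun z => congr1 (fun r => r * _) (fh z.1 z.2))) in ihk' *.
rewrite -(Ex_cmean_mul mh)//; last 2 first.
- exact: L1_xm.
- rewrite [X in L1 _ X](_ : _ = fun z => h (xm [set i] z) * k (xm [set i] z))//.
  by apply/funext => z; rewrite /xm fh.
rewrite (_ : 0 = E1 (fun=> 0)); last by rewrite Ex_cst.
apply: ae_eq_Ex => //.
  by apply: measurable_funM => //; apply: measurable_Ex1; exact: L1_xm.
by apply: filterS dk => x; rewrite /cmean /xm /= => ->; rewrite mulr0.
Qed.

Lemma degen_E2 (F : T * T -> R) : measurable_fun setT F -> free1 i F ->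
  L1 M (fun z => F z * k z.1) -> E2 (fun z => F z * k z.1) = 0.
Proof.
move=> mF fF iFk; rewrite (Ex_fubini2 iFk).
rewrite (_ : 0 = E1 (fun=> 0)); last by rewrite Ex_cst.
apply: ae_eq_Ex => //; first exact: (measurable_Ex2 iFk).
apply: filterS (ae_L1_slice2 iFk) => y iy /=; apply: degen_E1 => //.
exact: (measurableT_comp mF).
Qed.

(** [mswap S] turns [xm S z] into the first copy and, as [i] lies in [S], freeness in the second
    copy into freeness in the first. *)
Lemma degen_E2_in S (F : T * T -> R) : i \in S -> measurable_fun setT F ->
  free2 i F -> L1 M (fun z => F z * k (xm S z)) ->
  E2 (fun z => F z * k (xm S z)) = 0.
Proof.
move=> iS mF fF iFk; rewrite -(E2_mswap S); last exact: L1_meas iFk.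
have := mpres_L1 (sw S) iFk.
rewrite (_ : (fun z => _) = (fun z => (F \o mswap S) z * k z.1)); last first.
  apply/funext => z /=; rewrite xm_mswap (_ : symd S S = finset.set0) ?xm0//.
  by apply/setP => j; rewrite !inE addbb.
apply: degen_E2; last exact: free2_mswap.
exact: (measurableT_comp mF (sw S).1).
Qed.

End degenerate.

End two_copies.

(** * Averages over coordinates and the number operator *)

Section averaging.
Context {R : realType} {n : nat} {dE : 'I_n -> measure_display}
  {E : forall i, measurableType (dE i)}.
Local Notation T := (@cspace n dE E).
Implicit Types (S : {set 'I_n}) (i j : 'I_n) (x y : T) (z : T * T).
Implicit Types (h k : T -> R).
Variable mu : probability T R.
Hypothesis mu_rect : exists m : forall i, set (E i) -> \bar R,
  forall B : forall i, set (E i), (forall i, measurable (B i)) ->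
  mu (rect B) = (\prod_i m i (B i))%E.
Local Notation M := (mu \x mu)%E.
Local Notation E1 := (Ex mu).
Local Notation E2 := (Ex M).

(* Given the first copy, functions of disjoint sets of coordinates of the
   second copy are independent. *)
Lemma Ex_cmeanM S (u v : T * T -> R) : L2 M u -> L2 M v ->
  (forall x y w, u (x, mix S y w) = u (x, y)) ->
  (forall x y w, v (x, mix (~: S) y w) = v (x, y)) ->
  E1 (fun x => cmean mu u x * cmean mu v x) = E2 (fun z => u z * v z).
Proof.
move=> iu iv fu fv; have iuv := L1M iu iv.
rewrite (Ex_fubini1 iuv); apply: ae_eq_Ex.
- by apply: measurable_funM; [exact: (measurable_Ex1 (L2_L1 iu))|
                             exact: (measurable_Ex1 (L2_L1 iv))].
- exact: (measurable_Ex1 iuv).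
have := L2_slice1 iv; have := L2_slice1 iu; apply: filterS2 => x ix jx /=.
have ijx : L1 M (fun z => u (x, z.1) * v (x, z.2)).
  by apply: L1M; [exact: (mpres_L2 (mpres_fst mu mu) ix)|
                  exact: (mpres_L2 (mpres_snd mu mu) jx)].
transitivity (E2 (fun z => u (x, z.1) * v (x, z.2))).
  rewrite (Ex_fubini1 ijx) /cmean mulrC -(ExZ _ (L2_L1 ix)).
  by apply: eq_Ex => y; rewrite /= (ExZ _ (L2_L1 jx)) mulrC.
(* Exchanging the coordinates in [S] lets both factors read the same copy: [u] ignores [S], and [v]
   its complement. *)
rewrite -(E2_mswap mu_rect S); last exact: L1_meas ijx.
rewrite -(E2_fst mu (k := fun y => u (x, y) * v (x, y))); last first.
  exact: (L1_meas (L1M ix jx)).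
apply: eq_Ex => z /=; rewrite fu; congr (_ * _).
by rewrite -[RHS](fv x z.1 z.2); congr (v (x, _)); exact: (xmC S z).
Qed.

(** The conditional expectation given the coordinates outside [S]. *)
Definition avg S (h : T -> R) : T -> R := cmean mu (fun z => h (xm S z)).

Lemma L2_avg S h : L2 mu h -> L2 mu (avg S h).
Proof. by move=> ih; apply: L2_cmean; exact: L2_xm. Qed.

Lemma E1_avg S h k : L2 mu h -> L2 mu k ->
  E1 (fun x => avg S h x * k x) = E2 (fun z => k z.1 * h (xm S z)).
Proof.
move=> ih ik; have ih' := L2_xm mu_rect S ih.
rewrite -(Ex_cmean_mul (L2_meas ik) (L2_L1 ih')).
  by apply: eq_Ex => x; rewrite mulrC.
by apply: L1M => //; exact: (mpres_L2 (mpres_fst mu mu) ik).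
Qed.

Lemma symdd S : symd S S = finset.set0.
Proof. by apply/setP => i; rewrite !inE addbb. Qed.

Lemma symd0 S : symd finset.set0 S = S.
Proof. by apply/setP => i; rewrite !inE. Qed.

(** The pair of [z.1] and [xm S z] is exchangeable. *)
Lemma E2_flip S h k : measurable_fun setT h -> measurable_fun setT k ->
  E2 (fun z => k z.1 * h (xm S z)) = E2 (fun z => h z.1 * k (xm S z)).
Proof.
move=> mh mk; rewrite -(E2_mswap mu_rect S (F := fun z => k z.1 * h (xm S z))).
  by apply: eq_Ex => z; rewrite xm_mswap symdd xm0 mulrC.
apply: measurable_funM; last exact: meas_xm.
exact: (measurableT_comp mk measurable_fst).
Qed.

Lemma avg_sa S h k : L2 mu h -> L2 mu k ->
  E1 (fun x => avg S h x * k x) = E1 (fun x => h x * avg S k x).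
Proof.
move=> ih ik; rewrite E1_avg// (E2_flip _ (L2_meas ih) (L2_meas ik)).
by rewrite -E1_avg//; apply: eq_Ex => x; rewrite mulrC.
Qed.

Lemma avg_free S h x y : avg S h (mix S x y) = avg S h x.
Proof.
apply: eq_Ex => w; rewrite /xm /=; congr h; apply: cspaceP => i.
by rewrite !mixE; case: ifP => // ->.
Qed.

Lemma avg_cst S h : (forall x y, h (mix S x y) = h x) -> avg S h = h.
Proof.
move=> fh; apply/funext => x; rewrite /avg /cmean.
by rewrite -[RHS](Ex_cst mu); apply: eq_Ex => y; exact: fh.
Qed.

Lemma avg_idem S h : avg S (avg S h) = avg S h.
Proof. by apply: avg_cst; exact: avg_free. Qed.

Lemma avg_proj S h k : L2 mu h -> L2 mu k ->
  E1 (fun x => avg S h x * avg S k x) = E1 (fun x => avg S h x * k x).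
Proof.
by move=> ih ik; rewrite avg_sa ?avg_idem//; [rewrite avg_sa|exact: L2_avg].
Qed.

Lemma E2_flip_ge0 S h : L2 mu h -> 0 <= E2 (fun z => h z.1 * h (xm S z)).
Proof.
by move=> ih; rewrite -E1_avg// -avg_proj//; apply: Ex_ge0 => x; exact: sqr_ge0.
Qed.

Lemma avg_comm i j h k : L2 mu h -> L2 mu k ->
  E1 (fun x => avg [set i] h x * avg [set j] k x) =
  E1 (fun x => avg [set j] h x * avg [set i] k x).
Proof.
move=> ih ik; have [->//|ij] := eqVneq i j.
have ji : j != i by rewrite eq_sym.
have key a b (u v : T -> R) : a != b -> L2 mu u -> L2 mu v ->
    E1 (fun x => avg [set a] u x * avg [set b] v x) =
    E2 (fun z => u (xm [set a] z) * v (xm [set b] z)).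
  move=> ab iu iv; apply: (Ex_cmeanM (S := [set b])); try exact: L2_xm.
    move=> x y w; congr u; apply: cspaceP => l; rewrite !xmE /= !mixE !inE.
    by case: eqVneq => // ->; rewrite (negbTE ab).
  move=> x y w; congr v; apply: cspaceP => l; rewrite !xmE /= !mixE !inE.
  by case: eqVneq.
(* The symmetric difference with [[set i; j]] interchanges [[set i]] and [[set j]]. *)
rewrite !key// -(E2_mswap mu_rect [set i; j]); last first.
  by apply: measurable_funM; apply: meas_xm; [exact: L2_meas ih|exact: L2_meas ik].
apply: eq_Ex => z; rewrite !xm_mswap.
congr (h (xm _ _) * k (xm _ _)); apply/setP => l; rewrite !inE.
  by case: (eqVneq l i) => [->|]; case: (eqVneq _ j) => //= e; rewrite -?e ?eqxx// in ij.
by case: (eqVneq l i) => [->|]; case: (eqVneq _ j) => //= e; rewrite -?e ?eqxx// in ij.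
Qed.

(** The orthogonal projection onto the part of [h] that depends on coordinate [i]; the sum of the
    [dev i] is the number operator. *)
Definition dev i (h : T -> R) : T -> R := fun x => h x - avg [set i] h x.

Lemma L2_dev i h : L2 mu h -> L2 mu (dev i h).
Proof. by move=> ih; apply: L2B => //; exact: L2_avg. Qed.

Lemma ipBl (h k l : T -> R) : L2 mu h -> L2 mu k -> L2 mu l ->
  E1 (fun x => (h x - k x) * l x) =
  E1 (fun x => h x * l x) - E1 (fun x => k x * l x).
Proof.
move=> ih ik il; rewrite -ExB; [|exact: L1M..].
by apply: eq_Ex => x; rewrite mulrBl.
Qed.

Lemma ipBr (h k l : T -> R) : L2 mu h -> L2 mu k -> L2 mu l ->
  E1 (fun x => l x * (h x - k x)) =
  E1 (fun x => l x * h x) - E1 (fun x => l x * k x).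
Proof.
move=> ih ik il; rewrite -ExB; [|exact: L1M..].
by apply: eq_Ex => x; rewrite mulrBr.
Qed.

Lemma dev_sa i h k : L2 mu h -> L2 mu k ->
  E1 (fun x => dev i h x * k x) = E1 (fun x => h x * dev i k x).
Proof.
by move=> ih ik; rewrite ipBl ?ipBr ?avg_sa//; exact: L2_avg.
Qed.

Lemma dev_proj i h k : L2 mu h -> L2 mu k ->
  E1 (fun x => dev i h x * dev i k x) = E1 (fun x => dev i h x * k x).
Proof.
move=> ih ik; have ih' := L2_avg [set i] ih; have ik' := L2_avg [set i] ik.
rewrite ipBr//; last exact: L2_dev.
rewrite [X in _ - X]ipBl// avg_proj// -[X in _ - (X - _)]avg_sa//.
by rewrite subrr subr0.
Qed.

Lemma dev_comm i j h k : L2 mu h -> L2 mu k ->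
  E1 (fun x => dev i h x * dev j k x) = E1 (fun x => dev j h x * dev i k x).
Proof.
move=> ih ik.
have ia l a : L2 mu a -> L2 mu (avg [set l] a) by exact: L2_avg.
have dd a b : E1 (fun x => dev a h x * dev b k x) =
    E1 (fun x => h x * k x) - E1 (fun x => avg [set b] h x * k x) -
    (E1 (fun x => avg [set a] h x * k x) -
     E1 (fun x => avg [set a] h x * avg [set b] k x)).
  have ia' := ia a _ ih; have ib' := ia b _ ik.
  rewrite /dev ipBl//; last exact: L2B.
  by rewrite ipBr// ipBr// (avg_sa [set b] ih ik).
rewrite (dd i j) (dd j i) (avg_comm i j ih ik).
by move: (E1 _) (E1 _) (E1 _) (E1 _) => a b c e; ring.
Qed.

Section number_operator.
Variables (K : finType) (F : K -> T -> R) (D : K -> {set 'I_n}) (m : nat).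
Variable h : T -> R.
Hypotheses (iF : forall k : K, L2 mu (F k)) (ih : L2 mu h).
Hypothesis hE : forall x, h x = \sum_(k : K) F k x.
Hypothesis fF : forall (k : K) i x y, i \notin D k -> F k (mix [set i] x y) = F k x.
Hypothesis cD : forall k : K, (#|D k| <= m)%N.

Lemma number_dev_bound :
  \sum_i E1 (fun x => dev i h x * h x) <= m%:R * E1 (fun x => h x * h x) /\
  \sum_i \sum_j E1 (fun x => dev i h x * dev j h x) <=
    m%:R * \sum_i E1 (fun x => dev i h x * h x).
Proof.
refine (@number_operator_bound R (T -> R : zmodType) (L2 mu)
  (fun a b => E1 (fun x => a x * b x)) 'I_n dev _ _ _ _ _ _ _ _ K
  (index_enum 'I_n) m h F (fun a j => j \in D a) ih iF _ _ _).
- by move=> a b; exact: L2B.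
- by move=> i a; exact: L2_dev.
- by move=> a b c; exact: ipBl.
- by move=> a b _ _; apply: eq_Ex => x; rewrite mulrC.
- by move=> a _; apply: Ex_ge0 => x; exact: sqr_ge0.
- by move=> i a b; exact: dev_sa.
- by move=> i a b; exact: dev_proj.
- by move=> i j a b; exact: dev_comm.
(* [dev j] annihilates the components that do not depend on [j]. *)
- move=> a j _ jk l il; rewrite -dev_sa// (_ : dev j (F a) = fun=> 0).
    by under eq_Ex do rewrite mul0r; rewrite Ex_cst.
  by apply/funext => x; rewrite /dev avg_cst ?subrr// => *; exact: fF.
- by move=> a; rewrite -sum1_count sum1_card.
- move=> l il; rewrite -Ex_sum; last by move=> k _; exact: L1M.
  by apply: eq_Ex => x; rewrite hE mulr_suml.
Qed.

Lemma E1_dev i (a : T -> R) : L2 mu a -> E1 (fun x => a x * dev i h x) =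
  E2 (fun z => a z.1 * (h z.1 - h (xm [set i] z))).
Proof.
move=> ia; have i1 := mpres_L2 (mpres_fst mu mu) ia.
have i2 := mpres_L2 (mpres_fst mu mu) ih; have i3 := L2_xm mu_rect [set i] ih.
rewrite ipBr//; last exact: L2_avg.
rewrite -(E2_fst mu (k := fun x => a x * h x)); last exact: L1_meas (L1M ia ih).
under [X in _ - X]eq_Ex do rewrite mulrC.
rewrite E1_avg// -ExB; [|exact: L1M..].
by apply: eq_Ex => z; rewrite mulrBr.
Qed.

(** The number operator N satisfies [N ^ 2 <= m N <= 2 q N] at [h]. Hence [1 - q^-1 N] does not
    increase the L2 norm of [h], which is seen by expanding the square. *)
Lemma number_dev_norm (q c : R) (a : T -> R) : 0 < q -> m%:R <= 2 * q -> 0 <= c ->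
  measurable_fun setT a -> (forall x, `|a x| <= c) ->
  `|E1 (fun x => a x * h x) -
    q^-1 * \sum_i E2 (fun z => a z.1 * (h z.1 - h (xm [set i] z)))| <=
  c * Num.sqrt (E1 (fun x => h x ^+ 2)).
Proof.
move=> q0 mq c0 ma ac; have ia : L2 mu a by exact: (L2_bdd mu ma ac).
pose N x := \sum_i dev i h x.
have iN : L2 mu N by apply: L2_sum => i _; exact: L2_dev.
pose r x := h x - q^-1 * N x.
have ir : L2 mu r by apply: L2B => //; exact: L2Z.
have NN : E1 (fun x => N x * N x) =
    \sum_i \sum_j E1 (fun x => dev i h x * dev j h x).
  rewrite (eq_Ex mu (fun x => mulr_suml _ _ _ _)) Ex_sum; last first.
    by move=> i _; apply: L1M => //; exact: L2_dev.
  apply: eq_bigr => i _; rewrite (eq_Ex mu (fun x => mulr_sumr _ _ _ _)) Ex_sum//.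
  by move=> j _; apply: L1M; exact: L2_dev.
have Nh : E1 (fun x => N x * h x) = \sum_i E1 (fun x => dev i h x * h x).
  rewrite (eq_Ex mu (fun x => mulr_suml _ _ _ _)) Ex_sum//.
  by move=> i _; apply: L1M => //; exact: L2_dev.
have aN : E1 (fun x => a x * N x) =
    \sum_i E2 (fun z => a z.1 * (h z.1 - h (xm [set i] z))).
  rewrite (eq_Ex mu (fun x => mulr_sumr _ _ _ _)) Ex_sum; last first.
    by move=> i _; apply: L1M => //; exact: L2_dev.
  by apply: eq_bigr => i _; rewrite E1_dev.
have -> : E1 (fun x => a x * h x) -
    q^-1 * \sum_i E2 (fun z => a z.1 * (h z.1 - h (xm [set i] z))) =
    E1 (fun x => a x * r x).
  rewrite ipBr//; last exact: L2Z.
  rewrite -aN -ExZ; last exact: L1M.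
  by congr (_ - _); apply: eq_Ex => x; rewrite mulrCA.
apply: (le_trans (normEx_bdd c0 ma ac ir)); rewrite ler_wpM2l// ler_wsqrtr//.
have -> : E1 (fun x => r x ^+ 2) = E1 (fun x => h x ^+ 2) -
    (2 * q^-1) * E1 (fun x => N x * h x) + q^-1 ^+ 2 * E1 (fun x => N x * N x).
  have i1 := ih.2; have i2 := L1M iN ih; have i3 := L1M iN iN.
  rewrite -ExZ// -[X in _ + X]ExZ// -ExB//; last exact: L1Z.
  rewrite -ExD; [|by apply: L1B => //; exact: L1Z|exact: L1Z].
  by apply: eq_Ex => x; rewrite /r; ring.
have [_ b2] := number_dev_bound; rewrite -Nh -NN in b2.
have Nh0 : 0 <= E1 (fun x => N x * h x).
  rewrite Nh; apply: sumr_ge0 => i _; rewrite -dev_proj//.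
  by apply: Ex_ge0 => x; exact: sqr_ge0.
rewrite -addrA gerDl addrC subr_le0.
apply: (@le_trans _ _ (q^-1 ^+ 2 * (m%:R * E1 (fun x => N x * h x)))).
  by rewrite ler_wpM2l// sqr_ge0.
set v := q^-1; set y := E1 _; have v0 : 0 <= v by rewrite invr_ge0 ltW.
rewrite (_ : v ^+ 2 * _ = v * y * (m%:R * v)); last by ring.
rewrite (_ : 2 * v * y = v * y * 2); last by ring.
by rewrite ler_wpM2l ?mulr_ge0// ler_pdivrMr.
Qed.

End number_operator.
End averaging.

(** * Moments of the increments *)

Section L43.
Context {d : measure_display} {T : measurableType d} {R : realType}.
Variable P : probability T R.

(* The dual class of [L4]; it contains the products of three [L4] functions. *)
Definition L43 (F : T -> R) := measurable_fun setT F /\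
  forall k, L4 P k -> L1 P (fun x => F x * k x).

Lemma L43_L2 F : L2 P F -> L43 F.
Proof. by move=> iF; split; [case: iF|move=> k /L4_L2; exact: L1M]. Qed.

Lemma L43_M3 F G H : L4 P F -> L4 P G -> L4 P H ->
  L43 (fun x => F x * G x * H x).
Proof.
move=> iF iG iH; split.
  by do 2?apply: measurable_funM; [exact: L4_meas iF|exact: L4_meas iG|exact: L4_meas iH].
move=> k ik; rewrite (_ : (fun _ => _) = fun x => F x * G x * (H x * k x)).
  by apply: L1M; exact: L4M.
by apply/funext => x; rewrite mulrA.
Qed.

Lemma L43_X3 F : L4 P F -> L43 (fun x => F x ^+ 3).
Proof.
move=> iF; have := L43_M3 iF iF iF; congr L43.
by apply/funext => x; rewrite !exprS expr0 mulr1 mulrA.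
Qed.

End L43.

(** * Increments of a degenerate statistic and their fourth moments *)

Section kernels.
Context {R : realType} {n : nat} {dE : 'I_n -> measure_display}
  {E : forall i, measurableType (dE i)}.
Local Notation T := (@cspace n dE E).
Implicit Types (S J K : {set 'I_n}) (i j : 'I_n) (x y : T) (z : T * T).
Variable mu : probability T R.
Hypothesis mu_rect : exists m : forall i, set (E i) -> \bar R,
  forall B : forall i, set (E i), (forall i, measurable (B i)) ->
  mu (rect B) = (\prod_i m i (B i))%E.
Local Notation M := (mu \x mu)%E.
Local Notation E1 := (Ex mu).
Local Notation E2 := (Ex M).
Variables (p : nat) (g : {set 'I_n} -> T -> R).
Hypothesis g_L4 : forall J, L4 mu (g J).
Hypothesis g_free : forall J S x y, [disjoint S & J]%B -> g J (mix S x y) = g J x.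
Hypothesis g_degen : forall J i, i \in J -> degen mu i (g J).
Hypothesis g_order : forall J, #|J| != p -> g J = fun=> 0.

Definition ustat x := \sum_J g J x.
Local Notation W := ustat.

Lemma ustat_L4 : L4 mu W.
Proof. exact: L4_sum. Qed.

Let L4x S k : L4 mu k -> L4 M (fun z => k (xm S z)) := @L4_xm _ _ _ _ _ mu_rect S k.

Let L4f (k : T -> R) : L4 mu k -> L4 M (fun z => k z.1).
Proof. exact: (mpres_L4 (mpres_fst mu mu)). Qed.

Lemma g_xmI J S z : g J (xm S z) = g J (xm (S :&: J) z).
Proof.
rewrite -(@g_free J (S :\: J) (xm (S :&: J) z) z.2); last first.
  by apply/pred0P => i /=; rewrite !inE; case: (i \in J); rewrite ?andbF.
congr g; apply: cspaceP => i; rewrite mixE !xmE !inE.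
by case: (i \in S); case: (i \in J).
Qed.

Lemma g_xm_out J S z : [disjoint S & J]%B -> g J (xm S z) = g J z.1.
Proof. by move=> SJ; rewrite /xm g_free. Qed.

Lemma g_xm_in J S z : J \subset S -> g J (xm S z) = g J z.2.
Proof. by move=> /finset.setIidPr JS; rewrite g_xmI JS -[in RHS](xmT z) [RHS]g_xmI finset.setTI. Qed.

Lemma E2_g_avg (G : T * T -> R) i S J : L43 M G -> free2 i G ->
  E2 (fun z => G z * g J (xm (i |: S) z)) =
  if i \in J then 0 else E2 (fun z => G z * g J (xm S z)).
Proof.
move=> iG fG; case: ifPn => iJ.
  apply: (degen_E2_in mu_rect (i := i)) => //.
  - exact/L4_L1.
  - exact: g_degen.
  - by rewrite !inE eqxx.
  - by case: iG.
  - exact/iG.2/L4x.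
apply: eq_Ex => z; rewrite g_xmI [in RHS]g_xmI; congr (_ * g _ (xm _ _)).
apply/setP => j; rewrite !inE; case: eqVneq => // ->.
by rewrite (negbTE iJ) !andbF.
Qed.

Definition incr i z := W z.1 - W (xm [set i] z).

(** The increment in direction [i] after coordinate [j] has been resampled; [mswap [set j]]
    interchanges it with [incr i]. *)
Definition incr2 i j z := W (xm [set j] z) - W (xm [set i; j] z).

Lemma incr_L4 i : L4 M (incr i).
Proof. by apply: L4B; [exact/L4f/ustat_L4|exact/L4x/ustat_L4]. Qed.

Lemma incr2_L4 i j : L4 M (incr2 i j).
Proof. by apply: L4B; exact/L4x/ustat_L4. Qed.

Lemma E2_sum_ustat (G : T * T -> R) S : L43 M G ->
  E2 (fun z => G z * W (xm S z)) = \sum_J E2 (fun z => G z * g J (xm S z)).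
Proof.
move=> iG; rewrite (eq_Ex M (fun z => mulr_sumr _ _ _ _)) Ex_sum// => J _.
exact/iG.2/L4x.
Qed.

Lemma E2_incr (G : T * T -> R) i : L43 M G -> free2 i G ->
  E2 (fun z => G z * incr i z) = \sum_(J : {set 'I_n} | i \in J) E2 (fun z => G z * g J z.1).
Proof.
move=> iG fG.
rewrite (_ : (fun z => _) = fun z => G z * W (xm finset.set0 z) -
    G z * W (xm (i |: finset.set0) z)); last first.
  by apply/funext => z; rewrite xm0 finset.setU0 mulrBr.
rewrite ExB; [|exact/iG.2/L4x/ustat_L4..].
rewrite !E2_sum_ustat// -sumrB [RHS]big_mkcond; apply: eq_bigr => J _.
rewrite E2_g_avg//; case: ifP => _; last by rewrite subrr.
by rewrite subr0; apply: eq_Ex => z; rewrite xm0.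
Qed.

Lemma sum_E2_incr (h : T -> R) : L43 mu h -> L43 M (fun z => h z.1) ->
  \sum_i E2 (fun z => h z.1 * incr i z) = p%:R * E1 (fun x => h x * W x).
Proof.
move=> ih ih2; transitivity (\sum_i \sum_(J : {set 'I_n} | i \in J) E1 (fun x => h x * g J x)).
  apply: eq_bigr => i _; rewrite E2_incr//.
  apply: eq_bigr => J _; rewrite (E2_fst mu (k := fun x => h x * g J x))//.
  by apply: L1_meas; exact/ih.2.
rewrite (exchange_big_dep xpredT)//= (eq_Ex mu (fun x => mulr_sumr _ _ _ _)).
rewrite Ex_sum; last by move=> J _; exact/ih.2.
rewrite mulr_sumr; apply: eq_bigr => J _; rewrite sumr_const.
have [<-|Jp] := eqVneq #|J| p; first by rewrite mulr_natl.
rewrite g_order//; under eq_Ex do rewrite mulr0.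
by rewrite Ex_cst mul0rn mulr0.
Qed.

Let incrg i J z := g J z.1 - g J (xm [set i] z).

Let E2_incr2 (G : T * T -> R) i j : L43 M G -> free2 j G -> j != i ->
  E2 (fun z => G z * (incr i z - incr2 i j z)) =
  \sum_(J : {set 'I_n} | j \in J) E2 (fun z => G z * incrg i J z).
Proof.
move=> iG fG ji.
have iGg S J : L1 M (fun z => G z * g J (xm S z)) by exact/iG.2/L4x.
have iGW S : L1 M (fun z => G z * W (xm S z)) by exact/iG.2/L4x/ustat_L4.
rewrite (_ : (fun z => _) = fun z => (G z * W (xm finset.set0 z) -
    G z * W (xm (j |: finset.set0) z)) - (G z * W (xm [set i] z) -
    G z * W (xm (j |: [set i]) z))); last first.
  apply/funext => z; rewrite /incr /incr2 xm0 finset.setU0 finset.setUC; ring.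
rewrite ExB; [|exact: L1B..]; rewrite !ExB// !E2_sum_ustat// -!sumrB [RHS]big_mkcond.
apply: eq_bigr => J _; rewrite !E2_g_avg//; case: ifP => _.
  rewrite !subr0 -ExB//; apply: eq_Ex => z.
  by rewrite /incrg xm0 mulrBr.
by rewrite !subrr.
Qed.

Let incrg0 i J : i \notin J -> incrg i J = fun=> 0.
Proof.
move=> iJ; apply/funext => z; rewrite /incrg g_xm_out ?subrr//.
by rewrite disjoints1.
Qed.

Let sum_incrg i z : \sum_J incrg i J z = incr i z.
Proof. by rewrite sumrB. Qed.

(** In the coordinates other than [i], the increment in direction [i] is degenerate of order
    [p - 1]: only the kernels containing [i] enter it, and each has [p - 1] further coordinates to
    count. *)
Let sum_E2_incr2 (G : T * T -> R) i : L43 M G -> (forall j, j != i -> free2 j G) ->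
  \sum_(j | j != i) E2 (fun z => G z * (incr i z - incr2 i j z)) =
  p.-1%:R * E2 (fun z => G z * incr i z).
Proof.
move=> iG fG.
rewrite (eq_bigr (fun j => \sum_(J : {set 'I_n} | j \in J) E2 (fun z => G z * incrg i J z))).
  2: by move=> j ji; rewrite E2_incr2//; exact: fG.
rewrite (exchange_big_dep xpredT)//=.
under [in RHS]eq_Ex do rewrite -sum_incrg mulr_sumr.
rewrite Ex_sum; last first.
  by move=> J _; apply: iG.2; apply: L4B; [exact: L4f|exact: L4x].
rewrite mulr_sumr; apply: eq_bigr => J _; rewrite sumr_const.
have z0 : incrg i J = (fun=> 0) -> E2 (fun z => G z * incrg i J z) = 0.
  by move=> ->; under eq_Ex do rewrite mulr0; rewrite Ex_cst.
have [Jp|Jp] := eqVneq #|J| p; last first.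
  rewrite z0 ?mul0rn ?mulr0//; apply/funext => z.
  by rewrite /incrg g_order// subrr.
have [iJ|iJ] := boolP (i \in J); last by rewrite z0 ?incrg0// mul0rn mulr0.
rewrite -[LHS]mulr_natl; congr (_%:R * _); rewrite -Jp (cardsD1 i) iJ /=.
by apply: eq_card => j; rewrite !inE.
Qed.

Lemma incr_free2 i j : j != i -> free2 j (incr i).
Proof.
move=> ji x y w; rewrite /incr /=; congr (_ - W _); apply: cspaceP => k.
by rewrite !xmE /= !mixE !inE; case: eqVneq => // ->; rewrite eq_sym (negbTE ji).
Qed.

Lemma symd_set1 i j : j != i ->
  [/\ symd [set i] [set j] = [set i; j]%SET, symd [set j] [set i] = [set i; j]%SET,
      symd [set i; j] [set j] = [set i]%SET & symd [set i; j] [set i] = [set j]%SET].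
Proof.
move=> ji; have ij : (i == j) = false by rewrite eq_sym; exact/negbTE.
by split; apply/setP => k; rewrite !inE;
  (have [->|_] := eqVneq k i; first by rewrite ij); case: (k == j).
Qed.

Lemma incr_mswap i j z : j != i -> incr i (mswap [set j] z) = incr2 i j z.
Proof.
move=> ji; rewrite /incr /incr2 -[in LHS](xm0 (mswap _ _)) !xm_mswap symd0.
by have [-> _ _ _] := symd_set1 ji.
Qed.

Lemma incr2_mswap i j z : j != i -> incr2 i j (mswap [set j] z) = incr i z.
Proof.
move=> ji; rewrite /incr /incr2 !xm_mswap symdd xm0.
by have [_ _ -> _] := symd_set1 ji.
Qed.

Lemma incr_mswapN i z : incr i (mswap [set i] z) = - incr i z.
Proof.
by rewrite /incr -[in LHS](xm0 (mswap _ _)) !xm_mswap symd0 symdd xm0 opprB.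
Qed.

Lemma incr2_mswapN i j z : j != i -> incr2 i j (mswap [set i] z) = - incr2 i j z.
Proof.
move=> ji; rewrite /incr2 !xm_mswap opprB.
by have [_ -> _ ->] := symd_set1 ji.
Qed.

Lemma E2_incr4 i : L1 M (fun z => incr i z ^+ 4).
Proof. exact: (incr_L4 i).2. Qed.

(** With a and b for the two increments, [a^2 (a - b)^2] equals [2 a^3 (a - b) + (b^4 - a^4) / 2]
    minus [(a^2 - b^2)^2 / 2]. The fourth powers have equal expectation, and the cubic term is
    summed by the counting identity of order [p - 1]. *)
Lemma sum_E2_incr2_sqr i :
  \sum_(j | j != i) E2 (fun z => incr i z ^+ 2 * (incr i z - incr2 i j z) ^+ 2) <=
  2 * p.-1%:R * E2 (fun z => incr i z ^+ 4).
Proof.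
have fG j : j != i -> free2 j (fun z => incr i z ^+ 3).
  by move=> ji x y w; rewrite incr_free2.
have i43 : L43 M (fun z => incr i z ^+ 3) by apply: L43_X3; exact: incr_L4.
have := sum_E2_incr2 i43 fG.
under [in RHS]eq_Ex do rewrite -exprSr.
move=> sE; rewrite -mulrA -sE mulr_sumr; apply: ler_sum => j ji.
have i4 := incr_L4 i; have j4 := incr2_L4 i j.
have e4 : E2 (fun z => incr2 i j z ^+ 4) = E2 (fun z => incr i z ^+ 4).
  rewrite -(E2_mswap mu_rect [set j]); last exact: L1_meas j4.2.
  by apply: eq_Ex => z; rewrite incr2_mswap.
have i1 : L1 M (fun z => incr i z ^+ 2 * (incr i z - incr2 i j z) ^+ 2).
  by apply: L1M; apply: L4X2 => //; exact: L4B.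
have i2 : L1 M (fun z => incr i z ^+ 3 * (incr i z - incr2 i j z)).
  by apply: i43.2; exact: L4B.
have i3 := E2_incr4 i; have i5 : L1 M (fun z => incr2 i j z ^+ 4) := j4.2.
have := @le_Ex _ _ _ M (fun z => incr i z ^+ 2 * (incr i z - incr2 i j z) ^+ 2)
  (fun z => 2 * (incr i z ^+ 3 * (incr i z - incr2 i j z)) +
   2^-1 * (incr2 i j z ^+ 4 - incr i z ^+ 4)).
rewrite ExD ?ExZ ?ExB//; [|exact: L1B|exact: L1Z|by apply: L1Z; exact: L1B].
rewrite e4 subrr mulr0 addr0; apply => //.
  by apply: L1D; apply: L1Z => //; exact: L1B.
move=> z; rewrite -subr_ge0.
have -> : 2 * (incr i z ^+ 3 * (incr i z - incr2 i j z)) +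
    2^-1 * (incr2 i j z ^+ 4 - incr i z ^+ 4) -
    incr i z ^+ 2 * (incr i z - incr2 i j z) ^+ 2 =
    2^-1 * (incr i z ^+ 2 - incr2 i j z ^+ 2) ^+ 2 by field.
by rewrite mulr_ge0 ?sqr_ge0.
Qed.

(** Expand the fourth power of a - b for the exchangeable pair a, b. Since E[b^4] = E[a^4] and
    E[a b^3] = E[a^3 b], it is 8 E[a^3 (a - b)] - 6 E[a^2 (a^2 - b^2)], and the first term sums to a
    multiple of [p]. *)
Lemma sum_E2_incr4 :
  \sum_i E2 (fun z => incr i z ^+ 4) = 8 * p%:R * E1 (fun x => W x ^+ 4) -
    6 * \sum_i E2 (fun z => W z.1 ^+ 2 * (W z.1 ^+ 2 - W (xm [set i] z) ^+ 2)).
Proof.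
have iW := ustat_L4.
have iW3 : L43 mu (fun x => W x ^+ 3) by exact: L43_X3.
have iW32 : L43 M (fun z => W z.1 ^+ 3) by apply: L43_X3; exact: L4f.
have <- : E1 (fun x => W x ^+ 3 * W x) = E1 (fun x => W x ^+ 4).
  by apply: eq_Ex => x; rewrite -exprSr.
rewrite -mulrA -(sum_E2_incr iW3 iW32) !mulr_sumr -sumrB; apply: eq_bigr => i _.
have i1 := L4f iW; have i2 := L4x [set i] iW.
have i31 : L1 M (fun z => W z.1 ^+ 3 * W (xm [set i] z)) by exact: iW32.2.
have i22 : L1 M (fun z => W z.1 ^+ 2 * W (xm [set i] z) ^+ 2).
  by apply: L1M; exact: L4X2.
have i13 : L1 M (fun z => W z.1 * W (xm [set i] z) ^+ 3).
  have := (L43_X3 i2).2 _ i1; congr L1; by apply/funext => z; rewrite mulrC.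
have i40 : L1 M (fun z => W z.1 ^+ 4) := i1.2.
have i04 : L1 M (fun z => W (xm [set i] z) ^+ 4) := i2.2.
have e4 : E2 (fun z => W (xm [set i] z) ^+ 4) = E2 (fun z => W z.1 ^+ 4).
  rewrite -(E2_mswap mu_rect [set i]); last exact: L1_meas i04.
  by apply: eq_Ex => z; rewrite xm_mswap symdd xm0.
have e3 : E2 (fun z => W z.1 * W (xm [set i] z) ^+ 3) =
    E2 (fun z => W z.1 ^+ 3 * W (xm [set i] z)).
  rewrite -(E2_mswap mu_rect [set i]); last exact: L1_meas i13.
  apply: eq_Ex => z; rewrite -[in LHS](xm0 (mswap _ _)) !xm_mswap symdd symd0 xm0.
  by rewrite mulrC.
transitivity (2 * E2 (fun z => W z.1 ^+ 4) -
    8 * E2 (fun z => W z.1 ^+ 3 * W (xm [set i] z)) +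
    6 * E2 (fun z => W z.1 ^+ 2 * W (xm [set i] z) ^+ 2)).
  transitivity (E2 (fun z => (W z.1 ^+ 4 - 4 * (W z.1 ^+ 3 * W (xm [set i] z))) +
      6 * (W z.1 ^+ 2 * W (xm [set i] z) ^+ 2) +
      (W (xm [set i] z) ^+ 4 - 4 * (W z.1 * W (xm [set i] z) ^+ 3)))).
    by apply: eq_Ex => z; rewrite /incr; ring.
  have j1 := L1Z 4 i31; have j2 := L1Z 6 i22; have j3 := L1Z 4 i13.
  have k1 := L1B i40 j1; have k2 := L1B i04 j3.
  rewrite ExD//; last exact: L1D.
  rewrite ExD// ExB// ExB// !ExZ// e4 e3.
  by move: (E2 _) (E2 _) (E2 _) => a b c; ring.
rewrite (_ : E2 (fun z => W z.1 ^+ 3 * incr i z) = E2 (fun z => W z.1 ^+ 4) -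
    E2 (fun z => W z.1 ^+ 3 * W (xm [set i] z))); last first.
  by rewrite -ExB//; apply: eq_Ex => z; rewrite /incr mulrBr -exprSr.
rewrite (_ : E2 (fun z => W z.1 ^+ 2 *
  (W z.1 ^+ 2 - W (xm [set i] z) ^+ 2)) = E2 (fun z => W z.1 ^+ 4) -
    E2 (fun z => W z.1 ^+ 2 * W (xm [set i] z) ^+ 2)); last first.
  by rewrite -ExB//; apply: eq_Ex => z; rewrite mulrBr -exprD.
by move: (E2 _) (E2 _) (E2 _) => a b c; ring.
Qed.

(** The signed square: odd, so that exchanging coordinate [i] negates it on the increment, and with
    square the fourth power. *)
Definition sgsq (x : R) := x * `|x|.

Lemma sgsqN (x : R) : sgsq (- x) = - sgsq x.
Proof. by rewrite /sgsq normrN mulNr. Qed.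

Lemma sgsq_sqr (x : R) : sgsq x ^+ 2 = x ^+ 4.
Proof. by rewrite /sgsq exprMn real_normK ?num_real// -exprD. Qed.

Lemma sgsq_lip (a b : R) : `|sgsq a - sgsq b| <= (`|a| + `|b|) * `|a - b|.
Proof.
have p1 (x y : R) : 0 <= x -> 0 <= y -> `|x ^+ 2 - y ^+ 2| = (x + y) * `|x - y|.
  move=> x0 y0; rewrite subr_sqr normrM mulrC (ger0_norm (addr_ge0 x0 y0)) mulrC.
  by rewrite mulrC.
have p2 (x y : R) : 0 <= x -> 0 <= y -> x ^+ 2 + y ^+ 2 <= (x + y) * (x + y).
  by move=> x0 y0; have := mulr_ge0 x0 y0; nra.
have [a0|/ltW a0] := lerP 0 a; have [b0|/ltW b0] := lerP 0 b.
- by rewrite /sgsq (ger0_norm a0) (ger0_norm b0) -!expr2 p1.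
- rewrite /sgsq (ger0_norm a0) (ler0_norm b0) mulrN opprK -!expr2 ger0_norm; last first.
    by rewrite addr_ge0 ?sqr_ge0.
  have Nb : 0 <= - b by rewrite oppr_ge0.
  by rewrite (ger0_norm (addr_ge0 a0 Nb)) -(sqrrN b) p2.
- rewrite /sgsq (ler0_norm a0) (ger0_norm b0) mulrN -opprD normrN -!expr2 ger0_norm; last first.
    by rewrite addr_ge0 ?sqr_ge0.
  have Na : 0 <= - a by rewrite oppr_ge0.
  rewrite (_ : `|a - b| = - a + b); first by rewrite -(sqrrN a) p2.
  by rewrite (_ : a - b = - (- a + b)) ?normrN ?ger0_norm ?addr_ge0// opprD opprK.
- rewrite /sgsq (ler0_norm a0) (ler0_norm b0) !mulrN -opprD normrN -!expr2.
  rewrite -(sqrrN a) -(sqrrN b) p1 ?oppr_ge0//.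
  by rewrite (_ : - a - - b = - (a - b)) ?normrN// opprD.
Qed.

Lemma measurable_sgsq : measurable_fun setT sgsq.
Proof. by apply: measurable_funM => //; exact: measurableT_comp. Qed.

Lemma L2_sgsq d' (T' : measurableType d') (P : probability T' R) F :
  L4 P F -> L2 P (fun t => sgsq (F t)).
Proof.
move=> iF; apply: (L2_dom (G := fun t => F t ^+ 2)).
- exact: (measurableT_comp measurable_sgsq (L4_meas iF)).
- exact: L4X2.
- by move=> t; rewrite /sgsq normrM normr_id normrX expr2.
Qed.

(** Exchanging [i] or [j] negates one increment and alters the other, so four times the left side is
    the expectation of a product of two differences of signed squares. The increments in both
    differences differ by the same mixed second difference, whose square [sgsq_lip] extracts. *)
Lemma E2_sgsq_mul i j : j != i ->
  E2 (fun z => sgsq (incr i z) * sgsq (incr j z)) <=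
  2^-1 * (E2 (fun z => incr i z ^+ 2 * (incr i z - incr2 i j z) ^+ 2) +
          E2 (fun z => incr j z ^+ 2 * (incr j z - incr2 j i z) ^+ 2)).
Proof.
move=> ji; have ij : i != j by rewrite eq_sym.
pose a := incr i; pose a' := incr2 i j; pose b := incr j; pose b' := incr2 j i.
have ia : L4 M a by exact: incr_L4. have ia' : L4 M a' by exact: incr2_L4.
have ib : L4 M b by exact: incr_L4. have ib' : L4 M b' by exact: incr2_L4.
have ab z : b z - b' z = a z - a' z.
  by rewrite /a /b /a' /b' /incr /incr2 (finset.setUC [set j]); ring.
have La := L2_sgsq ia; have La' := L2_sgsq ia'.
have Lb := L2_sgsq ib; have Lb' := L2_sgsq ib'.
have L1ab := L1M La Lb; have L1a'b := L1M La' Lb.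
have L1ab' := L1M La Lb'; have L1a'b' := L1M La' Lb'.
set X := E2 (fun z => sgsq (a z) * sgsq (b z)).
have X2 : E2 (fun z => sgsq (a' z) * sgsq (b z)) = - X.
  rewrite -(E2_mswap mu_rect [set j]); last exact: L1_meas L1a'b.
  rewrite -mulN1r -ExZ//; apply: eq_Ex => z.
  by rewrite /a' /b incr2_mswap// incr_mswapN sgsqN mulN1r mulrN.
have X3 : E2 (fun z => sgsq (a z) * sgsq (b' z)) = - X.
  rewrite -(E2_mswap mu_rect [set i]); last exact: L1_meas L1ab'.
  rewrite -mulN1r -ExZ//; apply: eq_Ex => z.
  by rewrite /a /b' incr2_mswap// incr_mswapN sgsqN mulN1r mulNr.
have X4 : E2 (fun z => sgsq (a' z) * sgsq (b' z)) = X.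
  rewrite -(E2_mswap mu_rect [set j]); last exact: L1_meas L1a'b'.
  transitivity (E2 (fun z => (- 1) * (sgsq (a z) * sgsq (b' z)))).
    apply: eq_Ex => z; rewrite /a' /b' incr2_mswap// incr2_mswapN// sgsqN.
    by rewrite mulN1r mulrN.
  by rewrite ExZ// X3 mulN1r opprK.
have i1 : L1 M (fun z => a z ^+ 2 * (a z - a' z) ^+ 2).
  by apply: L1M; apply: L4X2 => //; exact: L4B.
have i2 : L1 M (fun z => a' z ^+ 2 * (a z - a' z) ^+ 2).
  by apply: L1M; apply: L4X2 => //; exact: L4B.
have i3 : L1 M (fun z => b z ^+ 2 * (b z - b' z) ^+ 2).
  by apply: L1M; apply: L4X2 => //; exact: L4B.
have i4 : L1 M (fun z => b' z ^+ 2 * (b z - b' z) ^+ 2).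
  by apply: L1M; apply: L4X2 => //; exact: L4B.
have e2 : E2 (fun z => a' z ^+ 2 * (a z - a' z) ^+ 2) =
    E2 (fun z => a z ^+ 2 * (a z - a' z) ^+ 2).
  rewrite -(E2_mswap mu_rect [set j]); last exact: L1_meas i2.
  apply: eq_Ex => z; rewrite /a /a' incr2_mswap// incr_mswap//; congr (_ * _).
  by rewrite -sqrrN opprB.
have e4 : E2 (fun z => b' z ^+ 2 * (b z - b' z) ^+ 2) =
    E2 (fun z => b z ^+ 2 * (b z - b' z) ^+ 2).
  rewrite -(E2_mswap mu_rect [set i]); last exact: L1_meas i4.
  apply: eq_Ex => z; rewrite /b /b' incr2_mswap// incr_mswap//; congr (_ * _).
  by rewrite -sqrrN opprB.
rewrite -/a -/b -/a' -/b' -/X.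
suff : 4 * X <= E2 (fun z => 2^-1 * ((a z ^+ 2 * (a z - a' z) ^+ 2 +
    a' z ^+ 2 * (a z - a' z) ^+ 2) + (b z ^+ 2 * (b z - b' z) ^+ 2 +
    b' z ^+ 2 * (b z - b' z) ^+ 2)) * 2).
  under [X in _ <= X -> _]eq_Ex do rewrite mulrC mulrA divff// mul1r.
  rewrite ExD; [|exact: L1D|exact: L1D].
  by rewrite !ExD// e2 e4; lra.
have -> : 4 * X = E2 (fun z =>
    (sgsq (a z) - sgsq (a' z)) * (sgsq (b z) - sgsq (b' z))).
  transitivity (E2 (fun z => (sgsq (a z) * sgsq (b z) - sgsq (a' z) * sgsq (b z)) -
      (sgsq (a z) * sgsq (b' z) - sgsq (a' z) * sgsq (b' z)))).
    rewrite ExB; [|exact: L1B|exact: L1B].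
    by rewrite !ExB// -/X X2 X3 X4; ring.
  by apply: eq_Ex => z; ring.
apply: le_Ex.
- by apply: L1M; exact: L2B.
- rewrite [X in L1 _ X](_ : _ = fun z => (a z ^+ 2 * (a z - a' z) ^+ 2 +
    a' z ^+ 2 * (a z - a' z) ^+ 2) + (b z ^+ 2 * (b z - b' z) ^+ 2 +
    b' z ^+ 2 * (b z - b' z) ^+ 2)); first by apply: L1D; exact: L1D.
  by apply/funext => z; field.
move=> z; apply: (le_trans (ler_norm _)); rewrite normrM.
apply: (le_trans (ler_pM _ _ (sgsq_lip _ _) (sgsq_lip _ _))) => //.
rewrite ab -!(real_normK (num_real (a z - a' z))).
rewrite -(real_normK (num_real (a z))) -(real_normK (num_real (a' z))).
rewrite -(real_normK (num_real (b z))) -(real_normK (num_real (b' z))).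
move: (normr_ge0 (a z)) (normr_ge0 (a' z)) (normr_ge0 (b z)) (normr_ge0 (b' z)).
move: `|a z| `|a' z| `|b z| `|b' z| `|a z - a' z| => q r s t D q0 r0 s0 t0.
(* [q^2 + r^2 + s^2 + t^2 - (q + r) (s + t)] as a sum of squares. *)
rewrite -subr_ge0 (_ : _ - _ = (2^-1 * ((q + r) - (s + t)) ^+ 2 +
   2^-1 * (q - r) ^+ 2 + 2^-1 * (s - t) ^+ 2) * D ^+ 2); last by field.
by rewrite mulr_ge0 ?sqr_ge0// !addr_ge0// mulr_ge0// sqr_ge0.
Qed.

End kernels.

(** * Splitting the square of the statistic *)

Section decomposition.
Context {R : realType} {n : nat} {dE : 'I_n -> measure_display}
  {E : forall i, measurableType (dE i)}.
Local Notation T := (@cspace n dE E).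
Implicit Types (S J K : {set 'I_n}) (i j : 'I_n) (x y : T) (z : T * T).
Variable mu : probability T R.
Hypothesis mu_rect : exists m : forall i, set (E i) -> \bar R,
  forall B : forall i, set (E i), (forall i, measurable (B i)) ->
  mu (rect B) = (\prod_i m i (B i))%E.
Local Notation M := (mu \x mu)%E.
Local Notation E1 := (Ex mu).
Local Notation E2 := (Ex M).
Variables (p : nat) (g : {set 'I_n} -> T -> R).
Hypothesis p_gt0 : (0 < p)%N.
Hypothesis g_L4 : forall J, L4 mu (g J).
Hypothesis g_free : forall J S x y, [disjoint S & J]%B -> g J (mix S x y) = g J x.
Hypothesis g_degen : forall J i, i \in J -> degen mu i (g J).
Hypothesis g_order : forall J, #|J| != p -> g J = fun=> 0.
Local Notation W := (ustat g).
Let W_L4 : L4 mu W := ustat_L4 g_L4.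
Let L4x S (k : T -> R) : L4 mu k -> L4 M (fun z => k (xm S z)) :=
  @L4_xm _ _ _ _ _ mu_rect S k.
Let L2x S (k : T -> R) : L2 mu k -> L2 M (fun z => k (xm S z)) :=
  @L2_xm _ _ _ _ _ mu_rect S k.
Let L4f (k : T -> R) : L4 mu k -> L4 M (fun z => k z.1).
Proof. exact: (mpres_L4 (mpres_fst mu mu)). Qed.
Let L2f (k : T -> R) : L2 mu k -> L2 M (fun z => k z.1).
Proof. exact: (mpres_L2 (mpres_fst mu mu)). Qed.

(** Absolute values inside the sum would leave the sum of the E[D_i^2], which is 2p E[W^2] and not
    small. The second moment of the sum of conditional means keeps the cancellation: its diagonal is
    at most the sum of the E[D_i^4], its off-diagonal part at most [2 (p - 1)] times that. *)
Lemma sgsq_incr_bound (b : T -> R) (c : R) : 0 <= c ->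
  measurable_fun setT b -> (forall x, `|b x| <= c) ->
  `|\sum_i E2 (fun z => b z.1 * sgsq (incr g i z))| <=
  c * Num.sqrt (2 * p%:R * \sum_i E2 (fun z => incr g i z ^+ 4)).
Proof.
move=> c0 mb bc.
pose u i z := sgsq (incr g i z).
have iu i : L2 M (u i) by apply: L2_sgsq; exact: incr_L4.
pose V x := \sum_i cmean mu (u i) x.
have iV : L2 mu V by apply: L2_sum => i _; exact: L2_cmean.
have ib : L2 mu b := L2_bdd mu mb bc.
have -> : \sum_i E2 (fun z => b z.1 * u i z) = E1 (fun x => b x * V x).
  under [RHS]eq_Ex do rewrite mulr_sumr.
  rewrite Ex_sum; last by move=> i _; apply: L1M => //; exact: L2_cmean.
  apply: eq_bigr => i _; rewrite Ex_cmean_mul//; first exact: L2_L1.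
  by apply: L1M => //; exact: L2f.
apply: (le_trans (normEx_bdd c0 mb bc iV)); rewrite ler_wpM2l// ler_wsqrtr//.
have -> : E1 (fun x => V x ^+ 2) =
    \sum_i \sum_j E1 (fun x => cmean mu (u i) x * cmean mu (u j) x).
  under eq_Ex do rewrite expr2 mulr_suml.
  have L1V i : L1 mu (fun x => cmean mu (u i) x * V x).
    by apply: L1M => //; exact: L2_cmean.
  rewrite Ex_sum//; apply: eq_bigr => i _.
  under eq_Ex do rewrite mulr_sumr.
  by rewrite Ex_sum// => j _; apply: L1M; exact: L2_cmean.
pose e i j := E2 (fun z => incr g i z ^+ 2 * (incr g i z - incr2 g i j z) ^+ 2).
pose e4 i := E2 (fun z => incr g i z ^+ 4).
have eij i j : j != i -> E1 (fun x => cmean mu (u i) x * cmean mu (u j) x) <=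
    2^-1 * (e i j + e j i).
  (* [u i] reads the second copy at coordinate [i] only, so the product of conditional means is one
     expectation over two copies. *)
  move=> ji; rewrite (Ex_cmeanM mu_rect (S := [set j])) ?E2_sgsq_mul//.
    by move=> x y w; rewrite /u incr_free2.
  move=> x y w; congr (sgsq (_ - W _)); apply: cspaceP => k.
  by rewrite !xmE /= !mixE !inE; case: eqVneq.
have eii i : E1 (fun x => cmean mu (u i) x * cmean mu (u i) x) <= e4 i.
  have := le_Ex_cmean (iu i).
  under [X in _ <= X -> _]eq_Ex do rewrite sgsq_sqr.
  by under [X in X <= _ -> _]eq_Ex do rewrite expr2.
have S1 i : \sum_(j | j != i) e i j <= 2 * p.-1%:R * e4 i by exact: sum_E2_incr2_sqr.
have S2 : \sum_i \sum_(j | j != i) e j i = \sum_i \sum_(j | j != i) e i j.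
  rewrite (exchange_big_dep xpredT)//=; apply: eq_bigr => i _.
  by apply: eq_bigl => j; rewrite eq_sym.
have S3 : \sum_i \sum_(j | j != i) e i j <= 2 * p.-1%:R * \sum_i e4 i.
  by rewrite mulr_sumr; apply: ler_sum => i _; exact: S1.
apply: (@le_trans _ _ (\sum_i (e4 i + \sum_(j | j != i) 2^-1 * (e i j + e j i)))).
  apply: ler_sum => i _; rewrite (bigD1 i)//= lerD//.
  by apply: ler_sum => j; exact: eij.
rewrite big_split/=; under [X in _ + X]eq_bigr do rewrite -mulr_sumr big_split/=.
rewrite -mulr_sumr big_split/= S2 -/(e4 _).
have e40 : 0 <= \sum_i e4 i.
  by apply: sumr_ge0 => i _; apply: Ex_ge0 => z; rewrite (exprM _ 2 2) sqr_ge0.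
rewrite (_ : 2 * p%:R = 2 * p.-1%:R + 2); last first.
  by rewrite -{1}(prednK p_gt0) -(natr1 p.-1) mulrDr mulr1.
rewrite -[X in _ <= _ * X]/(\sum_i e4 i) mulrDl.
set a := \sum_i \sum_(j | j != i) e i j in S3 *.
set b' := \sum_i e4 i in S3 e40 *; lra.
Qed.

Lemma L2_gg J K : L2 mu (fun x => g J x * g K x).
Proof. exact: L4M. Qed.

Lemma L1_g4 J K J' K' : L1 mu (fun x => g J x * g K x * (g J' x * g K' x)).
Proof. by apply: L1M; exact: L2_gg. Qed.

(** The top-order part of the square: a product over disjoint sets is degenerate in all of its 2p
    coordinates, while a product in [rpart] depends on fewer than 2p. *)
Definition upart x := \sum_(J : {set 'I_n}) \sum_(K : {set 'I_n} | [disjoint J & K]%B) g J x * g K x.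
Definition rpart x := \sum_(J : {set 'I_n}) \sum_(K : {set 'I_n} | ~~ [disjoint J & K]%B) g J x * g K x.
Local Notation U := upart.
Local Notation Rp := rpart.

Lemma upart_L2 : L2 mu U.
Proof. by do 2!apply: L2_sum => ? _; exact: L2_gg. Qed.
Lemma rpart_L2 : L2 mu Rp.
Proof. by do 2!apply: L2_sum => ? _; exact: L2_gg. Qed.

Lemma ustat_sqr x : W x ^+ 2 = U x + Rp x.
Proof.
rewrite expr2 mulr_suml -big_split/=; apply: eq_bigr => J _.
by rewrite mulr_sumr (bigID (fun K : {set 'I_n} => [disjoint J & K]%B)).
Qed.

Let g_free1 J i x y : i \notin J -> g J (mix [set i] x y) = g J x.
Proof. by move=> iJ; rewrite g_free// disjoints1. Qed.

Lemma E2_gg_avg (h : T -> R) i J K : L2 mu h -> [disjoint J & K]%B ->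
  E2 (fun z => h z.1 * (g J (xm [set i] z) * g K (xm [set i] z))) =
  if i \in J :|: K then 0 else E1 (fun x => h x * (g J x * g K x)).
Proof.
move=> ih JK; wlog iJ : J K JK / i \notin K.
  move=> wl; have [iK|/wl] := boolP (i \in K); last exact.
  under eq_Ex do rewrite [X in _ * X]mulrC.
  under [in RHS]eq_Ex do rewrite [X in _ * X]mulrC.
  rewrite finset.setUC wl//; first by rewrite disjoint_sym.
  by rewrite (disjointFl JK iK).
rewrite inE (negbTE iJ) orbF; case: ifPn => [iJ'|iJ'].
  transitivity (E2 (fun z => h z.1 * g K z.1 * g J (xm [set i] z))).
    by apply: eq_Ex => z; rewrite [g K _]g_free1// [g J _ * _]mulrC mulrA.
  apply: (degen_E2_in mu_rect (i := i)); rewrite ?inE//.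
  - exact: L4_L1.
  - exact: g_degen.
  - by apply: measurable_funM; [exact: L2_meas (L2f ih)|exact: L4_meas (L4f (g_L4 K))].
  - rewrite (_ : (fun _ => _) = fun z => h z.1 * (g K z.1 * g J (xm [set i] z))).
      by apply: L1M; [exact: L2f|apply: L4M; [exact: L4f|exact: L4x]].
    by apply/funext => z; rewrite mulrA.
transitivity (E2 (fun z => h z.1 * (g J z.1 * g K z.1))).
  by apply: eq_Ex => z; rewrite [g K _]g_free1// [g J _]g_free1.
by rewrite (E2_fst mu (k := fun x => h x * (g J x * g K x)))//;
  apply: L1_meas (L1M ih (L2_gg J K)).
Qed.

(** In weak form, [upart] is an eigenfunction of the number operator with eigenvalue [2p], the size
    of a disjoint union. *)
Lemma number_upart (h : T -> R) : L2 mu h ->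
  \sum_i E2 (fun z => h z.1 * (U z.1 - U (xm [set i] z))) =
  2 * p%:R * E1 (fun x => h x * U x).
Proof.
move=> ih.
have i1 J K : L1 M (fun z => h z.1 * (g J z.1 * g K z.1)).
  by apply: L1M; [exact: L2f|apply: L4M; exact: L4f].
have i2 i J K : L1 M (fun z => h z.1 * (g J (xm [set i] z) * g K (xm [set i] z))).
  by apply: L1M; [exact: L2f|apply: L4M; exact: L4x].
have i0 J K : L1 mu (fun x => h x * (g J x * g K x)).
  by apply: L1M => //; exact: L2_gg.
have eU : E1 (fun x => h x * U x) = \sum_(J : {set 'I_n}) \sum_(K : {set 'I_n} | [disjoint J & K]%B)
    E1 (fun x => h x * (g J x * g K x)).
  under eq_Ex do rewrite mulr_sumr.
  rewrite Ex_sum; last first.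
    by move=> J _; apply: L1M => //; apply: L2_sum => K _; exact: L2_gg.
  apply: eq_bigr => J _; under eq_Ex do rewrite mulr_sumr.
  by rewrite Ex_sum.
transitivity (\sum_i \sum_(J : {set 'I_n}) \sum_(K : {set 'I_n} | [disjoint J & K]%B)
    (i \in J :|: K)%:R * E1 (fun x => h x * (g J x * g K x))).
  apply: eq_bigr => i _.
  transitivity (E2 (fun z => \sum_(J : {set 'I_n}) \sum_(K : {set 'I_n} | [disjoint J & K]%B)
     (h z.1 * (g J z.1 * g K z.1) -
      h z.1 * (g J (xm [set i] z) * g K (xm [set i] z))))).
    apply: eq_Ex => z; rewrite mulrBr !mulr_sumr -sumrB; apply: eq_bigr => J _.
    by rewrite !mulr_sumr -sumrB.
  rewrite Ex_sum; last by move=> J _; apply: L1_sum => K _; exact: L1B.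
  apply: eq_bigr => J _; rewrite Ex_sum; last by move=> K _; exact: L1B.
  apply: eq_bigr => K JK; rewrite ExB// E2_gg_avg//.
  rewrite (E2_fst mu (k := fun x => h x * (g J x * g K x))); last exact: L1_meas (i0 J K).
  by case: ifP => _; rewrite ?subr0 ?subrr ?mul1r ?mul0r.
rewrite eU mulr_sumr exchange_big/=; apply: eq_bigr => J _.
rewrite mulr_sumr exchange_big/=; apply: eq_bigr => K JK.
rewrite -mulr_suml; have [Jp|Jp] := eqVneq #|J| p; last first.
  by rewrite (eq_Ex mu (G := fun=> 0)) ?Ex_cst ?mulr0// => x; rewrite (g_order Jp) mul0r mulr0.
have [Kp|Kp] := eqVneq #|K| p; last first.
  by rewrite (eq_Ex mu (G := fun=> 0)) ?Ex_cst ?mulr0// => x; rewrite (g_order Kp) !mulr0.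
congr (_ * _); rewrite -natr_sum -natrM; congr (_%:R).
have -> : (\sum_i (i \in J :|: K) = #|J :|: K|)%N.
  by rewrite -sum1_card [RHS]big_mkcond; apply: eq_bigr => i _; case: (i \in _).
by rewrite cardsU Jp Kp disjoint_setI0// cards0 subn0 mul2n addnn.
Qed.

Lemma E1_g4_eq0 i J K J' K' : [disjoint J & K]%B -> i \in J :|: K ->
  i \notin J' :|: K' -> E1 (fun x => g J x * g K x * (g J' x * g K' x)) = 0.
Proof.
move=> JK iJK; rewrite inE negb_or => /andP[iJ' iK'].
wlog iJ1 : J K JK iJK / i \in J.
  move=> wl; move: (iJK); rewrite inE => /orP[iJ1|iK]; first exact: wl.
  under eq_Ex do rewrite [g J _ * _]mulrC.
  by apply: wl => //; rewrite 1?disjoint_sym// finset.setUC.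
have iK : i \notin K by rewrite (disjointFr JK iJ1).
transitivity (E1 (fun x => (g K x * (g J' x * g K' x)) * g J x)).
  by apply: eq_Ex => x; ring.
apply: (degen_E1 mu_rect (i := i)).
- exact: L4_L1.
- exact: g_degen.
- by do !apply: measurable_funM; exact: L4_meas.
- by move=> x y; rewrite !g_free1.
rewrite (_ : (fun _ => _) = fun x => g J x * g K x * (g J' x * g K' x)).
  exact: L1_g4.
by apply/funext => x; ring.
Qed.

Lemma E1_upart_rpart : E1 (fun x => U x * Rp x) = 0.
Proof.
have iUR (J K J' K' : {set 'I_n}) := L1_g4 J K J' K'.
have iR := rpart_L2.
under eq_Ex do rewrite mulr_suml.
have iJ J : L1 mu (fun x => (\sum_(K : {set 'I_n} | [disjoint J & K]%B) g J x * g K x) * Rp x).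
  by apply: L1M => //; apply: L2_sum => K _; exact: L2_gg.
rewrite Ex_sum// big1// => J _; under eq_Ex do rewrite mulr_suml.
rewrite Ex_sum; last by move=> K _; apply: L1M => //; exact: L2_gg.
apply: big1 => K JK; under eq_Ex do rewrite mulr_sumr.
rewrite Ex_sum; last first.
  by move=> J' _; apply: L1M; [exact: L2_gg|apply: L2_sum => K' _; exact: L2_gg].
apply: big1 => J' _; under eq_Ex do rewrite mulr_sumr.
rewrite Ex_sum//; apply: big1 => K' JK'.
have z0 (F : T -> R) : (forall x, F x = 0) -> E1 F = 0.
  by move=> F0; rewrite (eq_Ex mu F0) Ex_cst.
have [Jp|Jp] := eqVneq #|J| p; last by apply: z0 => x; rewrite (g_order Jp) !mul0r.
have [Kp|Kp] := eqVneq #|K| p; last first.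
  by apply: z0 => x; rewrite (g_order Kp) mulr0 mul0r.
have [Jp'|Jp'] := eqVneq #|J'| p; last first.
  by apply: z0 => x; rewrite (g_order Jp') mul0r mulr0.
have [Kp'|Kp'] := eqVneq #|K'| p; last by apply: z0 => x; rewrite (g_order Kp') !mulr0.
(* The left union has 2p elements and the right one fewer; a coordinate in the difference is met by
   a single degenerate factor. *)
have /subsetPn[i iJK iJ'] : ~~ (J :|: K \subset J' :|: K').
  apply/negP => /subset_leq_card; rewrite !cardsU Jp Kp Jp' Kp' disjoint_setI0//.
  rewrite cards0 subn0 leqNgt => /negP; apply.
  rewrite -subn_gt0 subKn; last first.
    by rewrite (leq_trans (subset_leq_card (finset.subsetIl J' K')))// Jp' leq_addr.
  by rewrite card_gt0 setI_eq0.
exact: E1_g4_eq0 JK iJK iJ'.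
Qed.

Lemma E1_upart : E1 U = 0.
Proof.
rewrite Ex_sum; last by move=> J _; apply: L1_sum => K _; exact/L2_L1/L2_gg.
apply: big1 => J _; rewrite Ex_sum; last by move=> K _; exact/L2_L1/L2_gg.
apply: big1 => K JK; have [Jp|Jp] := eqVneq #|J| p; last first.
  by rewrite (eq_Ex mu (G := fun=> 0)) ?Ex_cst// => x; rewrite (g_order Jp) mul0r.
have /card_gt0P[i iJ] : (0 < #|J|)%N by rewrite Jp.
under eq_Ex do rewrite mulrC.
apply: (degen_E1 mu_rect (i := i)) => //.
- exact: L4_L1.
- exact: g_degen.
- exact: L4_meas.
- by move=> x y; rewrite g_free1// (disjointFr JK iJ).
- exact/L2_L1/L2_gg.
Qed.

Hypothesis W_sqr1 : E1 (fun x => W x ^+ 2) = 1.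
Let u := E1 (fun x => U x ^+ 2).

Let iR := rpart_L2.
Let iU := upart_L2.

Lemma E1_rpart : E1 Rp = 1.
Proof.
rewrite -W_sqr1 (eq_Ex mu ustat_sqr) ExD ?E1_upart ?add0r//; exact: L2_L1.
Qed.

Lemma E1_ustat4 : E1 (fun x => W x ^+ 4) = u + E1 (fun x => Rp x ^+ 2).
Proof.
transitivity (E1 (fun x => U x ^+ 2 + Rp x ^+ 2 + 2 * (U x * Rp x))).
  by apply: eq_Ex => x; rewrite (exprM _ 2 2) ustat_sqr; ring.
have i1 := iR.2; have i2 := iU.2; have i3 := L1M iU iR.
rewrite ExD; [|exact: L1D|exact: L1Z].
by rewrite ExD// ExZ// E1_upart_rpart mulr0 addr0.
Qed.

Let r x := Rp x - 1.
Let ir : L2 mu r. Proof. by apply: L2B => //; exact: L2_cst. Qed.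

Lemma E1_rpart_centered : E1 (fun x => r x ^+ 2) = E1 (fun x => W x ^+ 4) - u - 1.
Proof.
rewrite E1_ustat4 (addrC u) addrK.
transitivity (E1 (fun x => Rp x ^+ 2 - 2 * Rp x + 1)).
  by apply: eq_Ex => x; rewrite /r; ring.
have i1 := iR.2; have i2 := L2_L1 iR; have i3 := L1Z 2 i2.
rewrite ExD ?ExB ?ExZ ?Ex_cst ?E1_rpart//; [|exact: L1B|exact: L1_cst].
by lra.
Qed.

(** From [D_i^2 = 2 W D_i - (W^2 - W_i^2)] and the number operator N, the sum of the E[D_i^2 | X] is
    [2p W^2 - N W^2 = 2p R - N R], because [N U = 2p U]. Divided by 2p and centred, it is
    [1 - N / 2p] applied to [r = R - 1], a contraction. *)
Lemma incr_sqr_bound (a : T -> R) (c : R) : 0 <= c ->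
  measurable_fun setT a -> (forall x, `|a x| <= c) ->
  `|E1 a - (2 * p%:R)^-1 * \sum_i E2 (fun z => a z.1 * incr g i z ^+ 2)| <=
  c * Num.sqrt (E1 (fun x => W x ^+ 4) - u - 1).
Proof.
move=> c0 ma ac; have ia : L2 mu a := L2_bdd mu ma ac.
have ia2 := L2f ia.
have p0 : 0 < 2 * p%:R :> R by rewrite mulr_gt0 ?ltr0n.
(* The index [None] carries the centring constant -1. Pairs containing a set of the wrong size have
   a vanishing component, so they are given no coordinates below. *)
pose F (k : option ({set 'I_n} * {set 'I_n})) : T -> R :=
  if k is Some (J, K) then
    (fun x => (~~ [disjoint J & K]%B)%:R * (g J x * g K x)) else fun=> - 1.
pose D (k : option ({set 'I_n} * {set 'I_n})) :=
  if k is Some (J, K) then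
    if (#|J| == p) && (#|K| == p) then J :|: K else finset.set0
  else finset.set0.
have iF k : L2 mu (F k).
  by case: k => [[J K]|]; [apply: L2Z; exact: L2_gg|exact: L2_cst].
have rF x : r x = \sum_k F k x.
  rewrite /r /rpart (bigD1 None)//= addrC; congr (_ + _).
  pose F' J K := (~~ [disjoint J & K]%B)%:R * (g J x * g K x).
  rewrite (reindex_omap (Some : {set 'I_n} * {set 'I_n} -> option _) id)/=; last by case.
  rewrite [RHS](eq_bigl xpredT); last by move=> k; rewrite eqxx.
  rewrite (eq_bigr (fun q => F' q.1 q.2)); last by case.
  rewrite /= -(pair_bigA _ F')/=; apply: eq_bigr => J _; rewrite [LHS]big_mkcond.
  by apply: eq_bigr => K _; rewrite /F'; case: ifP; rewrite ?mul1r ?mul0r.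
have fF k i x y : i \notin D k -> F k (mix [set i] x y) = F k x.
  case: k => [[J K]|//]; rewrite /F /D.
  have [Jp|Jp] := eqVneq #|J| p; last by rewrite (g_order Jp) !mul0r.
  have [Kp|Kp] := eqVneq #|K| p; last by rewrite (g_order Kp) !mulr0.
  by rewrite /= inE negb_or => /andP[iJ iK]; rewrite !g_free1.
have cD k : (#|D k| <= 2 * p)%N.
  case: k => [[J K]|]; rewrite /D ?cards0//.
  case: ifP => [/andP[/eqP Jp /eqP Kp]|_]; last by rewrite cards0.
  by rewrite cardsU Jp Kp (leq_trans (leq_subr _ _))// mul2n addnn.
(* The spectrum lies in [0, 2p] and [q] is 2p, so the requirement [m <= 2 q] holds with room. *)
have mp : (2 * p)%N%:R <= 2 * (2 * p%:R) :> R.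
  by rewrite natrM; have : 0 <= p%:R :> R; [exact: ler0n|lra].
have := number_dev_norm mu_rect iF ir rF fF cD p0 mp c0 ma ac.
rewrite E1_rpart_centered; congr (_ <= _).
rewrite -normrN; congr `| _ |.
have iW := W_L4; have iWf := L4f iW.
have iWx i := L4x [set i] iW.
have i1 : L1 M (fun z => a z.1 * W z.1 ^+ 2) by apply: L1M => //; exact: L4X2.
have i2 i : L1 M (fun z => a z.1 * (W z.1 * incr g i z)).
  by apply: L1M => //; apply: L4M => //; exact: incr_L4.
have i3 i : L1 M (fun z => a z.1 * W (xm [set i] z) ^+ 2).
  by apply: L1M => //; exact: L4X2.
have i4 i : L1 M (fun z => a z.1 * (U z.1 - U (xm [set i] z))).
  by apply: L1M => //; apply: L2B; [exact: L2f|exact: L2x].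
have i5 i : L1 M (fun z => a z.1 * (Rp z.1 - Rp (xm [set i] z))).
  by apply: L1M => //; apply: L2B; [exact: L2f|exact: L2x].
have iaW : L2 mu (fun x => a x * W x) := L2_bddM ma ac (L4_L2 iW).
have e1 : \sum_i E2 (fun z => a z.1 * (W z.1 * incr g i z)) =
    p%:R * E1 (fun x => a x * W x ^+ 2).
  have := sum_E2_incr mu_rect g_L4 g_free g_degen g_order (L43_L2 iaW) (L43_L2 (L2f iaW)).
  move=> eq1; transitivity (p%:R * E1 (fun x => a x * W x * W x)).
    by rewrite -eq1; apply: eq_bigr => i _; apply: eq_Ex => z; rewrite mulrA.
  by congr (_ * _); apply: eq_Ex => x; rewrite expr2 mulrA.
have -> : \sum_i E2 (fun z => a z.1 * incr g i z ^+ 2) =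
    2 * p%:R * E1 (fun x => a x * Rp x) -
    \sum_i E2 (fun z => a z.1 * (r z.1 - r (xm [set i] z))).
  have eR : E1 (fun x => a x * Rp x) =
      E1 (fun x => a x * W x ^+ 2) - E1 (fun x => a x * U x).
    rewrite -ExB; [|exact: L1M (L4X2 _)|exact: L1M].
    by apply: eq_Ex => x; rewrite ustat_sqr; ring.
  rewrite eR mulrBr -(number_upart ia) -mulrA -e1 mulr_sumr -!sumrB.
  apply: eq_bigr => i _; rewrite -ExZ// -ExB//; last exact: L1Z.
  have ei z : incr g i z ^+ 2 = 2 * (W z.1 * incr g i z) -
      (U z.1 - U (xm [set i] z)) - (Rp z.1 - Rp (xm [set i] z)).
    have eU x : U x = W x ^+ 2 - Rp x by rewrite ustat_sqr addrK.
    by rewrite !eU /incr; ring.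
  have i6 : L1 M (fun z => a z.1 * (r z.1 - r (xm [set i] z))).
    apply: L1M => //; apply: L2B; [exact: L2f|exact: L2x].
  rewrite -ExB//; last by apply: L1B => //; exact: L1Z.
  by apply: eq_Ex => z; rewrite ei /r; ring.
have er : E1 (fun x => a x * r x) = E1 (fun x => a x * Rp x) - E1 a.
  rewrite -ExB//; [|exact: L1M|exact: L2_L1].
  by apply: eq_Ex => x; rewrite /r mulrBr mulr1.
rewrite er; move: (E1 a) (E1 _) (\sum_i _) => q s t.
by field; rewrite pnatr_eq0 -lt0n.
Qed.

(** With N the number operator and [W^2 = U + R], the form [<W^2, N W^2>] is at least [2p E[U^2]]:
    [<U, N U> = 2p E[U^2]], the cross terms vanish since [N U = 2p U] is orthogonal to [R], and
    [<R, N R>] is nonnegative. *)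
Lemma sum_E2_incr4_le :
  \sum_i E2 (fun z => incr g i z ^+ 4) <=
  p%:R * (8 * E1 (fun x => W x ^+ 4) - 12 * u).
Proof.
rewrite (sum_E2_incr4 mu_rect g_L4 g_free g_degen g_order).
have iQ : L2 mu (fun x => W x ^+ 2) by exact: L4X2.
suff h : 2 * p%:R * u <=
    \sum_i E2 (fun z => W z.1 ^+ 2 * (W z.1 ^+ 2 - W (xm [set i] z) ^+ 2)).
  by move: h; move: (\sum_i _) => t; move: (E1 _) u (p%:R) => q v w; nra.
have iQf := L2f iQ; have iUf := L2f iU; have iRf := L2f iR.
have dU i : L2 M (fun z => U z.1 - U (xm [set i] z)) by apply: L2B => //; exact: L2x.
have dR i : L2 M (fun z => Rp z.1 - Rp (xm [set i] z)) by apply: L2B => //; exact: L2x.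
have -> : 2 * p%:R * u = \sum_i (E2 (fun z => W z.1 ^+ 2 * (U z.1 - U (xm [set i] z))) +
    E2 (fun z => U z.1 * (Rp z.1 - Rp (xm [set i] z)))).
  rewrite big_split/= (number_upart iQ).
  have -> : \sum_i E2 (fun z => U z.1 * (Rp z.1 - Rp (xm [set i] z))) = 0.
    transitivity (\sum_i E2 (fun z => Rp z.1 * (U z.1 - U (xm [set i] z)))).
      apply: eq_bigr => i _.
      rewrite (_ : (fun z => U z.1 * _) = fun z => U z.1 * Rp z.1 - U z.1 * Rp (xm [set i] z)).
        rewrite ExB; [|exact: L1M|apply: L1M => //; exact: L2x].
        rewrite (E2_flip mu_rect _ (L2_meas iR) (L2_meas iU)) -ExB; last first.
        - by apply: L1M => //; exact: L2x.
        - exact: L1M.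
        by apply: eq_Ex => z; ring.
      by apply/funext => z; rewrite mulrBr.
    rewrite (number_upart iR).
    by under eq_Ex do rewrite mulrC; rewrite E1_upart_rpart mulr0.
  rewrite addr0; congr (_ * _).
  transitivity (E1 (fun x => U x ^+ 2 + U x * Rp x)).
    have i1 := iU.2; have i2 := L1M iU iR.
    by rewrite ExD// E1_upart_rpart addr0.
  by apply: eq_Ex => x; rewrite ustat_sqr; ring.
apply: ler_sum => i _.
have h0 : 0 <= E2 (fun z => Rp z.1 * (Rp z.1 - Rp (xm [set i] z))).
  rewrite -(E1_dev mu_rect iR i iR).
  rewrite (eq_Ex mu (fun x => mulrC _ _)) -(dev_proj mu_rect i iR iR).
  by apply: Ex_ge0 => x; rewrite -expr2 sqr_ge0.
rewrite -[leLHS]addr0; apply: (le_trans (lerD (lexx _) h0)).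
rewrite -ExD; [|exact: L1M..]; rewrite -ExD; [|by apply: L1D; exact: L1M|exact: L1M].
rewrite le_eqVlt; apply/orP; left; apply/eqP; apply: eq_Ex => z.
by rewrite !ustat_sqr; ring.
Qed.



End decomposition.

(** * Lower bound for the disjoint part *)

Section products_of_preserving_maps.
Context {d0 d1 d2 : measure_display} {T0 : measurableType d0}
  {T1 : measurableType d1} {T2 : measurableType d2} {R : realType}.
Variables (P0 : probability T0 R) (P1 : probability T1 R) (P2 : probability T2 R).

Lemma mpres_swap : mpres (P0 \x P1)%E (P1 \x P0)%E (fun t => (t.2, t.1)).
Proof.
have ms : measurable_fun setT (fun t : T0 * T1 => (t.2, t.1)).
  exact: measurable_swap.
split=> // A mA; pose m' := pushforward (P0 \x P1)%E (fun t : T0 * T1 => (t.2, t.1)).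
apply/esym; rewrite -[RHS]/(m' A).
move: A mA; apply: product_measure_unique.
move=> B C mB mC; rewrite -[LHS]/((P0 \x P1)%E (_ @^-1` (B `*` C))).
rewrite (_ : _ @^-1` _ = C `*` B); last first.
  by apply/seteqP; split => [[x y] []|[x y] []].
by rewrite muleC; exact: product_measure1E.
Qed.

Lemma mpres_prodl (phi : T0 -> T1) : mpres P0 P1 phi ->
  mpres (P0 \x P2)%E (P1 \x P2)%E (fun t => (phi t.1, t.2)).
Proof.
move=> [mphi pphi].
have ms : measurable_fun setT (fun t : T0 * T2 => (phi t.1, t.2)).
  by apply: measurable_fun_pair => //; exact: measurableT_comp.
split=> // A mA; pose m' := pushforward (P0 \x P2)%E (fun t : T0 * T2 => (phi t.1, t.2)).
apply/esym; rewrite -[RHS]/(m' A).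
move: A mA; apply: product_measure_unique.
move=> B C mB mC; rewrite -[LHS]/((P0 \x P2)%E (_ @^-1` (B `*` C))).
rewrite (_ : _ @^-1` _ = (phi @^-1` B) `*` C); last first.
  by apply/seteqP; split => [[x y] []|[x y] []].
transitivity (P0 (phi @^-1` B) * P2 C)%E.
  by apply: product_measure1E => //; rewrite -[_ @^-1` _]setTI; exact: mphi.
by congr (_ * _)%E; exact: pphi.
Qed.

End products_of_preserving_maps.

Lemma mpres_comp (d0 d1 d2 : measure_display) (T0 : measurableType d0)
  (T1 : measurableType d1) (T2 : measurableType d2) (R : realType)
  (P0 : probability T0 R) (P1 : probability T1 R) (P2 : probability T2 R)
  (phi : T0 -> T1) (psi : T1 -> T2) :
  mpres P0 P1 phi -> mpres P1 P2 psi -> mpres P0 P2 (psi \o phi).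
Proof.
move=> [mphi pphi] [mpsi ppsi]; split; first exact: measurableT_comp.
move=> A mA; rewrite -ppsi// -pphi//.
by rewrite -[_ @^-1` _]setTI; exact: mpsi.
Qed.

Lemma Ex_ae_ge0 (d : measure_display) (T : measurableType d) (R : realType)
    (P : probability T R) (F : T -> R) : measurable_fun setT F ->
  {ae P, forall x, 0 <= F x} -> 0 <= Ex P F.
Proof.
move=> mF F0; rewrite (ae_eq_Ex (G := fun x => `|F x|) mF); last 2 first.
- exact: measurableT_comp.
- by apply: filterS F0 => x x0; rewrite ger0_norm.
by apply: Ex_ge0 => x.
Qed.

(** * Positivity of four-cycle expectations *)

Section four_cycle.
Context {R : realType} {n : nat} {dE : 'I_n -> measure_display}
  {E : forall i, measurableType (dE i)}.
Local Notation T := (@cspace n dE E).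
Implicit Types (S : {set 'I_n}) (i j : 'I_n) (x y w : T) (z : T * T).
Variable mu : probability T R.
Hypothesis mu_rect : exists m : forall i, set (E i) -> \bar R,
  forall B : forall i, set (E i), (forall i, measurable (B i)) ->
  mu (rect B) = (\prod_i m i (B i))%E.
Local Notation M := (mu \x mu)%E.
Local Notation E1 := (Ex mu).
Local Notation E2 := (Ex M).

(* With [kappa y x = k x * k (mix S x y)], the left-hand side is the
   expectation of [kappa y x * kappa y x'] where [x'] is [x] resampled off [S],
   hence the mean of a squared conditional expectation. *)
Lemma four_cycle_ge0 S (k : T -> R) : L4 mu k ->
  0 <= E2 (fun z => k z.1 * k z.2 * (k (xm S z) * k (xm (~: S) z))).
Proof.
move=> ik; pose C := ~: S.
pose F (t : (T * T) * T) := k t.1.1 * k (mix S t.1.1 t.2) *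
  (k (mix C t.1.1 t.1.2) * k (mix C t.2 t.1.2)).
pose P3 := (M \x mu)%E.
have pf : mpres P3 M (fun t => (t.1.1, t.2)).
  exact: (mpres_prodl mu (mpres_fst mu mu)).
have ps : mpres P3 M (fun t => (t.2, t.1.2)).
  exact: (mpres_comp (mpres_prodl mu (mpres_snd mu mu)) (mpres_swap mu mu)).
have i1 : L4 P3 (fun t => k t.1.1).
  exact: (mpres_L4 (mpres_comp (mpres_fst M mu) (mpres_fst mu mu)) ik).
have i2 : L4 P3 (fun t => k (mix S t.1.1 t.2)).
  exact: (mpres_L4 (mpres_comp pf (mpres_xm mu_rect S)) ik).
have i3 : L4 P3 (fun t => k (mix C t.1.1 t.1.2)).
  exact: (mpres_L4 (mpres_comp (mpres_fst M mu) (mpres_xm mu_rect C)) ik).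
have i4 : L4 P3 (fun t => k (mix C t.2 t.1.2)).
  exact: (mpres_L4 (mpres_comp ps (mpres_xm mu_rect C)) ik).
have iF : L1 P3 F by apply: L1M; exact: L4M.
have pos : 0 <= Ex P3 F.
  rewrite (Ex_fubini2 iF); apply: Ex_ae_ge0; first exact: (measurable_Ex2 iF).
  pose h (z : T * T) := k z.2 * k (mix S z.2 z.1).
  have ih : L2 M h.
    apply: L4M; first exact: (mpres_L4 (mpres_snd mu mu)).
    exact: (mpres_L4 (mpres_comp (mpres_swap mu mu) (mpres_xm mu_rect S)) ik).
  apply: filterS (L2_slice1 ih) => y iy; have := E2_flip_ge0 mu_rect C iy.
  congr (0 <= _); apply: eq_Ex => -[x w]; rewrite /h /F /=; congr (_ * (_ * k _)).
  by apply: cspaceP => i; rewrite /xm /= !mixE !inE; case: (i \in S).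
have iF1 := L1_Ex1 iF.
suff -> : E2 (fun z => k z.1 * k z.2 * (k (xm S z) * k (xm (~: S) z))) = Ex P3 F by [].
have i0 : L1 M (fun z => k z.1 * k z.2 * (k (xm S z) * k (xm C z))).
  by apply: L1M; apply: L4M; [exact: (mpres_L4 (mpres_fst mu mu))|
    exact: (mpres_L4 (mpres_snd mu mu))|exact: L4_xm|exact: L4_xm].
rewrite (Ex_fubini1 iF) (Ex_fubini1 iF1) (Ex_fubini1 i0).
apply: ae_eq_Ex; [exact: (measurable_Ex1 i0)|exact: (measurable_Ex1 iF1)|].
have L4_slice (a : T * T -> R) : L4 M a -> {ae mu, forall x, L4 mu (fun y => a (x, y))}.
  move=> [ma ia]; apply: filterS (ae_L1_slice1 ia) => x ix; split => //.
  exact: (measurableT_comp ma).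
have := L4_slice _ (L4_xm mu_rect C ik); have := L4_slice _ (L4_xm mu_rect S ik).
apply: filterS2 => x iS iC.
have iG : L1 M (fun t => F ((x, t.1), t.2)).
  apply: L1M; apply: L4M.
  - exact: (L4_cst M (k x)).
  - exact: (mpres_L4 (mpres_snd mu mu) iS).
  - exact: (mpres_L4 (mpres_fst mu mu) iC).
  - exact: (mpres_L4 (mpres_comp (mpres_swap mu mu) (mpres_xm mu_rect C)) ik).
(* For fixed [x], exchanging the coordinates off [S] between the other two copies makes all factors
   read one and the same copy. *)
rewrite -(Ex_fubini1 iG) -(E2_mswap mu_rect C); last exact: L1_meas iG.
transitivity (E2 (fun z => k x * k z.2 * (k (mix S x z.2) * k (mix C x z.2)))).
  rewrite (mpres_Ex (mpres_snd mu mu)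
    (f := fun y => k x * k y * (k (mix S x y) * k (mix C x y))))//.
  do !apply: measurable_funM => //; [exact: L4_meas ik|exact: L4_meas iS|exact: L4_meas iC].
apply: eq_Ex => z; rewrite /F /=.
have -> : mix S x (mix C z.2 z.1) = mix S x z.2.
  by apply: cspaceP => i; rewrite !mixE !inE; case: (i \in S).
have -> : mix C x (mix C z.1 z.2) = mix C x z.2.
  by apply: cspaceP => i; rewrite !mixE !inE; case: (i \in S).
have -> : mix C (mix C z.2 z.1) (mix C z.1 z.2) = z.2.
  by apply: cspaceP => i; rewrite !mixE !inE; case: (i \in S).
by ring.
Qed.

End four_cycle.

(** A set with prescribed trace [Q] on [A] is free on the complement of [A]. *)
Lemma card_setI_fiber (I : finType) (A Q : {set I}) : Q \subset A ->
  #|[set S : {set I} | S :&: A == Q]%SET| = (2 ^ #|~: A|)%N.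
Proof.
move=> QA; rewrite -card_powerset -[RHS](card_in_imset (f := fun B => Q :|: B)%SET); last first.
  move=> B C; rewrite !inE => BA CA /setP e; apply/setP => i; have := e i.
  rewrite !inE; have [iQ _|//] := boolP (i \in Q).
  have iA := fintype.subsetP QA _ iQ.
  have nB (D : {set I}) : D \subset ~: A -> i \notin D.
    by move=> DA; apply: contraL iA => /(fintype.subsetP DA); rewrite inE.
  by rewrite (negbTE (nB _ BA)) (negbTE (nB _ CA)).
apply: eq_card => S; rewrite !inE; apply/eqP/imsetP => [SAQ|[B]].
  exists (S :\: A)%SET; first by rewrite inE; apply/fintype.subsetP => i; rewrite !inE => /andP[].
  by rewrite -SAQ finset.setID.
rewrite inE => BA ->; apply/setP => i; rewrite !inE.
have [iQ|iQ]/= := boolP (i \in Q); first by rewrite (fintype.subsetP QA).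
by apply/negP => /andP[/(fintype.subsetP BA)]; rewrite inE => /negP.
Qed.

(** * Exchanging the elements of two index sets *)

Section exchange.
Context {n : nat}.
Implicit Types (S J K : {set 'I_n}).

(** [exch S J K] and [exch S K J] are what [J] and [K] become when they exchange their elements in
    [S]. *)
Definition exch S J K : {set 'I_n} := [set i | if i \in S then i \in K else i \in J]%SET.

Lemma in_exch S J K i : (i \in exch S J K) = if i \in S then i \in K else i \in J.
Proof. by rewrite inE. Qed.

Lemma exchK S J K : exch S (exch S J K) (exch S K J) = J.
Proof. by apply/setP => i; rewrite !in_exch; case: (i \in S). Qed.

Lemma exchC S J K : exch (~: S) J K = exch S K J.
Proof. by apply/setP => i; rewrite !in_exch inE; case: (i \in S). Qed.

Lemma exch_disjoint S J K : [disjoint exch S J K & exch S K J]%B = [disjoint J & K]%B.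
Proof.
apply/pred0P/pred0P => h i; have := h i; rewrite /= ?in_exch; case: (i \in S) => //.
  by rewrite andbC.
by rewrite andbC.
Qed.

(** On [J :|: K] the set [S] is determined: it consists of the elements that change sides, those
    leaving [J] and those of [K] entering [J']. *)
Lemma exch_fiber S J K J' K' : [disjoint J & K]%B -> [disjoint J' & K']%B ->
  (J' :|: K' = J :|: K)%SET ->
  ((exch S J K == J') && (exch S K J == K')) =
  ((S :&: (J :|: K))%SET == ((J :\: J') :|: (K :&: J'))%SET).
Proof.
move=> /pred0P JK /pred0P JK' /setP e; apply/andP/eqP => [[/eqP e1 /eqP e2]|/setP h].
  apply/setP => i; have := JK i; have := JK' i; have := e i; rewrite -e1 -e2.
  rewrite !inE; by case: (i \in S) (i \in J) (i \in K) => -[] [].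
split; apply/eqP/setP => i; have := JK i; have := JK' i; have := e i; have := h i;
  rewrite /= in_exch !inE;
  by case: (i \in S) (i \in J) (i \in K) (i \in J') (i \in K') => -[] [] [] [].
Qed.

End exchange.

(** * Mixed fourth moments under exchange *)

Section zeta.
Context {R : realType} {n : nat} {dE : 'I_n -> measure_display}
  {E : forall i, measurableType (dE i)}.
Local Notation T := (@cspace n dE E).
Implicit Types (S J K : {set 'I_n}) (i j : 'I_n) (x y : T) (z : T * T).
Variable mu : probability T R.
Hypothesis mu_rect : exists m : forall i, set (E i) -> \bar R,
  forall B : forall i, set (E i), (forall i, measurable (B i)) ->
  mu (rect B) = (\prod_i m i (B i))%E.
Local Notation M := (mu \x mu)%E.
Local Notation E1 := (Ex mu).
Local Notation E2 := (Ex M).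
Variables (p : nat) (g : {set 'I_n} -> T -> R).
Hypothesis p_gt0 : (0 < p)%N.
Hypothesis g_L4 : forall J, L4 mu (g J).
Hypothesis g_free : forall J S x y, [disjoint S & J]%B -> g J (mix S x y) = g J x.
Hypothesis g_degen : forall J i, i \in J -> degen mu i (g J).
Hypothesis g_order : forall J, #|J| != p -> g J = fun=> 0.
Local Notation W := (ustat g).
Let L4x S (k : T -> R) : L4 mu k -> L4 M (fun z => k (xm S z)) :=
  @L4_xm _ _ _ _ _ mu_rect S k.
Let L4f (k : T -> R) : L4 mu k -> L4 M (fun z => k z.1).
Proof. exact: (mpres_L4 (mpres_fst mu mu)). Qed.

Definition gvar J := E1 (fun x => g J x ^+ 2).
Local Notation v := gvar.

Lemma gvar_ge0 J : 0 <= v J. Proof. by apply: Ex_ge0 => x; exact: sqr_ge0. Qed.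

Lemma gvar_eq0 J : #|J| != p -> v J = 0.
Proof. by move=> Jp; rewrite /gvar (g_order Jp) (eq_Ex mu (G := fun=> 0)) ?Ex_cst// => x; rewrite expr0n. Qed.

Lemma E2_mul_sqr J K : E2 (fun z => g J z.1 ^+ 2 * g K z.2 ^+ 2) = v J * v K.
Proof.
have iJ := L4X2 (L4f (g_L4 J)).
have iK : L2 M (fun z => g K z.2 ^+ 2) by apply: L4X2; exact: (mpres_L4 (mpres_snd mu mu)).
rewrite (Ex_fubini1 (L1M iJ iK)) mulrC /gvar -ExZ; last exact: (L4_L2 (g_L4 _)).2.
by apply: eq_Ex => x /=; rewrite ExZ 1?mulrC//; exact: (L4_L2 (g_L4 _)).2.
Qed.

(** The four kernels are evaluated at the two copies and at the two copies after their exchange on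
    [S]. *)
Definition moment4 S J K J' K' :=
  E2 (fun z => g J z.1 * g K z.2 * (g J' (xm S z) * g K' (xm (~: S) z))).

Local Notation e4 := moment4.
Let L4g2 K : L4 M (fun z => g K z.2).
Proof. exact: (mpres_L4 (mpres_snd mu mu)). Qed.

Lemma moment4_L1 S J K J' K' :
  L1 M (fun z => g J z.1 * g K z.2 * (g J' (xm S z) * g K' (xm (~: S) z))).
Proof. by apply: L1M; apply: L4M; [exact: L4f|exact: L4g2|exact: L4x|exact: L4x]. Qed.

Lemma moment4_swap S J K J' K' : e4 S J K J' K' = e4 S K J K' J'.
Proof.
rewrite /moment4 -(E2_mswap mu_rect [set: 'I_n]%SET); last exact: L1_meas (moment4_L1 _ _ _ _ _).
apply: eq_Ex => z; rewrite !xm_mswap.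
have -> : (mswap [set: 'I_n]%SET z) = (z.2, z.1).
  by congr (_, _); apply: cspaceP => i; rewrite mixE inE.
have -> : symd S [set: 'I_n] = ~: S by apply/setP => i; rewrite !inE addbT.
have -> : symd (~: S) [set: 'I_n] = S by apply/setP => i; rewrite !inE addbT negbK.
by rewrite /= [g J _ * _]mulrC [g J' _ * _]mulrC.
Qed.

Lemma mswapE S z : mswap S z = (xm S z, xm (~: S) z).
Proof.
congr (_, _); apply: cspaceP => i; rewrite mixE xmE inE.
by case: (i \in S).
Qed.

Lemma moment4_mswap S J K J' K' : e4 S J K J' K' = e4 S J' K' J K.
Proof.
rewrite /moment4 -(E2_mswap mu_rect S); last exact: L1_meas (moment4_L1 _ _ _ _ _).
apply: eq_Ex => z; rewrite !xm_mswap symdd xm0.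
have -> : symd (~: S) S = finset.setT by apply/setP => i; rewrite !inE; case: (i \in S).
by rewrite mswapE xmT /= mulrC.
Qed.

Lemma moment4_setC S J K J' K' : e4 (~: S) J K J' K' = e4 S J K K' J'.
Proof. by apply: eq_Ex => z; rewrite finset.setCK [g J' _ * _]mulrC. Qed.

(** Coordinate [i] of the first copy is read by the kernel of [J] and, among the exchanged ones,
    only by [K'] if [i] is in [S] and by [J'] otherwise. If that one ignores [i] too, degeneracy
    applies. *)
Lemma moment4_eq0_in S J K J' K' i : i \in J -> i \notin (if i \in S then K' else J') ->
  e4 S J K J' K' = 0.
Proof.
move=> iJ iJK.
pose F z := g K z.2 * (g J' (xm S z) * g K' (xm (~: S) z)).
have eF z : g J z.1 * g K z.2 * (g J' (xm S z) * g K' (xm (~: S) z)) = F z * g J z.1.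
  by rewrite /F; ring.
have iF := moment4_L1 S J K J' K'; rewrite (funext eF) in iF.
rewrite /moment4 (eq_Ex M eF); apply: (degen_E2 mu_rect (i := i)) => //.
- exact/L4_L1.
- exact: g_degen.
- by do !apply: measurable_funM; [exact: L4_meas (L4g2 K)|exact: L4_meas (L4x _ (g_L4 _))|exact: L4_meas (L4x _ (g_L4 _))].
move=> x y w; rewrite /F /=; congr (_ * _).
have fr S' J0 : (i \notin S' -> i \notin J0) ->
    g J0 (xm S' (mix [set i] x w, y)) = g J0 (xm S' (x, y)).
  move=> iS; have [iS'|iS'] := boolP (i \in S').
    congr g; apply: cspaceP => j; rewrite !xmE /= mixE inE.
    by case: eqVneq => // ->; rewrite iS'.
  rewrite -[RHS](@g_free J0 [set i]%SET _ w); last by rewrite disjoints1 iS.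
  congr g; apply: cspaceP => j; rewrite mixE !xmE /= mixE inE.
  by case: eqVneq => // ->; rewrite (negbTE iS').
congr (_ * _); apply: fr; first by move=> iS; rewrite (negbTE iS) in iJK.
by rewrite inE negbK => iS; rewrite iS in iJK.
Qed.

(** The symmetries bring each of the four kernels into first place; the four inclusions obtained in
    this way force both equalities of sets. *)
Lemma moment4_eq0 S J K J' K' : ~~ ((exch S J K == J') && (exch S K J == K')) ->
  e4 S J K J' K' = 0.
Proof.
apply: contraNeq => e0.
have a1 (A B C D : {set 'I_n}) : e4 S A B C D != 0 -> forall i, i \in A -> i \in if i \in S then D else C.
  move=> h i iA; apply/negPn/negP => iB; move/eqP: h; apply.
  exact: moment4_eq0_in iA iB.
have h1 := a1 _ _ _ _ e0.
have e0' := e0; rewrite moment4_swap in e0'; have h2 := a1 _ _ _ _ e0'.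
rewrite moment4_mswap in e0'; have h3 := a1 _ _ _ _ e0'.
rewrite moment4_swap in e0'; have h4 := a1 _ _ _ _ e0'.
apply/andP; split; apply/eqP/setP => i; rewrite in_exch; apply/idP/idP;
  move: (h1 i) (h2 i) (h3 i) (h4 i); case: (i \in S) => //;
  by case: (i \in J) (i \in K) (i \in J') (i \in K') => -[] [] [] a b c d; auto.
Qed.

(** By [moment4_eq0], the one mixed moment with [J] and [K] at the two copies that can be
    nonzero. *)
Definition exch_moment S J K := e4 S J K (exch S J K) (exch S K J).

Local Notation eps := exch_moment.
Lemma exch_momentC S J K : eps (~: S) J K = eps S J K.
Proof. by rewrite /exch_moment !exchC moment4_setC. Qed.

Lemma exch_moment_swap S J K : eps S J K = eps S K J.
Proof. exact: moment4_swap. Qed.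

Let moment4_eq0r S J K J' K' : ([|| #|J| != p, #|K| != p, #|J'| != p | #|K'| != p])%N -> e4 S J K J' K' = 0.
Proof.
move=> h; rewrite /moment4 (eq_Ex M (G := fun=> 0)) ?Ex_cst// => z.
by case/or4P: h => /g_order ->; rewrite ?mulr0 ?mul0r// ?mulr0 ?mul0r.
Qed.

(** For [J] inside [S], [exch S J K] is [K :&: S]: it has fewer than [p] elements unless [K] lies in
    [S], and then the exchange only relabels the copies. *)
Lemma exch_moment_sub S J K : J \subset S -> eps S J K = if K \subset S then v J * v K else 0.
Proof.
move=> JS; case: ifPn => KS.
  have -> : eps S J K = e4 S J K K J.
    rewrite /exch_moment; congr e4; apply/setP => i; rewrite in_exch;
      have /implyP := fintype.subsetP JS i; have /implyP := fintype.subsetP KS i;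
      by case: (i \in S) (i \in J) (i \in K) => -[] [].
  rewrite -E2_mul_sqr /moment4; apply: eq_Ex => z.
  rewrite (g_xm_in g_free _ KS) (g_xm_out g_free); first by ring.
  by apply/pred0P => i /=; rewrite !inE; apply/negP => /andP[/negP iS /(fintype.subsetP JS)].
have [Kp|Kp] := eqVneq #|K| p; last by apply: moment4_eq0r; rewrite Kp orbT.
apply: moment4_eq0r; apply/or4P; apply: Or43; apply: contraNneq KS => e.
have sK : exch S J K \subset K.
  apply/fintype.subsetP => i; rewrite in_exch; case: ifPn => // iS iJ.
  by rewrite (fintype.subsetP JS _ iJ) in iS.
have eK : exch S J K = K by apply/eqP; rewrite eqEcard sK e Kp leqnn.
rewrite -eK.
apply/fintype.subsetP => i; rewrite in_exch; case: ifPn => // iS iJ.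
by rewrite (fintype.subsetP JS _ iJ) in iS.
Qed.

Lemma norm_exch_moment_le S J K :
  `|eps S J K| <= 2^-1 * (v J * v K + v (exch S J K) * v (exch S K J)).
Proof.
rewrite -!E2_mul_sqr -[X in _ + X](E2_mswap mu_rect S); last first.
  by apply: measurable_funM; apply: measurable_funX; [exact: L4_meas (L4f (g_L4 _))|exact: L4_meas (L4g2 _)].
have i1 (A B : {set 'I_n}) : L2 M (fun z => g A z.1 * g B z.2) by apply: L4M; [exact: L4f|exact: L4g2].
have i2 (A B : {set 'I_n}) : L2 M (fun z => g A (xm S z) * g B (xm (~: S) z)) by apply: L4M; exact: L4x.
have j1 : L1 M (fun z => g J z.1 ^+ 2 * g K z.2 ^+ 2).
  by have [_] := i1 J K; under [X in L1 M X]eq_fun do rewrite exprMn.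
pose J' := exch S J K; pose K' := exch S K J.
have j2 : L1 M (fun z => g J' (mswap S z).1 ^+ 2 * g K' (mswap S z).2 ^+ 2).
  by have [_] := i2 J' K'; under [X in L1 M X]eq_fun do rewrite exprMn; under [X in _ -> L1 M X]eq_fun do rewrite mswapE.
rewrite -ExD// -ExZ; last exact: L1D.
apply: norm_Ex_le; [exact: moment4_L1|exact/L1Z/L1D|].
move=> z; rewrite mswapE /= -!exprMn normrM.
move: (g J _ * g K _) (g J' _ * g K' _) => a b.
by rewrite -[a ^+ 2]real_normK ?num_real// -[b ^+ 2]real_normK ?num_real//; have := sqr_ge0 (`|a| - `|b|); nra.
Qed.

(** No coordinate is read from both copies: the first serves [J] and the second [K]. The two copies
    therefore merge into the single point [xm K z]. *)
Lemma exch_moment_disjoint S J K : [disjoint J & K]%B ->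
  eps S J K = E1 (fun x => g J x * g K x * (g (exch S J K) x * g (exch S K J) x)).
Proof.
move=> JK; rewrite -(E2_xm mu_rect K); last exact: L1_meas (L1_g4 g_L4 _ _ _ _).
apply: eq_Ex => z; congr (_ * _ * (_ * _)).
- by rewrite (g_xm_out g_free)// disjoint_sym.
- by rewrite (g_xm_in g_free).
- rewrite (g_xmI g_free) [RHS](g_xmI g_free); congr (g _ (xm _ _)).
  apply/setP => i; have := pred0P JK i; rewrite /= !finset.in_setI !in_exch.
  by case: (i \in S) (i \in J) (i \in K) => -[] [].
rewrite (g_xmI g_free) [RHS](g_xmI g_free); congr (g _ (xm _ _)).
apply/setP => i; have := pred0P JK i; rewrite /= !finset.in_setI !in_exch inE.
by case: (i \in S) (i \in J) (i \in K) => -[] [].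
Qed.

End zeta.

Lemma prod4_sum (R : comPzRingType) (I : finType) (Q : pred I) (a b c d : I -> R) :
  (\sum_(i | Q i) a i) * (\sum_(i | Q i) b i) *
    ((\sum_(i | Q i) c i) * (\sum_(i | Q i) d i)) =
  \sum_(i | Q i) \sum_(j | Q j) \sum_(k | Q k) \sum_(l | Q l)
    a i * b j * (c k * d l).
Proof.
rewrite -mulrA mulr_suml; apply: eq_bigr => i _.
rewrite mulr_suml mulr_sumr; apply: eq_bigr => j _.
rewrite mulrA mulr_suml mulr_sumr; apply: eq_bigr => k _.
by rewrite !mulr_sumr.
Qed.

(** * Lower bound for the sum of exchange moments over all pairs *)

Section zeta_sum.
Context {R : realType} {n : nat} {dE : 'I_n -> measure_display}
  {E : forall i, measurableType (dE i)}.
Local Notation T := (@cspace n dE E).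
Implicit Types (S J K : {set 'I_n}) (i j : 'I_n) (x y : T) (z : T * T).
Variable mu : probability T R.
Hypothesis mu_rect : exists m : forall i, set (E i) -> \bar R,
  forall B : forall i, set (E i), (forall i, measurable (B i)) ->
  mu (rect B) = (\prod_i m i (B i))%E.
Local Notation M := (mu \x mu)%E.
Local Notation E1 := (Ex mu).
Local Notation E2 := (Ex M).
Variables (p : nat) (g : {set 'I_n} -> T -> R).
Hypothesis p_gt0 : (0 < p)%N.
Hypothesis g_L4 : forall J, L4 mu (g J).
Hypothesis g_free : forall J S x y, [disjoint S & J]%B -> g J (mix S x y) = g J x.
Hypothesis g_degen : forall J i, i \in J -> degen mu i (g J).
Hypothesis g_order : forall J, #|J| != p -> g J = fun=> 0.
Local Notation W := (ustat g).
Let W_L4 : L4 mu W := ustat_L4 g_L4.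
Local Notation v := (gvar mu g).
Local Notation eps := (exch_moment mu g).
Local Notation e4 := (moment4 mu g).

Lemma E1_gg_eq0 J K : J != K -> E1 (fun x => g J x * g K x) = 0.
Proof.
move=> JK; have z0 (A B : {set _}) : #|A| != p -> E1 (fun x => g A x * g B x) = 0.
  move=> Ap; rewrite (eq_Ex mu (G := fun=> 0)) ?Ex_cst// => x.
  by rewrite (g_order Ap) mul0r.
have [Jp|/z0//] := eqVneq #|J| p.
have [Kp|Kp] := eqVneq #|K| p; last by under eq_Ex do rewrite mulrC; exact: z0.
have : ~~ (J \subset K) by move: JK; rewrite eqEcard Jp Kp leqnn andbT.
move=> /subsetPn[i iJ iK]; under eq_Ex do rewrite mulrC.
apply: (degen_E1 mu_rect (i := i)) => //.
- exact: L4_L1.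
- exact: g_degen.
- exact: L4_meas.
- by move=> x y; rewrite g_free// disjoints1.
- exact/L2_L1/L4M.
Qed.

Hypothesis W_sqr1 : E1 (fun x => W x ^+ 2) = 1.

Lemma sum_var : \sum_J v J = 1.
Proof.
rewrite -W_sqr1; transitivity (\sum_J E1 (fun x => g J x * W x)).
  apply: eq_bigr => J _; rewrite (eq_Ex mu (fun x => mulr_sumr _ _ _ _)).
  rewrite Ex_sum; last by move=> K _; exact/L2_L1/L4M.
  rewrite (bigD1 J)//= big1 ?addr0//; last by move=> K KJ; rewrite E1_gg_eq0// eq_sym.
rewrite -Ex_sum; last by move=> J _; apply/L2_L1/L4M.
by apply: eq_Ex => x; rewrite -mulr_suml expr2.
Qed.

(* Pairs with [J] or [K] inside [S] or inside its complement contribute a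
   product of variances or nothing; the other pairs add up to a four-cycle
   expectation, which is nonnegative. *)
Lemma sum_exch_moment_ge S :
  \sum_J \sum_K ((J :|: K \subset S)%:R + (J :|: K \subset ~: S)%:R) * (v J * v K) <=
  \sum_J \sum_K eps S J K.
Proof.
pose A J := ~~ (J \subset S) && ~~ (J \subset ~: S).
have decomp J K : eps S J K =
    ((J :|: K \subset S)%:R + (J :|: K \subset ~: S)%:R) * (v J * v K) +
    (A J && A K)%:R * eps S J K.
  have sw (B C : {set 'I_n}) : C \subset S -> eps S B C = if B \subset S then v B * v C else 0.
    by move=> CS; rewrite (exch_moment_swap mu_rect g_L4) (exch_moment_sub g_L4 g_free g_order)// mulrC.
  have v0 (B : {set 'I_n}) : (B \subset S) && (B \subset ~: S) -> v B = 0.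
    case/andP => BS BS'; apply: (gvar_eq0 mu g_order); suff -> : B = finset.set0 by rewrite cards0 eq_sym -lt0n.
    apply/setP => i; rewrite !inE; apply/negP => iB; have := fintype.subsetP BS' _ iB.
    by rewrite inE (fintype.subsetP BS _ iB).
  rewrite !finset.subUset /A.
  have := v0 J; have := v0 K.
  have [JS|JS] := boolP (J \subset S).
    rewrite (exch_moment_sub g_L4 g_free g_order)//=.
    have [JS'|JS'] := boolP (J \subset ~: S); have [KS|KS] := boolP (K \subset S);
    have [KS'|KS'] := boolP (K \subset ~: S) => //= a b;
    rewrite ?(a isT) ?(b isT); ring.
  have [JS'|JS'] := boolP (J \subset ~: S).
    rewrite -(exch_momentC mu g) (exch_moment_sub g_L4 g_free g_order)//=.
    have [KS|KS] := boolP (K \subset S);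
    have [KS'|KS'] := boolP (K \subset ~: S) => //= a b; rewrite ?(a isT) ?(b isT); ring.
  have [KS|KS] := boolP (K \subset S).
    by rewrite sw// (negbTE JS) /= => *; ring.
  have [KS'|KS'] := boolP (K \subset ~: S).
    rewrite -(exch_momentC mu g) (exch_moment_swap mu_rect g_L4) (exch_moment_sub g_L4 g_free g_order)// (negbTE JS') => *.
    by rewrite /=; ring.
  by move=> *; rewrite /=; ring.
under [leRHS]eq_bigr do rewrite (eq_bigr _ (fun K _ => decomp _ K)) big_split/=.
rewrite big_split/= lerDl.
(* The kernels that straddle [S] and its complement. Expanding their four-cycle expectation leaves
   only the exchange moments. *)
pose k x := \sum_(J : {set 'I_n} | A J) g J x.
have ik : L4 mu k by apply: L4_sum.
have := four_cycle_ge0 mu_rect S ik; congr (0 <= _).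
have i1 (B C D F : {set 'I_n}) := moment4_L1 mu_rect g_L4 S B C D F.
transitivity (\sum_(J : {set 'I_n} | A J) \sum_(K : {set 'I_n} | A K)
    \sum_(J' : {set 'I_n} | A J') \sum_(K' : {set 'I_n} | A K') e4 S J K J' K').
  have ek z : k z.1 * k z.2 * (k (xm S z) * k (xm (~: S) z)) =
      \sum_(J : {set 'I_n} | A J) \sum_(K : {set 'I_n} | A K)
      \sum_(J' : {set 'I_n} | A J') \sum_(K' : {set 'I_n} | A K')
        g J z.1 * g K z.2 * (g J' (xm S z) * g K' (xm (~: S) z)).
    exact: prod4_sum.
  rewrite (eq_Ex M ek).
  do 3!(rewrite Ex_sum; [apply: eq_bigr => ? _|move=> ? _; do !apply: L1_sum => ? _; exact: i1]).
  by rewrite Ex_sum.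
rewrite big_mkcond; apply: eq_bigr => J _; case: ifP => AJ; last first.
  by rewrite big1// => K _; rewrite mul0r.
rewrite big_mkcond; apply: eq_bigr => K _; case: ifP => AK /=; last by rewrite mul0r.
rewrite mul1r.
have e0 (B C : {set 'I_n}) : ~~ ((exch S J K == B) && (exch S K J == C)) -> e4 S J K B C = 0.
  exact: moment4_eq0.
transitivity (if A (exch S J K) && A (exch S K J) then eps S J K else 0).
  case: ifPn => [/andP[AJ' AK']|].
    rewrite (bigD1 (exch S J K))//= (bigD1 (exch S K J))//= [X in _ + X]big1 ?[X in _ + X + _]big1 ?addr0//.
    - by move=> K' /andP[_ nK]; apply: e0; rewrite [_ == K']eq_sym (negbTE nK) andbF.
    - move=> J' /andP[_ nJ]; apply: big1 => K' _; apply: e0.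
      by rewrite [_ == J']eq_sym (negbTE nJ).
  move=> nA; apply: big1 => J' AJ'; apply: big1 => K' AK'; apply: e0.
  by apply: contra nA => /andP[/eqP -> /eqP ->]; rewrite AJ'.
case: ifPn => // nA; apply/esym.
have es : eps S J K = eps S (exch S J K) (exch S K J).
  by rewrite /exch_moment !exchK (moment4_mswap mu_rect g_L4).
rewrite es.
(* Applied to the exchanged pair and read backwards through [exchK], this would put [J] or [K]
   inside [S] or its complement, against the choice of straddling sets. *)
have bad (B C S' : {set 'I_n}) : B \subset S' -> eps S' B C != 0 -> (exch S' B C) \subset S'.
  move=> BS; rewrite (exch_moment_sub g_L4 g_free g_order)//; case: ifPn => [CS _|_]; last by rewrite eqxx.
  apply/fintype.subsetP => i; rewrite in_exch; case: ifPn => // iS iB.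
  by rewrite (fintype.subsetP BS _ iB) in iS.
apply/eqP/negPn/negP => ne.
have ne' : eps S (exch S K J) (exch S J K) != 0 by rewrite (exch_moment_swap mu_rect g_L4).
move: AJ AK; rewrite /A; move=> /andP[J1 J2] /andP[K1 K2].
move: nA; rewrite /A !negb_and !negbK => /orP[/orP[h|h]|/orP[h|h]].
- by move: (bad _ _ _ h ne); rewrite exchK; exact/negP.
- by rewrite -(exch_momentC mu g) in ne; move: (bad _ _ _ h ne); rewrite exchC exchK; exact/negP.
- by move: (bad _ _ _ h ne'); rewrite exchK; exact/negP.
- by rewrite -(exch_momentC mu g) in ne'; move: (bad _ _ _ h ne'); rewrite exchC exchK; exact/negP.
Qed.

End zeta_sum.

(** * Averaging over the exchanged set *)

Section upart_bound.
Context {R : realType} {n : nat} {dE : 'I_n -> measure_display}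
  {E : forall i, measurableType (dE i)}.
Local Notation T := (@cspace n dE E).
Implicit Types (S J K : {set 'I_n}) (i j : 'I_n) (x y : T) (z : T * T).
Variable mu : probability T R.
Hypothesis mu_rect : exists m : forall i, set (E i) -> \bar R,
  forall B : forall i, set (E i), (forall i, measurable (B i)) ->
  mu (rect B) = (\prod_i m i (B i))%E.
Local Notation M := (mu \x mu)%E.
Local Notation E1 := (Ex mu).
Local Notation E2 := (Ex M).
Variables (p : nat) (g : {set 'I_n} -> T -> R).
Hypothesis p_gt0 : (0 < p)%N.
Hypothesis g_L4 : forall J, L4 mu (g J).
Hypothesis g_free : forall J S x y, [disjoint S & J]%B -> g J (mix S x y) = g J x.
Hypothesis g_degen : forall J i, i \in J -> degen mu i (g J).
Hypothesis g_order : forall J, #|J| != p -> g J = fun=> 0.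
Local Notation W := (ustat g).
Local Notation v := (gvar mu g).
Local Notation eps := (exch_moment mu g).
Local Notation U := (upart g).

Let v0 J : #|J| != p -> v J = 0 := @gvar_eq0 _ _ _ _ mu _ _ g_order J.

(** The exchange is an involution on pairs that preserves disjointness, so the two products of
    variances in [norm_exch_moment_le] have the same sum over intersecting pairs. *)
Lemma sum_norm_exch_moment_le (rho2 : R) S :
  E1 (fun x => W x ^+ 2) = 1 ->
  (forall i, \sum_(J : {set 'I_n} | i \in J) v J <= rho2) ->
  \sum_(J : {set 'I_n}) \sum_(K : {set 'I_n} | ~~ [disjoint J & K]%B) `|eps S J K| <= p%:R * rho2.
Proof.
move=> W1 vrho.
have s1 : \sum_(J : {set 'I_n}) v J = 1 by exact: (sum_var mu_rect g_L4 g_free g_degen g_order W1).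
pose D J K := ~~ [disjoint J & K]%B.
have hD : \sum_(J : {set 'I_n}) \sum_(K : {set 'I_n} | D J K) v J * v K <= p%:R * rho2.
  apply: (@le_trans _ _ (\sum_(J : {set 'I_n}) v J * (p%:R * rho2))); last by rewrite -mulr_suml s1 mul1r.
  apply: ler_sum => J _; rewrite -mulr_sumr.
  have [Jp|Jp] := eqVneq #|J| p; last by rewrite v0// !mul0r.
  apply: ler_wpM2l; first exact: gvar_ge0.
  (* A set [K] meeting [J] contains some [i] in [J]; each of the [p] choices of [i] costs at most
     [rho2]. *)
  apply: (@le_trans _ _ (\sum_(i in J) \sum_(K : {set 'I_n} | i \in K) v K)).
    rewrite (exchange_big_dep (fun=> true))//= big_mkcond; apply: ler_sum => K _.
    have s0 : 0 <= \sum_(i in J | i \in K) v K by apply: sumr_ge0 => i _; exact: gvar_ge0.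
    case: ifPn => //; rewrite /D -finset.setI_eq0 => /set0Pn[i]; rewrite inE => /andP[iJ iK].
    rewrite (bigD1 i) ?iJ//= lerDl; apply: sumr_ge0 => j _; exact: gvar_ge0.
  apply: (@le_trans _ _ (\sum_(i in J) rho2)); first by apply: ler_sum => i _.
  by rewrite sumr_const Jp mulr_natl.
apply: le_trans hD.
have e : \sum_(J : {set 'I_n}) \sum_(K : {set 'I_n} | D J K) v J * v K =
    \sum_(J : {set 'I_n}) \sum_(K : {set 'I_n} | D J K) v (exch S J K) * v (exch S K J).
  rewrite !pair_big_dep /=; pose f (t : {set 'I_n} * {set 'I_n}) := (exch S t.1 t.2, exch S t.2 t.1).
  have fK : involutive f by move=> [J K]; rewrite /f /= !exchK.
  rewrite (reindex_inj (inv_inj fK)) /=; apply: eq_bigl => -[J K] /=.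
  by rewrite /D exch_disjoint.
set t := (X in _ <= X); have -> : t = 2^-1 * (t + t) by rewrite mulrDr; lra.
rewrite {2}/t e /t -big_split/= mulr_sumr; apply: ler_sum => J _.
rewrite -big_split/= mulr_sumr; apply: ler_sum => K _.
exact: norm_exch_moment_le.
Qed.

Let Q J K J' K' := E1 (fun x => g J x * g K x * (g J' x * g K' x)).

Let Q0 J K J' K' : [|| #|J| != p, #|K| != p | (J' :|: K' != J :|: K)%SET] ->
  [disjoint J & K]%B -> [disjoint J' & K']%B -> Q J K J' K' = 0.
Proof.
move=> h JK JK'.
have z (F : T -> R) : F =1 (fun=> 0) -> E1 F = 0 by move=> /eq_Ex ->; rewrite Ex_cst.
case/or3P: h => [h|h|h].
- by apply: z => x; rewrite (g_order h) !mul0r.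
- by apply: z => x; rewrite (g_order h) mulr0 mul0r.
- move: h; rewrite finset.eqEsubset negb_and => /orP[] /subsetPn[i i1 i2].
  by rewrite /Q; under eq_Ex do rewrite mulrC; exact: (E1_g4_eq0 mu_rect g_L4 g_free g_degen JK' i1 i2).
by exact: (E1_g4_eq0 mu_rect g_L4 g_free g_degen JK i1 i2).
Qed.

(** Given disjoint [J], [K], each disjoint pair [J'], [K'] with the same union arises from exactly
    [2 ^ (n - 2p)] sets [S]. Pairs with another union do not contribute to E[U^2] either. *)
Lemma sum_exch_moment_disjoint :
  \sum_(S : {set 'I_n}) \sum_(J : {set 'I_n}) \sum_(K : {set 'I_n} | [disjoint J & K]%B) eps S J K =
  2 ^+ n / 4 ^+ p * E1 (fun x => U x ^+ 2).
Proof.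
transitivity (2 ^+ n / 4 ^+ p * \sum_(J : {set 'I_n}) \sum_(K : {set 'I_n} | [disjoint J & K]%B)
    \sum_(J' : {set 'I_n}) \sum_(K' : {set 'I_n} | [disjoint J' & K']%B) Q J K J' K'); last first.
  congr (_ * _); rewrite (eq_Ex mu (G := fun x => \sum_(J : {set 'I_n}) \sum_(K : {set 'I_n} | [disjoint J & K]%B)
    \sum_(J' : {set 'I_n}) \sum_(K' : {set 'I_n} | [disjoint J' & K']%B) g J x * g K x * (g J' x * g K' x))); last first.
    move=> x; rewrite /upart expr2 mulr_suml; apply: eq_bigr => J _.
    rewrite mulr_suml; apply: eq_bigr => K _.
    by rewrite mulr_sumr; apply: eq_bigr => J' _; rewrite mulr_sumr.
  do 3!(rewrite Ex_sum; [apply: eq_bigr => ? _|move=> ? _; do !apply: L1_sum => ? _; exact: L1_g4]).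
  by rewrite Ex_sum => // ? _; exact: L1_g4.
rewrite exchange_big/= mulr_sumr; apply: eq_bigr => J _.
rewrite exchange_big/= mulr_sumr; apply: eq_bigr => K JK.
transitivity (\sum_(S : {set 'I_n}) \sum_(J' : {set 'I_n}) \sum_(K' : {set 'I_n} | [disjoint J' & K']%B)
    ((exch S J K == J') && (exch S K J == K'))%:R * Q J K J' K').
  apply: eq_bigr => S _; rewrite (exch_moment_disjoint mu_rect g_L4 g_free)//.
  rewrite (bigD1 (exch S J K))//= (bigD1 (exch S K J))/=; last by rewrite exch_disjoint.
  rewrite !eqxx mul1r [X in _ + X]big1 ?[X in _ + X + _]big1 ?addr0//.
  - by move=> K' /andP[_ nK]; rewrite [_ == K']eq_sym (negbTE nK) mul0r.
  - move=> J' nJ; apply: big1 => K' _.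
    by rewrite [_ == J']eq_sym (negbTE nJ) mul0r.
rewrite exchange_big/= mulr_sumr; apply: eq_bigr => J' _.
rewrite exchange_big/= mulr_sumr; apply: eq_bigr => K' JK'.
rewrite -mulr_suml; have [h|] := boolP [|| #|J| != p, #|K| != p | (J' :|: K' != J :|: K)%SET].
  by rewrite Q0// !mulr0.
rewrite !negb_or !negbK => /and3P[/eqP Jp /eqP Kp /eqP e]; congr (_ * _).
under eq_bigr do rewrite (exch_fiber _ JK JK' e).
pose A := (J :|: K)%SET; rewrite -/A -natr_sum.
have -> : (\sum_S (S :&: A == (J :\: J') :|: (K :&: J'))%SET)%N =
    #|[set S : {set 'I_n} | S :&: A == (J :\: J') :|: (K :&: J')]%SET|.
  by rewrite -sum1dep_card [RHS]big_mkcond; apply: eq_bigr => S _; case: (_ == _).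
rewrite card_setI_fiber; last first.
  by apply/fintype.subsetP => i; rewrite !inE => /orP[/andP[_ ->]//|/andP[-> _]]; rewrite orbT.
have cA : (#|A| = 2 * p)%N.
  by apply/eqP; rewrite mul2n -addnn -{1}Jp -Kp eq_sym; have := leq_card_setU J K; rewrite JK => /leqifP; rewrite eq_sym.
have := cardsC A; rewrite cA card_ord => en; rewrite -[in RHS]en.
by rewrite natrX exprD exprM (_ : 2 ^+ 2 = 4) -?natrX// mulrAC divff ?mul1r// expf_neq0.
Qed.

(* Sum [eps S J K] over all [S]: disjoint [J] and [K] recover the second moment
   of [U], and intersecting pairs are bounded by the maximal influence. *)
Lemma upart_ge (rho2 : R) : E1 (fun x => W x ^+ 2) = 1 ->
  (forall i, \sum_(J : {set 'I_n} | i \in J) v J <= rho2) ->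
  2 - 4 ^+ p * p%:R * rho2 <= E1 (fun x => U x ^+ 2).
Proof.
move=> W1 vrho.
have s1 : \sum_J v J = 1 by exact: (sum_var mu_rect g_L4 g_free g_degen g_order W1).
have nS : 0 < 2 ^+ n :> R by exact: exprn_gt0.
have p4 : 0 < 4 ^+ p :> R by exact: exprn_gt0.
(* As [#|J :|: K| <= 2p], at least a fraction [1 / 4 ^ p] of all [S] contain the union and as large
   a fraction avoid it; the products of variances sum to 1. *)
have lo : 2 ^+ n * (2 / 4 ^+ p) <= \sum_(S : {set 'I_n}) \sum_(J : {set 'I_n}) \sum_(K : {set 'I_n}) eps S J K.
  apply: le_trans (ler_sum _ (fun S _ => sum_exch_moment_ge mu_rect p_gt0 g_L4 g_free g_degen g_order S)).
  have ec (c : R) : c = \sum_(J : {set 'I_n}) \sum_(K : {set 'I_n}) v J * v K * c.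
    rewrite -[LHS]mul1r -[X in X * _]mul1r -{1}s1 -s1 !mulr_suml; apply: eq_bigr => J _.
    by rewrite mulr_sumr mulr_suml.
  rewrite exchange_big/= [leLHS]ec; apply: ler_sum => J _.
  rewrite exchange_big/=; apply: ler_sum => K _.
  rewrite -mulr_suml [leRHS]mulrC; have [Jp|Jp] := eqVneq #|J| p; last by rewrite v0// !mul0r.
  have [Kp|Kp] := eqVneq #|K| p; last by rewrite [v K]v0// !(mulr0, mul0r).
  apply: ler_wpM2l; first by apply: mulr_ge0; exact: gvar_ge0.
  pose A := (J :|: K)%SET; rewrite -/A big_split/= [X in _ <= _ + X](reindex_inj (inv_inj (@finset.setCK _)))/=.
  under [X in _ <= _ + X]eq_bigr do rewrite finset.setCK.
  have -> : \sum_(S : {set 'I_n}) (A \subset S)%:R = (2 ^ #|~: A|)%:R :> R.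
    rewrite -natr_sum; congr (_%:R); rewrite -(@card_setI_fiber _ A A)// -sum1dep_card [RHS]big_mkcond.
    apply: eq_bigr => S _; rewrite (sameP finset.setIidPr eqP).
    by case: (_ == _).
  suff : 2 ^+ n <= 4 ^+ p * 2 ^+ #|~: A| :> R.
    by rewrite natrX => h; rewrite mulrA ler_pdivrMr//; move: h; set a := 2 ^+ n; set b := 4 ^+ p; set c := 2 ^+ _; lra.
  have := cardsC A; rewrite card_ord => nA.
  rewrite (_ : 4 = 2 ^+ 2 :> R); last by rewrite -natrX.
  rewrite -exprM -exprD; apply: ler_weXn2l; first by rewrite (ler1n R 2).
  rewrite -[leqLHS]nA leq_add2r mul2n -addnn -{1}Jp -Kp; exact: leq_card_setU.
have hi : \sum_(S : {set 'I_n}) \sum_(J : {set 'I_n}) \sum_(K : {set 'I_n}) eps S J K <=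
    2 ^+ n / 4 ^+ p * E1 (fun x => U x ^+ 2) + 2 ^+ n * (p%:R * rho2).
  rewrite -sum_exch_moment_disjoint.
  have -> : 2 ^+ n * (p%:R * rho2) = \sum_(S : {set 'I_n}) p%:R * rho2.
    have cS : #|{: {set 'I_n}}| = (2 ^ n)%N.
      by rewrite -cardsT -powersetT card_powerset cardsT card_ord.
    rewrite sumr_const cS.
    by rewrite -[RHS]mulr_natl natrX.
  rewrite -big_split/=; apply: ler_sum => S _.
  rewrite [leRHS]addrC -lerBlDr; apply: le_trans (sum_norm_exch_moment_le S W1 vrho); rewrite lerBlDr addrC.
  rewrite -big_split/=; apply: ler_sum => J _.
  rewrite (bigID (fun K : {set 'I_n} => [disjoint J & K]%B))/= lerD2l.
  by apply: ler_sum => K _; exact: ler_norm.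
have := le_trans lo hi.
rewrite -[2 ^+ n / _ * _]mulrA -mulrDr ler_pM2l// ler_pdivrMr// mulrDl mulrAC mulVf ?mul1r ?gt_eqF//.
by rewrite -mulrA mulrC -lerBlDr; lra.
Qed.

End upart_bound.

(** * The normal approximation on a product space *)

Section stein_bound.
Context {R : realType} {n : nat} {dE : 'I_n -> measure_display}
  {E : forall i, measurableType (dE i)}.
Local Notation T := (@cspace n dE E).
Implicit Types (S J K : {set 'I_n}) (i j : 'I_n) (x y : T) (z : T * T).
Variable mu : probability T R.
Hypothesis mu_rect : exists m : forall i, set (E i) -> \bar R,
  forall B : forall i, set (E i), (forall i, measurable (B i)) ->
  mu (rect B) = (\prod_i m i (B i))%E.
Local Notation M := (mu \x mu)%E.
Local Notation E1 := (Ex mu).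
Local Notation E2 := (Ex M).
Variables (p : nat) (g : {set 'I_n} -> T -> R).
Hypothesis p_gt0 : (0 < p)%N.
Hypothesis g_L4 : forall J, L4 mu (g J).
Hypothesis g_free : forall J S x y, [disjoint S & J]%B -> g J (mix S x y) = g J x.
Hypothesis g_degen : forall J i, i \in J -> degen mu i (g J).
Hypothesis g_order : forall J, #|J| != p -> g J = fun=> 0.
Local Notation W := (ustat g).
Let W_L4 : L4 mu W := ustat_L4 g_L4.
Let L2x S (k : T -> R) : L2 mu k -> L2 M (fun z => k (xm S z)) :=
  @L2_xm _ _ _ _ _ mu_rect S k.
Let L2f (k : T -> R) : L2 mu k -> L2 M (fun z => k z.1).
Proof. exact: (mpres_L2 (mpres_fst mu mu)). Qed.
Local Notation v := (gvar mu g).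
Local Notation D := (incr g).
Variable t : R.
Local Notation s := (stein t).
Local Notation ds := (dstein t).
Local Notation ms := (mstein t).

Let mW : measurable_fun setT W := L4_meas W_L4.
Let bW (f : R -> R) : measurable_fun setT f -> (exists c, forall w, `|f w| <= c) ->
  L2 mu (fun x => f (W x)).
Proof.
move=> mf [c fc]; apply: (L2_bdd mu (c := c)) => //; exact: (measurableT_comp mf).
Qed.

Let is_ : L2 mu (fun x => s (W x)).
Proof. by apply: bW; [exact: measurable_stein|eexists; exact: stein_bdd]. Qed.
Let ids : L2 mu (fun x => ds (W x)).
Proof. by apply: bW; [exact: measurable_dstein|eexists; exact: dstein_bdd]. Qed.
Let ims : L2 mu (fun x => ms (W x)).
Proof. by apply: bW; [exact: measurable_mstein|eexists; exact: mstein_bdd]. Qed.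

Lemma E2_antisym i (f : T -> R) (h : R -> R) : L2 mu f -> L2 M (fun z => h (D i z)) ->
  (forall r, h (- r) = - h r) ->
  2 * E2 (fun z => f z.1 * h (D i z)) =
  E2 (fun z => h (D i z) * (f z.1 - f (xm [set i] z))).
Proof.
move=> jf ih hN; have i1 := L1M (L2f jf) ih; have i2 := L1M (L2x [set i]%SET jf) ih.
transitivity (E2 (fun z => f z.1 * h (D i z)) - E2 (fun z => f (xm [set i] z) * h (D i z))).
  rewrite -[X in _ - X](E2_mswap mu_rect [set i]%SET); last exact: L1_meas i2.
  rewrite [X in _ = _ - X](_ : _ = - E2 (fun z => f z.1 * h (D i z))); first by ring.
  rewrite -mulN1r -ExZ//; apply: eq_Ex => z.
  by rewrite xm_mswap symdd xm0 incr_mswapN hN mulrN mulN1r.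
by rewrite -ExB//; apply: eq_Ex => z; ring.
Qed.

Lemma E2_sym i (f : T -> R) (h : R -> R) : L2 mu f -> L2 M (fun z => h (D i z)) ->
  (forall r, h (- r) = h r) ->
  2 * E2 (fun z => f z.1 * h (D i z)) =
  E2 (fun z => h (D i z) * (f z.1 + f (xm [set i] z))).
Proof.
move=> jf ih hN; have i1 := L1M (L2f jf) ih; have i2 := L1M (L2x [set i]%SET jf) ih.
transitivity (E2 (fun z => f z.1 * h (D i z)) + E2 (fun z => f (xm [set i] z) * h (D i z))).
  rewrite -[X in _ + X](E2_mswap mu_rect [set i]%SET); last exact: L1_meas i2.
  rewrite [X in _ = _ + X](_ : _ = E2 (fun z => f z.1 * h (D i z))); first by ring.
  by apply: eq_Ex => z; rewrite xm_mswap symdd xm0 incr_mswapN hN.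
by rewrite -ExD//; apply: eq_Ex => z; ring.
Qed.

Let m4 := E1 (fun x => W x ^+ 4).

(** Exchanging coordinate [i] negates [D i], so each expectation can be rewritten through both
    members of the pair: [s] and [ms] appear as differences, [ds] as a sum. This is the trapezoidal
    estimate, applied pointwise. *)
Lemma stein_pair_bound :
  `|E1 (fun x => s (W x) * W x) -
    (2 * p%:R)^-1 * \sum_i E2 (fun z => ds (W z.1) * D i z ^+ 2)| <=
  p%:R^-1 * Num.sqrt (2 * p%:R * \sum_i E2 (fun z => D i z ^+ 4)).
Proof.
have iD i : L4 M (D i) by exact: incr_L4.
have iD1 i : L2 M (fun z => D i z) by exact: L4_L2.
have iD2 i : L2 M (fun z => D i z ^+ 2) by exact: L4X2.
have iDs i : L2 M (fun z => sgsq (D i z)) by exact: L2_sgsq.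
have p0 : 0 < p%:R :> R by rewrite ltr0n.
have key i : `|4 * E2 (fun z => s (W z.1) * D i z) - 2 * E2 (fun z => ds (W z.1) * D i z ^+ 2)| <=
    2 * E2 (fun z => ms (W z.1) * sgsq (D i z)).
  have -> : 4 * E2 (fun z => s (W z.1) * D i z) =
      2 * E2 (fun z => D i z * (s (W z.1) - s (W (xm [set i] z)))).
    by rewrite -(E2_antisym (f := fun x => s (W x)) (h := id))// mulrA; congr (_ * _); ring.
  rewrite (E2_sym (f := fun x => ds (W x)) (h := fun r => r ^+ 2))//; last by move=> r; rewrite sqrrN.
  rewrite (E2_antisym (f := fun x => ms (W x)) (h := sgsq))//; last exact: sgsqN.
  have j1 : L1 M (fun z => D i z * (s (W z.1) - s (W (xm [set i] z)))).
    by apply: L1M => //; apply: L2B; [exact: (L2f is_)|exact: (L2x _ is_)].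
  have j2 : L1 M (fun z => D i z ^+ 2 * (ds (W z.1) + ds (W (xm [set i] z)))).
    by apply: L1M => //; apply: L2D; [exact: (L2f ids)|exact: (L2x _ ids)].
  have j3 : L1 M (fun z => sgsq (D i z) * (ms (W z.1) - ms (W (xm [set i] z)))).
    by apply: L1M => //; apply: L2B; [exact: (L2f ims)|exact: (L2x _ ims)].
  rewrite -ExZ// -ExB//; last exact: L1Z.
  apply: norm_Ex_le => //; first by apply: L1B => //; exact: L1Z.
  move=> z; have := stein_trapezoid t (W z.1) (W (xm [set i] z)).
  rewrite -[_ - W _]/(D i z) -[_ * `|_|]/(sgsq (D i z)); congr (`| _ | <= _); ring.
have eW := sum_E2_incr mu_rect g_L4 g_free g_degen g_order (L43_L2 is_) (L43_L2 (L2f is_)).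
set a := E1 _; set b := \sum_i _.
have h1 : `|4 * (p%:R * a) - 2 * b| <= 2 * (2 * Num.sqrt (2 * p%:R * \sum_i E2 (fun z => D i z ^+ 4))).
  apply: (@le_trans _ _ (2 * \sum_i E2 (fun z => ms (W z.1) * sgsq (D i z)))).
    rewrite -eW /b !mulr_sumr -sumrB; apply: le_trans (ler_norm_sum _ _ _) _.
    by apply: ler_sum => i _; exact: key.
  rewrite ler_pM2l//; apply: le_trans (ler_norm _) _.
  apply: (sgsq_incr_bound mu_rect p_gt0 g_L4 g_free g_degen g_order (b := fun x => ms (W x))) => //.
    exact: L2_meas ims.
  by move=> x; exact: mstein_bdd.
have -> : a - (2 * p%:R)^-1 * b = (4 * p%:R)^-1 * (4 * (p%:R * a) - 2 * b).
  by field; rewrite gt_eqF.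
rewrite normrM gtr0_norm ?invr_gt0 ?mulr_gt0//.
apply: le_trans (ler_wpM2l _ h1) _; first by rewrite invr_ge0 mulr_ge0// ltW.
rewrite le_eqVlt; apply/orP; left; apply/eqP; set q := Num.sqrt _; field.
by rewrite gt_eqF.
Qed.

Hypothesis W_sqr1 : E1 (fun x => W x ^+ 2) = 1.

Lemma kolmogorov_ustat (rho2 : R) :
  (forall i, \sum_(J : {set 'I_n} | i \in J) v J <= rho2) -> 0 <= rho2 ->
  `|E1 (fun x => (W x <= t)%R%:R) - Phi t| <=
  6 * Num.sqrt `|m4 - 3| + 7 * Num.sqrt (4 ^+ p * p%:R * rho2).
Proof.
move=> vrho rho0; have p0 : 0 < p%:R :> R by rewrite ltr0n.
have uge := upart_ge mu_rect p_gt0 g_L4 g_free g_degen g_order W_sqr1 vrho.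
set u := E1 _ in uge; set r := _ * rho2; set r' := _ * rho2 in uge.
have rr : r' = r by []. rewrite rr {r' rr} in uge.
have r0 : 0 <= r by apply: mulr_ge0 => //; apply: mulr_ge0 => //; exact: exprn_ge0.
(* The Stein equation, which is built into the definition of [dstein]. *)
have -> : E1 (fun x => (W x <= t)%R%:R) - Phi t =
    E1 (fun x => ds (W x)) - E1 (fun x => s (W x) * W x).
  have i1 := L2_L1 ids; have i2 := L1M is_ (L4_L2 W_L4).
  rewrite -ExB// -[X in _ - X](Ex_cst mu) -ExB; last exact: L1_cst.
  - by apply: eq_Ex => x; rewrite /dstein; ring.
  - have := L1D (L1B i1 i2) (L1_cst mu (Phi t)); congr (L1 mu _); apply/funext => x.
    by rewrite /dstein; ring.
have h1 := incr_sqr_bound mu_rect p_gt0 g_L4 g_free g_degen g_order W_sqr1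
  (ler0n R 2) (L2_meas ids) (fun x => dstein_bdd t (W x)).
have h2 := stein_pair_bound.
have h3 := sum_E2_incr4_le mu_rect g_L4 g_free g_degen g_order.
rewrite -/m4 -/u in h1 h3; set b := _ * \sum_i _ in h1; rewrite -/b in h2.
set q := \sum_i _ in h2; rewrite -/q in h3.
set d := `|m4 - 3|; have dm : m4 - 3 <= d by exact: ler_norm.
pose x := Num.sqrt d; pose y := Num.sqrt r.
have x0 : 0 <= x by exact: sqrtr_ge0.
have y0 : 0 <= y by exact: sqrtr_ge0.
have xE : x ^+ 2 = d by rewrite /x sqr_sqrtr /d ?normr_ge0.
have yE : y ^+ 2 = r by rewrite /y sqr_sqrtr.
have sq (c e : R) : 0 <= e -> c <= e ^+ 2 -> Num.sqrt c <= e.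
  by move=> e0 ce; rewrite -(ger0_norm e0) -sqrtr_sqr ler_wsqrtr.
have xy := mulr_ge0 x0 y0.
(* The factor 2 bounds [dstein]; by the lower bound on [u], [m4 - u - 1 <= d + r <= (x + y) ^ 2]. *)
have h1' : 2 * Num.sqrt (m4 - u - 1) <= 2 * (x + y).
  rewrite ler_pM2l//; apply: sq; first exact: addr_ge0.
  by rewrite sqrrD xE yE; lra.
(* After division by [p ^ 2] the radicand is at most [16 m4 - 24 u <= 16 d + 24 r], below
   [(4 x + 5 y) ^ 2]. Together with the previous bound this gives 6 and 7. *)
have h2' : p%:R^-1 * Num.sqrt (2 * p%:R * q) <= 4 * x + 5 * y.
  rewrite mulrC ler_pdivrMr//; apply: sq.
    by apply: mulr_ge0; [lra|exact: ltW].
  apply: (@le_trans _ _ (2 * p%:R * (p%:R * (8 * m4 - 12 * u)))).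
    by rewrite ler_wpM2l// mulr_ge0// ltW.
  rewrite exprMn mulrC mulrAC [leLHS](_ : _ = p%:R ^+ 2 * (16 * m4 - 24 * u)); last by ring.
  rewrite [leRHS]mulrC ler_pM2l ?exprn_gt0//.
  have -> : (4 * x + 5 * y) ^+ 2 = 16 * d + 25 * r + 40 * (x * y) by rewrite -xE -yE; ring.
  by lra.
have -> : E1 (fun x => ds (W x)) - E1 (fun x => s (W x) * W x) =
    (E1 (fun x => ds (W x)) - b) - (E1 (fun x => s (W x) * W x) - b) by ring.
apply: le_trans (ler_normB _ _) _.
by have := lerD (le_trans h1 h1') (le_trans h2 h2'); rewrite -/x -/y; lra.
Qed.

End stein_bound.

(** * Transfer to the coordinate space *)

Section doob_dynkin.
Context {R : realType} {n : nat} {dE : 'I_n -> measure_display}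
  {E : forall i, measurableType (dE i)} {T0 : Type}.
Local Notation T := (@cspace n dE E).
Implicit Types (S J K : {set 'I_n}) (i j : 'I_n) (x y : T) (w : T0).
Variable X : forall i, T0 -> E i.

Definition joint w : T := fun i => X i w.

Definition only_depends_on (U : Type) J (k : T -> U) :=
  forall S x y, [disjoint S & J]%B -> k (mix S x y) = k x.

(** The events with such a factor form a sigma-field containing the generators; the invariance of
    the factor at every point passes through complements and countable unions. *)
Lemma sigma_gen_factor J (A : set T0) : sigma_gen X J A ->
  exists B : set T, [/\ measurable B, only_depends_on J B & A = joint @^-1` B].
Proof.
move: A; apply: smallest_sub; first split.
- by exists set0; split; [exact: measurable0|move=> *|rewrite preimage_set0].
- move=> A [B [mB iB ->]]; exists (~` B); split; first exact: measurableC.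
  + by move=> S x y SJ; rewrite /setC /= iB.
  + by rewrite setTD preimage_setC.
- move=> A /choice[B hB]; exists (\bigcup_k B k); split.
  + by apply: bigcupT_measurable => k; have [] := hB k.
  + move=> S x y SJ; apply/propext; split => -[k _ Bk]; exists k => //;
    by have [_ iB _] := hB k; move: Bk; rewrite iB.
  + by rewrite preimage_bigcup; apply: eq_bigcupr => k _; have [_ _] := hB k.
move=> A [i /= iJ [C mC <-]]; exists ((fun x : T => x i) @^-1` C); split.
- by rewrite -[_ @^-1` _]setTI; exact: measurable_coord.
- move=> S x y /disjointFl /(_ iJ) iS.
  by rewrite /preimage /= mixE iS.
- by rewrite setTI.
Qed.

(* [g] is the largest function with [Y <= q] wherever the factor of the event
   [Y <= q] holds, [q] rational. *)
Lemma doob_dynkin J (Y : T0 -> R) : sigma_measurable (sigma_gen X J) Y ->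
  exists g : T -> R, [/\ measurable_fun setT g, only_depends_on J g &
    forall w, Y w = g (joint w)].
Proof.
move=> mY.
have /choice[B hB] : forall q : rat, exists B : set T,
    [/\ measurable B, only_depends_on J B & Y @^-1` `]-oo, ratr q] = joint @^-1` B].
  by move=> q; apply: sigma_gen_factor; exact: mY.
pose h x : \bar R := ereal_inf [set (ratr q : R)%:E | q in [set q | B q x]].
have mh : measurable_fun setT h.
  apply: (measurability _ (ErealGenInftyO.measurableE R)) => _ /= -[_ [r ->] <-].
  rewrite setTI (_ : h @^-1` _ = \bigcup_(q in [set q : rat | ratr q < r]) B q).
    rewrite bigcup_mkcond; apply: bigcupT_measurable_rat => q.
    by case: ifP => // _; have [] := hB q.
  apply/seteqP; split => x /=.
    rewrite in_itv/= => /ereal_inf_lt[_ [q Bq <-]]; rewrite lte_fin => qr.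
    by exists q.
  move=> [q /= qr Bq]; rewrite in_itv/=; apply: le_lt_trans (_ : (ratr q : R)%:E < _)%E.
    by apply: ereal_inf_lbound; exists q.
  by rewrite lte_fin.
(* Off the range of [joint] the infimum may be infinite, and [fine] then yields 0; on the range it
   equals [Y]. *)
exists (fine \o h); split.
- exact: measurableT_comp.
- move=> S x y SJ; rewrite /= /h; congr (fine (ereal_inf _)).
  by apply/seteqP; split => _ [q /= Bq <-]; exists q => //=; have [_ iB _] := hB q;
    move: Bq; rewrite iB.
move=> w; rewrite /= (_ : h (joint w) = (Y w)%:E)//.
have BE q : B q (joint w) = (Y w <= ratr q) :> Prop.
  have [_ _ e] := hB q.
  by rewrite -[LHS]/((joint @^-1` B q) w) -e /preimage /= in_itv.
apply/eqP; rewrite eq_le; apply/andP; split.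
  apply/lee_addgt0Pr => e e0.
  have [q] : exists q : rat, ratr q \in `]Y w, Y w + e[ by apply: rat_in_itvoo; rewrite ltrDl.
  rewrite in_itv/= => /andP[/ltW Yq /ltW qY].
  apply: le_trans (_ : (ratr q : R)%:E <= _)%E; last by rewrite -EFinD lee_fin.
  by apply: ereal_inf_lbound; exists q => //=; rewrite BE.
apply: le_ereal_inf_tmp => _ [q /= Bq <-].
by rewrite lee_fin -BE.
Qed.

(** Once coordinate [i] is frozen at [x0], the joint map is measurable for the other variables. If
    [A] ignores [i], this places its preimage in their sigma-field. *)
Lemma sigma_gen_mix i (x0 : T) (A : set T) : measurable A ->
  sigma_gen X (~: [set i]) ((fun w => mix [set i] (joint w) x0) @^-1` A).
Proof.
set G := sigma_gen _ _; set phi := (fun w => _).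
have [G0 GC GU] : sigma_algebra setT G by exact: smallest_sigma_algebra.
have GT : G setT by rewrite -[setT]setD0; exact: GC.
move: A; apply: smallest_sub; first split.
- by rewrite /= preimage_set0.
- by move=> A GA /=; rewrite setTD preimage_setC -setTD; exact: GC.
- by move=> A GA /=; rewrite preimage_bigcup; exact: GU.
move=> _ [B mB <-] /=.
(* A finite intersection is turned into a countable union of complements, indexed through [pickle]
   and padded with empty sets. *)
have GI (I : finType) (F : I -> set T0) : (forall k, G (F k)) -> G (\bigcap_k F k).
  move=> GF; rewrite -[\bigcap_k _]setCK setC_bigcap -setTD; apply: (GC).
  rewrite (_ : \bigcup_k _ = \bigcup_m (if unpickle m is Some k then ~` F k else set0)).
    apply: GU => m; case: (unpickle m) => [k|//]; rewrite -setTD; exact: GC.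
  apply/seteqP; split => w [k _ Fk].
    by exists (pickle k) => //; rewrite pickleK.
  by move: Fk; case: (unpickle k) => // l Fl; exists l.
rewrite (_ : _ @^-1` _ = \bigcap_j [set w | B j (phi w j)]).
  apply: GI => j; have [->|ji] := eqVneq j i.
    rewrite (_ : [set w | _] = if `[< B i (x0 i) >] then setT else set0); first by case: ifP.
    apply/seteqP; rewrite /phi; split => w /=; rewrite mixE finset.set11.
      by move=> /asboolP ->.
    by case: asboolP.
  apply: sub_sigma_algebra; exists j; first by rewrite /= !inE.
  exists (B j) => //; rewrite setTI; apply/seteqP; split => w /=;
    by rewrite /phi mixE inE (negbTE ji).
apply/seteqP; split => w h.
  by move=> j _; exact: h.
by move=> j; exact: h.
Qed.

End doob_dynkin.

(** * Fourth moments by truncation *)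

Section truncation.
Context {d : measure_display} {T : measurableType d} {R : realType}.
Variable P : probability T R.
Local Notation E := (Ex P).

Definition trunc (c : R) (F : T -> R) x := (`|F x| <= c)%R%:R * F x.

Lemma measurable_trunc c F : measurable_fun setT F -> measurable_fun setT (trunc c F).
Proof.
move=> mF; pose t (r : R) := (`|r| <= c)%R%:R : R.
have mt : measurable_fun setT t.
  rewrite (_ : t = \1_(`[- c, c]%classic)); first exact: measurable_indic (measurable_itv _).
  by apply/funext => r; rewrite /t indicE mem_setE in_itv/= ler_norml.
by apply: measurable_funM => //; exact: (measurableT_comp mt mF).
Qed.

Lemma norm_trunc_le c F x : 0 <= c -> `|trunc c F x| <= c.
Proof. by move=> c0; rewrite /trunc; have [|_] := boolP (`|F x| <= c); rewrite ?mul1r// mul0r normr0. Qed.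

(** Fatou: at each point the truncations are eventually equal to [F]. *)
Lemma L4_of_trunc (F : T -> R) (m : R) : measurable_fun setT F ->
  (forall k : nat, E (fun x => trunc k%:R F x ^+ 4) <= m) -> L4 P F.
Proof.
move=> mF Em; split=> //; apply/integrableP; split.
  by apply/measurable_EFinP; exact: measurable_funX.
pose G (k : nat) x := (trunc k%:R F x ^+ 4)%:E.
have mG k : measurable_fun setT (G k).
  by apply/measurable_EFinP; apply: measurable_funX; exact: measurable_trunc.
have G0 k x : setT x -> (0 <= G k x)%E by move=> _; rewrite lee_fin exprn_even_ge0.
have EG k : (\int[P]_x G k x <= m%:E)%E.
  rewrite Ex_EFin ?lee_fin//; have := L2_bdd P (c := k%:R ^+ 4) (F := fun x => trunc k%:R F x ^+ 4).
  move=> h; apply: L2_L1; apply: h; first by apply: measurable_funX; exact: measurable_trunc.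
  by move=> x; rewrite normrX lerXn2r ?nnegrE ?norm_trunc_le.
have := fatou P measurableT mG G0.
have -> : (fun x => limn_einf (G^~ x)) = fun x => (F x ^+ 4)%:E.
  apply/funext => x; apply: (cvg_limn_einf_sup _).1.
  apply: cvg_EFin; first by near=> k.
  apply: cvg_near_cst; near=> k; rewrite /= /trunc.
  by have -> : `|F x| <= k%:R; [near: k; exact: nbhs_infty_ger|rewrite mul1r].
move=> h; rewrite (eq_integral (fun x => (F x ^+ 4)%:E)); last first.
  by move=> x _; rewrite gee0_abs// lee_fin exprn_even_ge0.
apply: le_lt_trans h _; apply: le_lt_trans (ltry m).
rewrite limn_einf_lim; apply: lime_le; first exact: is_cvg_einfs.
near=> k; apply: le_trans (EG k); apply: ereal_inf_lbound; exists k => //=.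
Unshelve. all: by end_near. Qed.

End truncation.

(** * Degeneracy from test events, and integrability of the kernels *)

Section kernels.
Context {R : realType} {n : nat} {dE : 'I_n -> measure_display}
  {E : forall i, measurableType (dE i)}.
Local Notation T := (@cspace n dE E).
Implicit Types (S J K : {set 'I_n}) (i j : 'I_n) (x y : T) (z : T * T).
Variable mu : probability T R.
Hypothesis mu_rect : exists m : forall i, set (E i) -> \bar R,
  forall B : forall i, set (E i), (forall i, measurable (B i)) ->
  mu (rect B) = (\prod_i m i (B i))%E.
Local Notation M := (mu \x mu)%E.
Local Notation E1 := (Ex mu).
Local Notation E2 := (Ex M).

(** The average [q] of [k] over coordinate [i] ignores that coordinate, so the events [q > 0] and
    [q < 0] are admissible tests; their difference gives E|q| = 0. *)
Lemma degenP i (k : T -> R) : L1 mu k ->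
  (forall A : set T, measurable A -> (forall x y, A (mix [set i] x y) = A x) ->
    E1 (fun x => \1_A x * k x) = 0) -> degen mu i k.
Proof.
move=> ik kA; have ik2 := L1_xm mu_rect [set i]%SET ik.
pose q x := E1 (fun y => k (mix [set i] x y)).
have mq : measurable_fun setT q by exact: (measurable_Ex1 ik2).
have iq : L1 mu q by exact: (L1_Ex1 ik2).
have fq x y : q (mix [set i] x y) = q x.
  apply: eq_Ex => w; congr k; apply: cspaceP => j; rewrite !mixE.
  by case: (j \in _).
pose A := q @^-1` `]0, +oo[; pose B := q @^-1` `]-oo, 0[.
have mA : measurable A by rewrite -[A]setTI; exact: mq.
have mB : measurable B by rewrite -[B]setTI; exact: mq.
have AE x : (x \in A) = (0 < q x).
  by apply/idP/idP; rewrite inE /A /preimage /= in_itv/= andbT.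
have BE x : (x \in B) = (q x < 0).
  by apply/idP/idP; rewrite inE /B /preimage /= in_itv/=.
pose h x : R := \1_A x - \1_B x.
have mh : measurable_fun setT h by apply: measurable_funB; exact: measurable_indic.
have hb x : `|h x| <= 2.
  by rewrite /h !indicE; case: (_ \in _); case: (_ \in _); rewrite /= ?subr0 ?sub0r ?subrr ?normrN ?normr1 ?normr0//; lra.
have hq x : h x * q x = `|q x|.
  rewrite /h !indicE AE BE.
  by have [q0|q0|->] := ltgtP (q x) 0; rewrite ?mulr0 ?normr0//=;
    [rewrite ltr0_norm//; ring|rewrite gtr0_norm//; ring].
have fh x y : h (mix [set i] x y) = h x by rewrite /h !indicE !AE !BE fq.
have ihk : L1 mu (fun x => h x * k x) by exact: (L1_bddM mh hb).
have Eq : E1 (fun x => `|q x|) = 0.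
  under eq_Ex do rewrite -hq.
  rewrite (Ex_cmean_mul mh (u := fun z => k (xm [set i] z)))//; last first.
    have := L1_xm mu_rect [set i]%SET ihk; congr (L1 M _); apply/funext => z.
    by rewrite {1}/xm fh.
  transitivity (E2 (fun z => (fun x => h x * k x) (xm [set i] z))).
    by apply: eq_Ex => z; rewrite {2}/xm fh.
  rewrite (E2_xm mu_rect [set i]%SET (k := fun x => h x * k x)); last exact: L1_meas ihk.
  have i1 (C : set T) : measurable C -> L1 mu (fun x => \1_C x * k x).
    move=> mC; apply: (L1_bddM (c := 1) (measurable_indic mC) _ ik) => x.
    by rewrite indicE; case: (_ \in _); rewrite ?normr1 ?normr0.
  rewrite (eq_Ex mu (fun x => mulrBl _ _ _)) ExB ?kA ?subrr//; [| |exact: i1|exact: i1].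
  - by move=> x y; rewrite /B /preimage /= fq.
  - by move=> x y; rewrite /A /preimage /= fq.
have := Ex_eq0_ae (L1_abs iq) (fun x => normr_ge0 _) Eq.
by apply: filterS => x /eqP; rewrite normr_eq0 => /eqP.
Qed.

Variables (p : nat) (g : {set 'I_n} -> T -> R).
Hypothesis g_L1 : forall J, L1 mu (g J).
Hypothesis g_free : forall J, only_depends_on J (g J).
Hypothesis g_degen : forall J i, i \in J -> degen mu i (g J).
Hypothesis g_order : forall J, #|J| != p -> g J = fun=> 0.

(* Since [g J] is a conditional expectation of [ustat g], Jensen's inequality
   bounds its fourth moment; here through Young's inequality tested against
   truncations. *)
Lemma g_L4_of_ustat : L4 mu (ustat g) -> forall J, L4 mu (g J).
Proof.
move=> iW J; have mJ := L1_meas (g_L1 J).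
have [Jp|Jp] := eqVneq #|J| p; last by rewrite (g_order Jp); exact: L4_cst.
pose m := E1 (fun x => ustat g x ^+ 4).
apply: (@L4_of_trunc _ _ _ mu (g J) m) => // k; set a := trunc k%:R (g J).
have ma : measurable_fun setT a by exact: measurable_trunc.
have ba x : `|a x| <= k%:R by exact: norm_trunc_le.
have ba3 x : `|a x ^+ 3| <= k%:R ^+ 3 by rewrite normrX lerXn2r ?nnegrE.
have ma3 : measurable_fun setT (fun x => a x ^+ 3) by exact: measurable_funX.
have ia4 : L1 mu (fun x => a x ^+ 4).
  apply/L2_L1/(L2_bdd mu (c := k%:R ^+ 4)); first exact: measurable_funX.
  by move=> x; rewrite normrX lerXn2r ?nnegrE.
have iag K : L1 mu (fun x => a x ^+ 3 * g K x) by exact: (L1_bddM ma3 ba3).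
have iaW : L1 mu (fun x => a x ^+ 3 * ustat g x) by exact: (L1_bddM ma3 ba3 (L4_L1 iW)).
(* The truncation depends on [J] only, hence its cube is orthogonal to every other kernel of order
   [p]. *)
have e1 : E1 (fun x => a x ^+ 3 * ustat g x) = E1 (fun x => a x ^+ 4).
  rewrite (eq_Ex mu (fun x => mulr_sumr _ _ _ _)) Ex_sum//.
  rewrite (bigD1 J)//= big1 ?addr0.
    apply: eq_Ex => x; rewrite /a /trunc; case: (_ <= _) => /=; last by ring.
    by ring.
  move=> K KJ; have [Kp|Kp] := eqVneq #|K| p; last first.
    by rewrite (eq_Ex mu (G := fun=> 0)) ?Ex_cst// => x; rewrite (g_order Kp) mulr0.
  have : ~~ (K \subset J) by move: KJ; rewrite finset.eqEcard Kp Jp leqnn andbT.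
  move=> /subsetPn[i iK iJ]; apply: (degen_E1 mu_rect (i := i)) => //.
    exact: g_degen.
  by move=> x y; rewrite /a /trunc g_free// disjoints1.
have : E1 (fun x => a x ^+ 3 * ustat g x) <=
    E1 (fun x => 3 / 4 * a x ^+ 4 + 1 / 4 * ustat g x ^+ 4).
  apply: le_Ex => //; first by apply: L1D; apply: L1Z => //; exact: iW.2.
  move=> x; move: (a x) (ustat g x) => b c.
  (* [3 b^4 + c^4 - 4 b^3 c = (b - c)^2 (2 b^2 + (b + c)^2)]. *)
  have := mulr_ge0 (sqr_ge0 (b - c)) (addr_ge0 (mulr_ge0 (ler0n R 2) (sqr_ge0 b)) (sqr_ge0 (b + c))).
  nra.
rewrite ExD; [|exact: L1Z|by apply: L1Z; exact: iW.2].
by rewrite !ExZ ?e1; [|exact: iW.2|exact: ia4]; rewrite -/m; move: (E1 _) m => b c; lra.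
Qed.

End kernels.

(** * The joint law on the coordinate space *)

Section joint_law.
Context {R : realType} {d : measure_display} {T0 : measurableType d}
  {P : probability T0 R} {n : nat} {dE : 'I_n -> measure_display}
  {E : forall i, measurableType (dE i)}.
Variable X : forall i, {RV P >-> E i}.
Local Notation T := (@cspace n dE E).

Definition joint_rv : T0 -> T := joint (fun i => X i).

Lemma measurable_joint : measurable_fun setT joint_rv.
Proof. by apply: measurable_to_cspace => i; exact: measurable_funP. Qed.

HB.instance Definition _ := isMeasurableFun.Build _ _ _ _ joint_rv measurable_joint.

Definition joint_law : probability T R := distribution P joint_rv.

Lemma mpres_joint : mpres P joint_law joint_rv.
Proof. by split; [exact: measurable_joint|]. Qed.

Lemma joint_law_rect : independent_rvs X ->
  exists m : forall i, set (E i) -> \bar R,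
  forall B : forall i, set (E i), (forall i, measurable (B i)) ->
  joint_law (rect B) = (\prod_i m i (B i))%E.
Proof.
move=> iX; exists (fun i B => P (X i @^-1` B)) => B mB.
have := iX finset.setT B (fun i _ => mB i).
rewrite (eq_bigl (fun=> true)); last by move=> i; rewrite inE.
move=> <-; congr (P _); apply/seteqP; split => w h i.
  by move=> _; exact: h.
by apply: h; rewrite /= inE.
Qed.

End joint_law.

(** * From the given probability space to kernels on coordinates *)

Section transfer.
Context {R : realType} {d : measure_display} {T0 : measurableType d}
  {P : probability T0 R} {n : nat} {dE : 'I_n -> measure_display}
  {E : forall i, measurableType (dE i)}.
Implicit Types (J K : {set 'I_n}).
Variables (X : forall i, {RV P >-> E i}) (p : nat) (W : T0 -> R)
  (WJ : {set 'I_n} -> T0 -> R).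
Hypotheses (p_gt0 : (0 < p)%N) (iX : independent_rvs X).
Hypothesis W4 : W \in Lfun P 4%:E.
Hypothesis hW : completely_degenerate X p W WJ.
Hypothesis W_sqr1 : ('E_P[(fun w => W w ^+ 2)%R] = 1)%E.
Local Notation T := (@cspace n dE E).
Local Notation mu := (joint_law X).
Local Notation V := (joint_rv X).
Local Notation E1 := (Ex mu).

Let mu_rect := joint_law_rect iX.
Let mV : mpres P mu V := mpres_joint X.

Lemma L4_W : L4 P W.
Proof.
have mW : measurable_fun setT W by move: W4; rewrite inE => /andP[/[!inE]].
split => //; have := Lfun_integrable (ler1n R 4) W4.
congr (L1 P _); apply/funext => w.
by rewrite powR_mulrn// -normrX ger0_norm// exprn_even_ge0.
Qed.

Lemma Ex_expectation (F : T0 -> R) : fine 'E_P[F] = Ex P F.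
Proof. by rewrite unlock. Qed.

(** Components of the wrong order vanish only almost surely; their kernels are set to the zero
    function, so that vanishing holds at every point. *)
Lemma kernels_exist : exists g : {set 'I_n} -> T -> R,
  [/\ forall J, measurable_fun setT (g J), forall J, only_depends_on J (g J),
   forall J, #|J| != p -> g J = fun=> 0 &
   forall J, #|J| = p -> forall w, WJ J w = g J (V w)].
Proof.
have [[_ mWJ _] _] := hW.
suff /choice[g hg] : forall J : {set 'I_n}, exists gJ : T -> R,
    [/\ measurable_fun setT gJ, only_depends_on J gJ,
     #|J| != p -> gJ = fun=> 0 & #|J| = p -> forall w, WJ J w = gJ (V w)].
  by exists g; split => J; have [] := hg J.
move=> J; have [Jp|Jp] := eqVneq #|J| p.
  have [gJ [m1 m2 m3]] := doob_dynkin (mWJ J).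
  by exists gJ; split.
by exists (fun=> 0); split => // Jp'; rewrite Jp' eqxx in Jp.
Qed.

Section given_kernels.
Variable g : {set 'I_n} -> T -> R.
Hypotheses (mg : forall J, measurable_fun setT (g J))
  (g_free : forall J, only_depends_on J (g J))
  (g_order : forall J, #|J| != p -> g J = fun=> 0)
  (gE : forall J, #|J| = p -> forall w, WJ J w = g J (V w)).

Lemma g_L1 J : L1 mu (g J).
Proof.
have [Jp|Jp] := eqVneq #|J| p; last by rewrite g_order//; exact: L1_cst.
apply: (mpres_L1_inv mV) => //; have [[_ _ hWJ] _] := hW.
(* [J] is nonempty because [p > 0], so it is not contained in the empty set, and that instance of
   degeneracy includes integrability. *)
have := hWJ J finset.set0.
rewrite finset.subset0 -cards_eq0 Jp -lt0n => /(_ p_gt0)[iJ _ _ _].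
by move: iJ; congr (L1 P _); apply/funext => w; exact: gE.
Qed.

(** An event that ignores coordinate [i] pulls back to the sigma-field of the other variables, where
    the conditional expectation of [WJ J] is 0. *)
Lemma g_degen J i : i \in J -> degen mu i (g J).
Proof.
move=> iJ; have [Jp|Jp] := eqVneq #|J| p; last first.
  by rewrite g_order//; apply: aeW => x; rewrite Ex_cst.
apply: (degenP mu_rect (g_L1 J)) => A mA fA.
have [[_ _ hWJ] _] := hW.
have := hWJ J (~: [set i])%SET.
rewrite finset.subsetC finset.sub1set inE iJ => /(_ isT)[_ _ _ hA].
have mA1 : measurable_fun setT (fun x => \1_A x * g J x).
  by apply: measurable_funM => //; exact: (measurable_indic mA).
rewrite -(mpres_Ex mV mA1).
have : sigma_gen X (~: [set i])%SET (V @^-1` A).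
  have := sigma_gen_mix (T0 := T0) (X := fun j => X j) (i := i) point mA; congr (sigma_gen _ _ _).
  by apply/funext => w; rewrite /preimage /= fA.
move=> /hA; rewrite integral0_eq// integral_mkcond => /(congr1 fine) /= e0; rewrite [RHS]e0.
congr fine; apply: eq_integral => w _; rewrite patchE gE// indicE.
rewrite (_ : (w \in _) = (V w \in A)).
  by case: ifP => _; rewrite ?mul1r ?mul0r.
by apply/idP/idP; rewrite !inE.
Qed.

Lemma ustat_ae : {ae P, forall w, W w = ustat g (V w)}.
Proof.
have [[WE _ _] W0] := hW.
have : {ae P, forall w, forall J : {set 'I_n}, WJ J w = g J (V w)}.
  apply: filter_forall => J; have [Jp|Jp] := eqVneq #|J| p.
    by apply: aeW => w; exact: gE.
  by have /eqP/W0 := Jp; apply: filterS => w ->; rewrite g_order.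
by apply: filterS2 WE => w -> h; apply: eq_bigr => J _.
Qed.

Let mu_ : measurable_fun setT (ustat g).
Proof. exact: measurable_sum. Qed.

Lemma Ex_ustat (f : R -> R) : measurable_fun setT f ->
  Ex P (fun w => f (W w)) = E1 (fun x => f (ustat g x)).
Proof.
move=> mf; rewrite -(mpres_Ex mV); last exact: (measurableT_comp mf).
apply: ae_eq_Ex.
- exact: (measurableT_comp mf (L4_meas L4_W)).
- exact: (measurableT_comp mf (measurableT_comp mu_ mV.1)).
- by apply: filterS ustat_ae => w ->.
Qed.

Lemma ustat_L4_mu : L4 mu (ustat g).
Proof.
split => //; apply: (mpres_L1_inv mV); first exact: measurable_funX.
apply: (ae_eq_L1 _ _ L4_W.2).
  by apply: measurable_funX; exact: (measurableT_comp mu_ mV.1).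
by apply: filterS ustat_ae => w ->.
Qed.

Lemma g_L4 J : L4 mu (g J).
Proof. exact: (g_L4_of_ustat mu_rect g_L1 g_free g_degen g_order ustat_L4_mu). Qed.

Lemma sigma2E J : #|J| = p -> sigma2 P WJ J = gvar mu g J.
Proof.
move=> Jp; rewrite /sigma2 Ex_expectation /gvar -(mpres_Ex mV); last exact: measurable_funX.
by apply: eq_Ex => w; rewrite gE.
Qed.

Lemma varrho_ge (i : 'I_n) :
  \sum_(J : {set 'I_n} | i \in J) gvar mu g J <= varrho P p WJ ^+ 2.
Proof.
rewrite /varrho sqr_sqrtr; last exact: bigmax_ge_id.
apply: le_trans (le_bigmax _ _ i); rewrite big_mkcond [leRHS]big_mkcond.
apply: ler_sum => J _; have [Jp|Jp] /= := eqVneq #|J| p; first by rewrite sigma2E.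
by case: ifP => // _; rewrite (gvar_eq0 mu g_order).
Qed.

Lemma kolmogorov_dist_le :
  (kolmogorov_dist P W <=
   (6 * Num.sqrt `|fine 'E_P[(fun w => W w ^+ 4)%R] - 3| +
    7 * Num.sqrt (4 ^+ p * p%:R * varrho P p WJ ^+ 2))%:E)%E.
Proof.
apply: ub_ereal_sup => _ [t _ <-].
have mt : measurable_fun setT (fun r : R => (r <= t)%R%:R : R).
  rewrite (_ : (fun _ => _) = \1_(`]-oo, t]%classic)); first exact: measurable_indic (measurable_itv _).
  by apply/funext => r; rewrite indicE mem_setE in_itv.
have -> : P [set w | (W w <= t)%R] = (E1 (fun x => (ustat g x <= t)%R%:R))%:E.
  rewrite -(Ex_ustat mt) -Ex_EFin; last first.
    apply/L2_L1/(L2_bdd P (c := 1)); first exact: (measurableT_comp mt (L4_meas L4_W)).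
    by move=> w; have [_|_] := boolP (W w <= t); rewrite ?normr1 ?normr0.
  have mS : measurable [set w | (W w <= t)%R].
    have := L4_meas L4_W measurableT (measurable_itv `]-oo, t]).
    rewrite setTI; congr measurable; apply/seteqP; split => w;
    by rewrite /preimage /= in_itv.
  rewrite -[X in P X]setIT -integral_indic//; apply: eq_integral => w _.
  rewrite indicE; have [Wt|Wt] := boolP (W w <= t); first by rewrite mem_set.
  by rewrite memNset//=; exact/negP.
rewrite -EFinB abse_EFin lee_fin Ex_expectation (Ex_ustat (f := fun r => r ^+ 4)); last exact: measurable_funX.
apply: (kolmogorov_ustat mu_rect p_gt0 g_L4 g_free g_degen g_order).
- rewrite -(Ex_ustat (f := fun r => r ^+ 2)); last exact: measurable_funX.
  by rewrite -Ex_expectation W_sqr1.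
- exact: varrho_ge.
- exact: sqr_ge0.
Qed.

End given_kernels.
End transfer.

Theorem theorem2p1 (R : realType) (p : nat) (hp : (1 <= p)%N) :
  exists kappa : R, 0 < kappa /\
  forall (n : nat) (hn : (p <= n)%N)
    (d : measure_display) (T : measurableType d) (P : probability T R)
    (dE : 'I_n -> measure_display) (E : forall i, measurableType (dE i))
    (X : forall i, {RV P >-> E i})
    (f : (forall i, E i) -> R) (W : T -> R) (WJ : {set 'I_n} -> T -> R),
  independent_rvs X ->
  prod_measurable f ->
  W = (fun w => f (fun i => X i w)) ->
  W \in Lfun P 4%:E ->
  completely_degenerate X p W WJ ->
  'V_P[W]%E = 1%E ->
  'E_P[(fun w => W w ^+ 2)%R]%E = 1%E ->
  (kolmogorov_dist P W <=
   (119 / 10 * Num.sqrt `|fine 'E_P[(fun w => W w ^+ 4)%R] - 3|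
    + (35 / 10 + 108 / 10 * Num.sqrt kappa) * varrho P p WJ)%:E)%E.
Proof.
(* The constant in the lower bound for E[U^2]. The inequality proved has 6 and 7 in place of 11.9
   and 10.8, and no term in [varrho] free of [kappa]. *)
exists (4 ^+ p * p%:R); split; first by apply: mulr_gt0; rewrite ?exprn_gt0// ltr0n.
move=> n _ d T P dE E X f W WJ iX _ _ W4 hW _ W2.
have [g [mg g_free g_order gE]] := kernels_exist hW.
apply: le_trans (kolmogorov_dist_le hp iX W4 hW W2 mg g_free g_order gE) _.
rewrite lee_fin sqrtrM; last by rewrite mulr_ge0// exprn_ge0.
rewrite sqrtr_sqr; have r0 : 0 <= varrho P p WJ by exact: sqrtr_ge0.
rewrite (ger0_norm r0); set a := Num.sqrt _; set b := Num.sqrt _; set r := varrho P p WJ.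
have a0 : 0 <= a by exact: sqrtr_ge0.
have b0 : 0 <= b by exact: sqrtr_ge0.
have br : 0 <= b * r := mulr_ge0 b0 r0.
by rewrite -/r in r0; lra.
Qed.
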